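(* For every finite family $\mathcal{F}$ of graphs with $m_2(\mathcal{F}) > 1$, there exists a positive constant $c_0$ such that, for all $p \le c_0 \cdot n^{-1/m_2(\mathcal{F})}$, \[ \lim_{n\to\infty} \Pr\left( G_{n,p} \in \mathrm{Ram}_\ell(\mathcal{F}, 2)\right) = 0. \]
   Context: $G_{n,p}$ is the binomial random graph on $n$ vertices with edge probability $p$. For a graph $F$, $m_2(F) = \max\left(\left\{ \frac{e_{F'}-1}{v_{F'}-2} : \emptyset \ne F' \subseteq F,\ v_{F'} \ge 3 \right\} \cup \{1/2\}\right)$, where $e$, $v$ denote numbers of edges and vertices; for a family, $m_2(\mathcal{F}) = \min\{m_2(F): F \in \mathcal{F}\}$. $G \in \mathrm{Ram}_\ell(\mathcal{F}, 2)$ means there is an assignment of lists of $2$ colours to the edges of $G$ such that every colouring of the edges from these lists contains a monochromatic copy of some $F \in \mathcal{F}$. *)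

(* Defs.v *)
From HB Require Import structures.
From mathcomp Require Import all_boot all_order all_algebra finmap.
From mathcomp Require Import all_classical all_reals all_analysis.

Set Implicit Arguments.
Unset Strict Implicit.
Unset Printing Implicit Defensive.

Import Order.TTheory GRing.Theory Num.Theory.
Import numFieldNormedType.Exports.

Local Open Scope ring_scope.
Local Open Scope classical_set_scope.

(* Simple graphs with vertex set T, given by a set of two-element edges. *)
Record sgraph (T : finType) := SGraph {
  edges :> {set {set T}};
  _ : [forall e in edges, #|e| == 2%N]
}.

HB.instance Definition _ (T : finType) := [isSub for @edges T].
HB.instance Definition _ (T : finType) := [Finite of sgraph T by <:].

(* Up to isomorphism, every finite graph has vertex set 'I_k for some k. *)
Definition graph : Type := {k : nat & sgraph 'I_k}.

(* (V', E') is a subgraph of F, not necessarily an induced one. *)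
Definition subgraph (T : finType) (F : sgraph T)
    (H : {set T} * {set {set T}}) : bool :=
  (H.2 \subset edges F) && [forall e in H.2, e \subset H.1].

Definition m2 (R : realType) (F : graph) : R :=
  \big[Num.max/2^-1]_(H | subgraph (tagged F) H && (3 <= #|H.1|)%N)
    ((#|H.2|%:R - 1) / (#|H.1|%:R - 2)).

(* The minimum of the m2 of the members; it is meaningful only for nonempty
   families, and the junk value 0 is assigned to the empty one. *)
Definition m2_family (R : realType) (Fs : seq graph) : R :=
  let s := [seq m2 R F | F <- Fs] in \big[Num.min/head 0 s]_(x <- s) x.

(* chi restricted to the edges of G has a monochromatic (not necessarily
   induced) copy of F; the values of chi on non-edges are never used. *)
Definition mono_copy (T U : finType) (G : sgraph T) (chi : {set T} -> nat)
    (F : sgraph U) : Prop :=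
  exists f : U -> T, exists c : nat, injective f /\
    forall e : {set U}, e \in edges F ->
      f @: e \in edges G /\ chi (f @: e) = c.

(* Since G is finite, taking colours in nat is no loss of generality. *)
Definition list_Ramsey (Fs : seq graph) (r : nat) (T : finType) :
    set (sgraph T) :=
  [set G | exists L : {set T} -> {fset nat},
    (forall e, e \in edges G -> #|` L e| = r) /\
    forall chi : {set T} -> nat,
      (forall e, e \in edges G -> chi e \in L e) ->
      exists2 F, F \in Fs & mono_copy G chi (tagged F)].

(* The probability that G_{n,p} belongs to A. *)
Definition Pr_gnp (R : realType) (n : nat) (p : R) (A : set (sgraph 'I_n)) : R :=
  \sum_(G in A) p ^+ #|edges G| * (1 - p) ^+ ('C(n, 2) - #|edges G|).

(* Main.v *)
From HB Require Import structures.
From mathcomp Require Import all_boot all_order all_algebra boolp.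
From mathcomp Require Import zify ring lra.

Set Implicit Arguments.
Unset Strict Implicit.
Unset Printing Implicit Defensive.

Import Order.TTheory GRing.Theory Num.Theory.

(* Let m be the m_2-density of the family.  Call a graph critical if it is
   minimal subject to having at least three vertices and e - 1 >= m (v - 2).
   Every copy of a member of the family contains a critical graph on boundedly
   many vertices, so it suffices to colour without monochromatic critical
   graphs of bounded order.

   Graphs all of whose subgraphs satisfy e <= m v can be coloured from any lists
   of size two.  In a minimal counterexample, let every critical graph have
   minimum degree > k and let x have degree at most 2k + 1.  Then all lists at x
   equal {r, b}, and every k + 1 edges at x extend to a critical graph in either
   colour.  The union of the red ones and the union of the blue ones share all
   neighbours of x, so together they have more than m v edges.  Hence all degrees
   are large, and comparison with the average degree leaves only 3-regular graphs
   with m <= 3/2, which decompose into two forests, and 4-regular ones with m = 2,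
   which reduce to the complete graph on five vertices.

   In a minimal non-colourable subgraph X of the random graph, every edge lies in
   two critical graphs.  Explore X by attaching critical graphs one by one.
   Attaching along a single edge a graph with e - 1 = m (v - 2) is a regular step
   and has expected multiplicity O(c0); any other step is degenerate and has
   expected multiplicity n^(-epsilon).  A leaf is a regularly attached graph that
   nothing else touches; attaching at two edges of a leaf increases the number of
   leaves, and a degenerate step destroys boundedly many of them.  So an
   exploration with few degenerate steps either runs for log n steps, or gets
   stuck at a graph of bounded size.  The former is unlikely, and so are many
   degenerate steps; the latter yields a graph with more than m v edges, which is
   unlikely too, or a piece of X that can be coloured separately. *)

(** * Critical graphs *)

(** The obstacle to a plain union bound is the choice of the edge at which the next graph is
    attached. A regular step at a prescribed edge costs [O(c0)], but the explored graph grows to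
    order [log n] edges, so a free choice of the edge would cost [O(c0 log n)], which no constant
    [c0] compensates. Leaves remove this choice: every edge lies in a second critical graph, so the
    exploration may dictate the edges, namely two edges of a leaf that are picked from the explored
    graph alone. A free choice remains only when there is no leaf, and then the count of leaves
    bounds the number of steps so far, hence the explored graph, by a constant. Two edges of a leaf
    are used because the first attachment may destroy that leaf and thus merely replaces it. The
    constants are chosen in the order [K], gain of a degenerate step, number [N] of degenerate
    steps, size bound [B], [c0]; so [c0] has to beat only [B] choices, and nothing is circular. *)

Section EdgeSets.
Variable T : finType.
Implicit Types (E F : {set {set T}}) (e f W : {set T}) (x y : T).

Definition pairs E : bool := [forall e in E, #|e| == 2].

Definition star E x : {set {set T}} := [set e in E | x \in e].

Lemma in_star E x e : (e \in star E x) = (e \in E) && (x \in e).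
Proof. by rewrite inE. Qed.

Lemma star_sub E x : star E x \subset E.
Proof. by apply/subsetP => e; rewrite in_star => /andP[]. Qed.

Lemma pairsP E : reflect (forall e, e \in E -> #|e| = 2) (pairs E).
Proof. exact: (iffP 'forall_in_eqP). Qed.

Lemma pairs_sub E F : F \subset E -> pairs E -> pairs F.
Proof. by move=> /subsetP sFE /pairsP pE; apply/pairsP => e /sFE /pE. Qed.

Lemma pairsU E F : pairs E -> pairs F -> pairs (E :|: F).
Proof.
move=> /pairsP pE /pairsP pF; apply/pairsP => e.
by rewrite inE => /orP[/pE|/pF].
Qed.

Lemma in_coverP x E : reflect (exists2 e, e \in E & x \in e) (x \in cover E).
Proof. exact: bigcupP. Qed.

Lemma sub_cover e E : e \in E -> e \subset cover E.
Proof. by move=> eE; apply/subsetP => x xe; apply/in_coverP; exists e. Qed.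

Lemma coverS E F : E \subset F -> cover E \subset cover F.
Proof.
move=> /subsetP sEF; apply/subsetP => x /in_coverP[e /sEF eF xe].
by apply/in_coverP; exists e.
Qed.

Lemma coverU E F : cover (E :|: F) = cover E :|: cover F.
Proof. exact: bigcup_setU. Qed.

Lemma cover_set1 e : cover [set e] = e.
Proof. exact: big_set1. Qed.

Lemma coverI_sub E F : cover (E :&: F) \subset cover E :&: cover F.
Proof. by rewrite subsetI !coverS ?subsetIl ?subsetIr. Qed.

Lemma pair_eq e f : #|e| = 2 -> #|f| = 2 -> e \subset f -> e = f.
Proof. by move=> ce cf sef; apply/eqP; rewrite eqEcard sef ce cf. Qed.

Lemma pair_other e x : #|e| = 2 -> x \in e -> exists2 y, y != x & e = [set x; y].
Proof.
move=> /eqP /cards2P[a [b [ab ->]]]; rewrite !inE => /orP[] /eqP ->.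
  by exists b; rewrite // eq_sym.
by exists a; rewrite // setUC.
Qed.

Lemma card_pairs_small E W : pairs E -> cover E \subset W -> (#|W| <= 2)%N ->
  (#|E| <= 1)%N.
Proof.
move=> /pairsP pE sEW cW; rewrite -(cards1 W); apply: subset_leq_card.
apply/subsetP => e eE; rewrite inE eqEcard (pE _ eE) cW andbT.
exact: subset_trans (sub_cover eE) sEW.
Qed.

Lemma card_pairs_cover E e : pairs E -> e \in E -> (2 <= #|cover E|)%N.
Proof. by move=> /pairsP pE eE; rewrite -(pE _ eE) subset_leq_card ?sub_cover. Qed.

Lemma star_out E x : x \notin cover E -> star E x = set0.
Proof.
move=> nx; apply/setP => e; rewrite in_star inE; apply/negP => /andP[eE xe].
by case/negP: nx; apply/in_coverP; exists e.
Qed.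

Lemma handshake E : pairs E -> (\sum_(x in cover E) #|star E x| = #|E|.*2)%N.
Proof.
move=> /pairsP pE.
have -> : (\sum_(x in cover E) #|star E x| = \sum_x \sum_(e in E) (x \in e))%N.
  rewrite big_mkcond; apply: eq_bigr => x _; case: ifPn => [_|nx]; last first.
    rewrite big1 // => e eE; case: (boolP (x \in e)) => // xe.
    by case/negP: nx; apply/in_coverP; exists e.
  by rewrite -sum1dep_card big_mkcondr; apply: eq_bigr => e _; case: (x \in e).
rewrite exchange_big /= -muln2 -sum_nat_const; apply: eq_bigr => e eE.
by rewrite -(pE _ eE) -sum1_card [RHS]big_mkcond; apply: eq_bigr => x _; case: (x \in e).
Qed.

Lemma cover_diff_star E x : cover (E :\: star E x) \subset cover E :\ x.
Proof.
apply/subsetP => y /in_coverP[e]; rewrite !inE => /andP[nx eE] ye.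
rewrite eE /= in nx.
apply/andP; split; first by apply: contraNneq nx => <-.
by apply/in_coverP; exists e.
Qed.

Lemma card_cover_star E x : pairs E -> x \in cover E ->
  #|cover (star E x)| = #|star E x|.+1.
Proof.
move=> pE /in_coverP[e0 e0E xe0].
have xc : x \in cover (star E x).
  by apply/in_coverP; exists e0 => //; rewrite in_star e0E.
rewrite (cardsD1 x) xc /= add1n; congr _.+1.
pose g (e : {set T}) := odflt x [pick y in e :\ x].
have gP e : e \in star E x -> g e != x /\ e = [set x; g e].
  rewrite in_star => /andP[eE xe].
  have [y yx ee] := pair_other (pairsP _ pE _ eE) xe.
  rewrite /g; case: pickP => [z|/(_ y)]; last by rewrite ee !inE yx eqxx orbT.
  rewrite ee !inE => /andP[zx]; rewrite (negPf zx) /= => /eqP ->.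
  by split.
have gi : {in star E x &, injective g}.
  by move=> e f /gP[_ ee] /gP[_ ff] gg; rewrite ee ff gg.
rewrite -(card_in_imset gi).
apply: eq_card => y; rewrite !inE; apply/andP/imsetP => [[yx]|[e es ->]].
  move=> /in_coverP[e es ye]; exists e => //.
  have [gx ee] := gP _ es; move: ye; rewrite {1}ee !inE (negPf yx) /=.
  by move/eqP.
have [gx ee] := gP _ es; split => //; apply/in_coverP; exists e => //.
by rewrite {2}ee !inE eqxx orbT.
Qed.

End EdgeSets.

Section Critical.
Variables (R : realFieldType) (T : finType) (m : R).
Implicit Types (C D E F H U : {set {set T}}) (e f W : {set T}) (x : T).

Local Open Scope ring_scope.

Definition crit E : bool :=
  [&& pairs E, (3 <= #|cover E|)%N, m * (#|cover E|%:R - 2) <= #|E|%:R - 1 &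
    [forall F : {set {set T}}, (F \proper E) && (3 <= #|cover F|)%N ==>
      (#|F|%:R - 1 < m * (#|cover F|%:R - 2))]].

Definition exact E : bool := #|E|%:R - 1 == m * (#|cover E|%:R - 2).

Hypothesis m1 : 1 < m.

Local Ltac mlra := have ? := m1; lra.
Local Ltac mnra := have ? := m1; nra.

Lemma crit_pairs E : crit E -> pairs E.
Proof. by case/and4P. Qed.

Lemma crit_cover E : crit E -> (3 <= #|cover E|)%N.
Proof. by case/and4P. Qed.

Lemma crit_dense E : crit E -> m * (#|cover E|%:R - 2) <= #|E|%:R - 1.
Proof. by case/and4P. Qed.

Lemma crit_card E : crit E -> (3 <= #|E|)%N.
Proof.
move=> cE; have := crit_dense cE; have := crit_cover cE.
rewrite -(ler_nat R) => h3 h.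
have h4 : 0 <= (m - 1) * (#|cover E|%:R - 3) by apply: mulr_ge0; mlra.
have : 2 < #|E|%:R :> R by mlra.
by rewrite (ltr_nat R 2).
Qed.

Lemma crit_proper_lt E F : crit E -> F \proper E -> (3 <= #|cover F|)%N ->
  #|F|%:R - 1 < m * (#|cover F|%:R - 2).
Proof. by case/and4P=> _ _ _ /forallP /(_ F) /implyP h pF cF; apply: h; rewrite pF. Qed.

(** Minimality speaks of subgraphs with three vertices; below that there is at most one edge, and
    two elements of [W] suffice. [W] may exceed [cover F] because the typical use takes for [W] the
    common vertices of two graphs and for [F] their common edges. *)
Lemma crit_sub_le E F W : crit E -> F \proper E -> cover F \subset W ->
  (2 <= #|W|)%N -> #|F|%:R - 1 <= m * (#|W|%:R - 2).
Proof.
move=> cE pF sFW W2.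
have W2R : 2 <= #|W|%:R :> R by rewrite (ler_nat R 2).
have := subset_leq_card sFW; rewrite -(ler_nat R) => sR.
case: (leqP 3 #|cover F|) => c3.
  by have := crit_proper_lt cE pF c3; mnra.
have F1 : (#|F| <= 1)%N.
  exact: (card_pairs_small (pairs_sub (proper_sub pF) (crit_pairs cE)) (subxx _)).
by move: F1; rewrite -(ler_nat R); mnra.
Qed.

Lemma crit_sub_lt E F W : crit E -> F \proper E -> cover F \subset W ->
  (3 <= #|W|)%N -> #|F|%:R - 1 < m * (#|W|%:R - 2).
Proof.
move=> cE pF sFW W3.
have W3R : 3 <= #|W|%:R :> R by rewrite (ler_nat R 3).
have := subset_leq_card sFW; rewrite -(ler_nat R) => sR.
case: (leqP 3 #|cover F|) => c3.
  by have := crit_proper_lt cE pF c3; mnra.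
have F1 : (#|F| <= 1)%N.
  exact: (card_pairs_small (pairs_sub (proper_sub pF) (crit_pairs cE)) (subxx _)).
by move: F1; rewrite -(ler_nat R); mnra.
Qed.

Lemma crit_antichain C D : crit C -> crit D -> D \subset C -> C = D.
Proof.
move=> cC cD sDC; apply/eqP; rewrite eq_sym eqEproper sDC /=; apply/negP => pD.
by have := crit_proper_lt cC pD (crit_cover cD); have := crit_dense cD; mlra.
Qed.

Lemma crit_exists E : pairs E -> (3 <= #|cover E|)%N ->
  m * (#|cover E|%:R - 2) <= #|E|%:R - 1 -> exists2 C : {set {set T}}, C \subset E & crit C.
Proof.
move=> pE c3 dE.
pose P F := (3 <= #|cover F|)%N && (m * (#|cover F|%:R - 2) <= #|F|%:R - 1).
have PE : P E by rewrite /P c3.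
have [C /minsetP[/andP[cC dC] minC] sCE] := minset_exists (P := P) PE.
exists C => //; apply/and4P; split => //; first exact: pairs_sub pE.
apply/forallP => F; apply/implyP => /andP[pF cF]; rewrite ltNge.
apply/negP => dF; have PF : P F by apply/andP; split.
by move: (pF); rewrite (minC F PF (proper_sub pF)) properxx.
Qed.

Lemma crit_size3 E : crit E -> #|cover E| = 3 -> m <= 2.
Proof.
move=> cE c3; have := crit_dense cE; rewrite c3.
have /pairsP pE := crit_pairs cE.
have : (#|E| <= 'C(#|cover E|, 2))%N.
  rewrite -cards_draws; apply: subset_leq_card.
  by apply/subsetP => e eE; rewrite inE (pE _ eE) sub_cover ?eqxx.
rewrite c3 (_ : 'C(3, 2) = 3%N) //.
by rewrite -(ler_nat R); mlra.
Qed.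

Lemma card_star_diff E x :
  #|E|%:R = #|star E x|%:R + #|E :\: star E x|%:R :> R.
Proof.
rewrite -natrD -(cardsID (star E x) E); congr (_ + _)%:R.
by rewrite (setIidPr (star_sub E x)).
Qed.

Lemma crit_star_proper E x : x \in cover E -> E :\: star E x \proper E.
Proof.
move=> /in_coverP[e eE xe]; rewrite properE subsetDl /=.
apply/negP => /subsetP /(_ _ eE).
by rewrite inE in_star eE xe.
Qed.

(** Deleting [x] leaves a proper subgraph on at least three vertices, which falls strictly short of
    the density that [E] reaches; the two bounds differ by exactly [m]. *)
Lemma crit_deg_big E x : crit E -> x \in cover E -> (4 <= #|cover E|)%N ->
  m < #|star E x|%:R.
Proof.
move=> cE xE c4; have := card_star_diff E x.
have := crit_dense cE.
have := crit_sub_lt cE (crit_star_proper xE) (cover_diff_star E x).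
move: c4; rewrite (cardsD1 x) xE add1n ltnS => c4 /(_ c4).
rewrite -[#|_ :\ _|.+1%:R]natr1; mlra.
Qed.

Lemma crit_deg2 E x : crit E -> x \in cover E -> (2 <= #|star E x|)%N.
Proof.
move=> cE xE; case: (leqP 4 #|cover E|) => c4.
  by have := crit_deg_big cE xE c4; rewrite -(ltr_nat R); mlra.
have := card_star_diff E x; have := crit_card cE.
have := crit_sub_le cE (crit_star_proper xE) (cover_diff_star E x).
have c3 : #|cover E| = 3 by apply/eqP; rewrite eqn_leq -ltnS c4 crit_cover.
have -> : #|cover E :\ x| = 2%N by move: c3; rewrite (cardsD1 x) xE; lia.
by move=> /(_ isT); rewrite -!(ler_nat R); mlra.
Qed.

Lemma crit_cover_del E e : crit E -> cover (E :\ e) = cover E.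
Proof.
move=> cE; apply/eqP; rewrite eqEsubset coverS ?subsetDl //=.
apply/subsetP => x xE; have := crit_deg2 cE xE.
rewrite (cardsD1 e) => h.
have /card_gt0P[f] : (0 < #|star E x :\ e|)%N.
  by rewrite -(leq_add2l 1); apply: leq_trans h _; rewrite leq_add2r leq_b1.
rewrite !inE => /and3P[fe fE xf].
by apply/in_coverP; exists f; rewrite // !inE fe.
Qed.
End Critical.

(** * Gluing and leaves *)

Section Gluing.
Variables (R : realFieldType) (T : finType) (m : R).
Implicit Types (A B C D E F H U : {set {set T}}) (e f g W : {set T}) (x : T).
Local Open Scope ring_scope.
Hypothesis m1 : 1 < m.
Local Ltac mlra := have ? := m1; lra.
Local Ltac mnra := have ? := m1; nra.

Lemma card_cover_ge3 A e f : #|e| = 2 -> #|f| = 2 -> e \in A -> e != f ->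
  (3 <= #|cover A :|: f|)%N.
Proof.
move=> ce cf eA nef; rewrite leqNgt; apply: contra nef => h.
have se : e \subset cover A :|: f by rewrite subsetU // sub_cover.
have /eqP -> : e == cover A :|: f by rewrite eqEcard se ce.
by apply/eqP/esym/eqP; rewrite eqEcard subsetUr cf.
Qed.

(** Cut [C] along [f] into the part [A] inside [D :\ f] and the rest [B]. Each part obeys a subgraph
    bound, and over vertex sets that meet in [f] the bounds add up to less than the density of a
    critical graph. *)
Lemma glue D H C f : crit m D -> exact m D -> f \in D -> pairs H ->
  cover D :&: cover H \subset f -> crit m C -> C \subset H :|: D ->
  C \subset f |: H \/ C = D.
Proof.
move=> cD /eqP xD fD pH sDH cC sC.
case: (boolP (C \subset f |: H)) => [|nC]; first by left.
right; apply/eqP/negPn/negP => CD.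
have /pairsP pC := crit_pairs cC; have /pairsP pD := crit_pairs cD.
have cf := pD _ fD.
pose A := C :&: (D :\ f); pose B := C :\: (D :\ f).
have [e eA] : exists e, e \in A.
  have /subsetPn[e eC eN] := nC; exists e; rewrite !inE eC /=.
  move: eN; rewrite !inE negb_or => /andP[-> eH] /=.
  by move/subsetP: sC => /(_ _ eC); rewrite inE (negPf eH).
have [eC eD nef] : [/\ e \in C, e \in D & e != f].
  by move: eA; rewrite !inE => /and3P[-> -> ->].
have sBH : B \subset f |: H.
  apply/subsetP => b; rewrite !inE => /andP[]; rewrite negb_and negbK.
  case: eqP => //= _ bD bC.
  by move/subsetP: sC => /(_ _ bC); rewrite inE (negPf bD) orbF.
have pB : B \proper C.
  rewrite properE subsetDl; apply/subsetPn; exists e => //.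
  by rewrite !inE nef eD.
pose WA := cover A :|: f; pose WB := cover B :|: f.
have sfA : f |: A \subset D.
  apply/subsetP => x; rewrite !inE => /orP[/eqP -> //|].
  by case/and3P.
have cfA : cover (f |: A) = WA by rewrite coverU cover_set1 setUC.
have sfAW : cover (f |: A) \subset WA by rewrite cfA.
have WAB : WA :&: WB = f.
  apply/eqP; rewrite eqEsubset; apply/andP; split; last first.
    by rewrite subsetI !subsetUr.
  apply/subsetP => x; rewrite !inE => /andP[/orP[xA|//] /orP[xB|//]].
  have /subsetP/(_ _ xA) xD' : cover A \subset cover D.
    by apply: coverS; apply: subset_trans sfA; rewrite subsetUr.
  have /subsetP/(_ _ xB) := coverS sBH.
  rewrite coverU cover_set1 inE => /orP[//|xH].
  by move/subsetP: sDH; apply; rewrite inE xD'.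
have cWU : #|WA|%:R + #|WB|%:R = #|WA :|: WB|%:R + 2 :> R.
  by rewrite -!natrD -cardsUI WAB cf.
have cWUm : m * #|WA|%:R + m * #|WB|%:R = m * #|WA :|: WB|%:R + m * 2.
  by rewrite -!mulrDr cWU.
have CAB : C = A :|: B by rewrite setID.
have cCf : cover C :|: f = WA :|: WB.
  by rewrite {1}CAB coverU /WA /WB setUACA setUid.
have cardC : #|C|%:R = #|A|%:R + #|B|%:R :> R by rewrite -natrD cardsID.
have WA3 : (3 <= #|WA|)%N := card_cover_ge3 (pC _ eC) cf eA nef.
have WB2 : (2 <= #|WB|)%N by rewrite -cf subset_leq_card ?subsetUr.
have nfA : f \notin A by rewrite !inE eqxx andbF.
have cardfA : #|f |: A|%:R = #|A|%:R + 1 :> R.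
  by rewrite cardsU1 nfA natrD addrC.
have dC := crit_dense cC.
case: (boolP (f \in C)) => fC.
  have pfA : f |: A \proper D.
    rewrite properEneq sfA andbT; apply: contraNneq CD => eD'.
    rewrite (crit_antichain m1 cC cD) // -eD'; apply/subsetP => x.
    by rewrite !inE => /orP[/eqP -> //|/andP[]].
  have := crit_sub_lt m1 cD pfA sfAW WA3.
  have := crit_sub_le m1 cC pB (subsetUl _ _) WB2.
  have cCW : cover C = WA :|: WB by rewrite -cCf (setUidPl (sub_cover fC)).
  by move: dC; rewrite cCW; mlra.
(* As [f] is not in [C], all of [D] except [f] may lie in [C]; exactness of [D] bounds [A] in that
   case. *)
have hA : #|A|%:R <= m * (#|WA|%:R - 2).
  case: (eqVneq (f |: A) D) => [eD'|nD].
    by rewrite -cfA; move: xD; rewrite -eD' cardfA; mlra.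
  have pfA : f |: A \proper D by rewrite properEneq nD.
  by have := crit_sub_lt m1 cD pfA sfAW WA3; mlra.
have [B0|[b bB]] := set_0Vmem B.
  have CA : C \subset D by rewrite CAB B0 setU0 (subset_trans _ sfA) ?subsetUr.
  by case/negP: fC; rewrite -(crit_antichain m1 cD cC CA).
have bC : b \in C by move: bB; rewrite inE => /andP[].
have nbf : b != f by apply: contraNneq fC => <-.
have WB3 : (3 <= #|WB|)%N := card_cover_ge3 (pC _ bC) cf bB nbf.
have hB := crit_sub_lt m1 cC pB (subsetUl _ _) WB3.
case: (boolP (f \subset cover C)) => fsC.
  have cCW : cover C = WA :|: WB by rewrite -cCf (setUidPl fsC).
  by move: dC; rewrite cCW; mlra.
have pA : A \proper C.
  rewrite properE subsetIl; apply/subsetPn; exists b => //.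
  by move: bB; rewrite !inE; case: (b \in C) => //; rewrite andbT => /negPf ->.
have cA2 : (2 <= #|cover A|)%N.
  by apply: (@card_pairs_cover _ _ e) => //; apply: pairs_sub (crit_pairs cC); exact: proper_sub.
have cB2 : (2 <= #|cover B|)%N.
  by apply: (@card_pairs_cover _ _ b) => //; apply: pairs_sub (crit_pairs cC); exact: proper_sub.
have hA' := crit_sub_le m1 cC pA (subxx _) cA2.
have hB' := crit_sub_le m1 cC pB (subxx _) cB2.
have sAB : cover A :&: cover B \subset f by rewrite -WAB setISS ?subsetUl.
(* With at most one shared vertex, the bounds of the parts give [|C| - 1 <= m (v - 2) - (m - 1)] for
   the [v] vertices of [C], and [m > 1]. *)
have s1 : (#|cover A :&: cover B| <= 1)%N.
  rewrite leqNgt; apply: contra fsC => h.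
  have /eqP <- : cover A :&: cover B == f by rewrite eqEcard sAB cf.
  by rewrite (subset_trans (subsetIl _ _)) // coverS // proper_sub.
have cU : #|cover C|%:R + #|cover A :&: cover B|%:R = #|cover A|%:R + #|cover B|%:R :> R.
  by rewrite -!natrD {1}CAB coverU cardsUI.
move: s1; rewrite -(ler_nat R) => s1.
have : 0 <= m * (1 - #|cover A :&: cover B|%:R) by rewrite mulr_ge0; mlra.
have -> : #|cover A :&: cover B|%:R = #|cover A|%:R + #|cover B|%:R - #|cover C|%:R :> R.
  by mlra.
by mlra.
Qed.

Variable K : nat.

Definition critK E := crit m E && (#|cover E| <= K)%N.

(** [e] is the edge at which [C] hangs on the rest of [U], called its attaching edge below. *)
Definition leaf U C e := [&& C \subset U, critK C, exact m C, e \in C &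
  cover C :&: cover (U :\: C) \subset e].

Definition leaves U := [set C | [exists e, leaf U C e]].

Definition reg U f D := [&& critK D, exact m D, f \in D, f \in U &
  cover D :&: cover U \subset f].

Lemma critK_crit E : critK E -> crit m E.
Proof. by case/andP. Qed.

Lemma leaf_other U C e D : pairs U -> leaf U C e -> D \subset U -> crit m D ->
  D != C -> D \subset e |: (U :\: C).
Proof.
move=> pU /and5P[sC kC xC eC sCe] sD cD DC.
have sDU : D \subset (U :\: C) :|: C.
  by apply: subset_trans sD _; apply/subsetP => x xU; rewrite !inE xU andbT orNb.
have pUC : pairs (U :\: C) by apply: pairs_sub pU; exact: subsetDl.
have [//|eq] := glue (critK_crit kC) xC eC pUC sCe cD sDU.
by rewrite eq eqxx in DC.
Qed.

(** By [leaf_other], [D] without [e] has no edge in [C]; having minimum degree two, [D] loses no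
    vertex with [e]. So vertices shared with [C] are shared by [C] and the rest of [U]. *)
Lemma leaf_meet U C e D x : pairs U -> leaf U C e -> D \subset U -> crit m D ->
  D != C -> x \in cover D -> x \in cover C -> x \in e.
Proof.
move=> pU lC sD cD DC xD xC; have := leaf_other pU lC sD cD DC.
case/and5P: lC => sC kC exC eC /subsetP sCe /subsetP s.
rewrite -(crit_cover_del m1 e cD) in xD.
apply: sCe; rewrite inE xC /=; apply/subsetP: xD; apply: coverS.
by apply/subsetP => y; rewrite !inE => /andP[ye /s]; rewrite !inE (negPf ye).
Qed.

Lemma leaf_keep U C e D : leaf U C e ->
  (forall x, x \in cover D -> x \in cover C -> x \in e) -> leaf (U :|: D) C e.
Proof.
case/and5P => sC kC exC eC /subsetP sCe h; apply/and5P; split => //.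
  by rewrite subsetU ?sC.
apply/subsetP => x; rewrite inE setDUl coverU inE => /andP[xC /orP[xU|xD]].
  by apply: sCe; rewrite inE xC.
by apply: h => //; apply: (subsetP (coverS (subsetDl D C))).
Qed.

Lemma leaf_new U f D : reg U f D -> leaf (U :|: D) D f.
Proof.
case/and5P => kD xD fD fU s; apply/and5P; split => //; first exact: subsetUr.
apply: subset_trans s; rewrite setIS // coverS //.
by rewrite setDUl setDv setU0 subsetDl.
Qed.

Lemma reg_notin U f D : pairs U -> reg U f D -> ~~ (D \subset U).
Proof.
move=> /pairsP pU /and5P[kD xD fD fU s]; apply/negP => sDU.
have /subset_leq_card : cover D \subset f.
  by apply: subset_trans s; rewrite subsetI subxx coverS.
by rewrite (pU _ fU) leqNgt (crit_cover (critK_crit kD)).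
Qed.

Lemma leavesP U C : reflect (exists e, leaf U C e) (C \in leaves U).
Proof. by rewrite inE; apply: existsP. Qed.

Lemma leavesW U C : C \in leaves U -> C \subset U /\ critK C.
Proof. by case/leavesP => e /and5P[]. Qed.

Lemma leaves_reg U f D : reg U f D -> (0 < #|leaves (U :|: D)|)%N.
Proof.
by move=> r; apply/card_gt0P; exists D; apply/leavesP; exists f; apply: leaf_new.
Qed.

(** [D] touches [U] only inside [f], hence inside [C], and another leaf meets [C] only in its own
    attaching edge. *)
Lemma leaves_keep_reg U C e f D E : pairs U -> leaf U C e -> f \in C ->
  reg U f D -> E \in leaves U -> E != C -> E \in leaves (U :|: D).
Proof.
move=> pU lC fC rD /leavesP[d lE] EC; apply/leavesP; exists d.
case/and5P: (lE) => sE kE _ _ _; case/and5P: (lC) => sC kC _ _ _.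
apply: leaf_keep => // x xD xE.
have xU : x \in cover U by apply: (subsetP (coverS sE)).
case/and5P: rD => _ _ _ _ /subsetP /(_ x); rewrite inE xD xU => /(_ isT) xf.
apply: (leaf_meet pU lE sC (critK_crit kC)) => //; first by rewrite eq_sym.
by apply/in_coverP; exists f.
Qed.

Lemma leaves_half U C e f D : pairs U -> leaf U C e -> f \in C -> reg U f D ->
  (#|leaves U| <= #|leaves (U :|: D)|)%N.
Proof.
move=> pU lC fC rD.
have CU : C \in leaves U by apply/leavesP; exists e.
have DU : D \notin leaves U.
  by apply: contra (reg_notin pU rD) => /leavesW[].
rewrite (cardsD1 C) CU (leq_trans _ (subset_leq_card (_ : D |: (leaves U :\ C) \subset _))) //.
  by rewrite cardsU1 in_setD1 (negPf DU) andbF.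
apply/subsetP => E; rewrite in_setU1 => /orP[/eqP ->|].
  by apply/leavesP; exists f; apply: leaf_new.
by rewrite in_setD1 => /andP[EC EU]; apply: leaves_keep_reg lC fC rD EU _.
Qed.

(** [C] may stop being a leaf, while [D] and [F] become leaves. [D] stays one because [F] touches
    [U :|: D] only in [g], an edge of [U], and [D] touches [U] only in [f]. *)
Lemma leaves_good U C e f g D F : pairs U -> leaf U C e -> f \in C -> g \in C ->
  reg U f D -> reg (U :|: D) g F ->
  (#|leaves U| < #|leaves (U :|: D :|: F)|)%N.
Proof.
move=> pU lC fC gC rD rF.
have CU : C \in leaves U by apply/leavesP; exists e.
have DU : D \notin leaves U.
  by apply: contra (reg_notin pU rD) => /leavesW[].
have pD : pairs D by case/and5P: rD => /critK_crit /crit_pairs.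
have FUD := reg_notin (pairsU pU pD) rF.
have FU : F \notin leaves U.
  by apply: contra FUD => /leavesW[s _]; rewrite subsetU ?s.
have DF : D != F by apply: contraNneq FUD => <-; exact: subsetUr.
have hs : D |: (F |: (leaves U :\ C)) \subset leaves (U :|: D :|: F).
  apply/subsetP => E; rewrite in_setU1 => /orP[/eqP ->|].
    apply/leavesP; exists f; apply: leaf_keep; first exact: leaf_new.
    move=> x xF xD; case/and5P: rF => _ _ _ _ /subsetP /(_ x).
    rewrite inE xF coverU inE xD orbT => /(_ isT) xg.
    case/and5P: rD => _ _ _ _ /subsetP; apply; rewrite inE xD /=.
    have sC : C \subset U by case/and5P: lC.
    by apply: (subsetP (coverS sC)); apply/in_coverP; exists g.
  rewrite in_setU1 => /orP[/eqP ->|].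
    by apply/leavesP; exists g; apply: leaf_new.
  rewrite in_setD1 => /andP[EC EU].
  have /leavesP[d lE] := leaves_keep_reg pU lC fC rD EU EC.
  apply/leavesP; exists d; apply: leaf_keep => // x xF xE.
  have [sE _] := leavesW EU.
  have xU : x \in cover (U :|: D).
    by rewrite coverU inE (subsetP (coverS sE)).
  case/and5P: rF => _ _ _ _ /subsetP /(_ x); rewrite inE xF xU => /(_ isT) xg.
  case/and5P: (lC) => sC kC _ _ _.
  apply: (leaf_meet (pairsU pU pD) lE _ (critK_crit kC)) => //.
  - by rewrite subsetU ?sC.
  - by rewrite eq_sym.
  - by apply/in_coverP; exists g.
rewrite (cardsD1 C) CU (leq_trans _ (subset_leq_card hs)) //.
by rewrite !cardsU1 in_setU1 !in_setD1 (negPf DU) (negPf FU) (negPf DF) !andbF.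
Qed.

(** A leaf is lost only if [D] contains one of its vertices off its attaching edge. By [leaf_meet]
    such a vertex belongs to no other leaf, so the lost leaves inject into the at most [K] vertices
    of [D]. *)
Lemma leaves_bad U D : pairs U -> critK D ->
  (#|leaves U| <= #|leaves (U :|: D)| + K)%N.
Proof.
move=> pU /andP[_ cK].
rewrite -(cardsID (leaves (U :|: D)) (leaves U)) leq_add //.
  by rewrite subset_leq_card ?subsetIr.
apply: leq_trans cK.
have hP C : C \in leaves U :\: leaves (U :|: D) ->
    exists x, [&& x \in cover D, x \in cover C & [exists e, leaf U C e && (x \notin e)]].
  rewrite in_setD => /andP[nC /leavesP[e lC]].
  apply/existsP; apply: contraR nC; rewrite negb_exists => /forallP h.
  apply/leavesP; exists e; apply: leaf_keep => // x xD xC.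
  apply: contraR (h x) => xe; rewrite xD xC; apply/existsP; exists e.
  by rewrite lC.
have [->|[C0 C0in]] := set_0Vmem (leaves U :\: leaves (U :|: D)).
  by rewrite cards0.
have [x0 _] := hP _ C0in.
pose h C := odflt x0 [pick x | [&& x \in cover D, x \in cover C & [exists e, leaf U C e && (x \notin e)]]].
have hh C : C \in leaves U :\: leaves (U :|: D) ->
    [&& h C \in cover D, h C \in cover C & [exists e, leaf U C e && (h C \notin e)]].
  by move=> /hP[x hx]; rewrite /h; case: pickP => [//|/(_ x)]; rewrite hx.
rewrite -(@card_in_imset _ _ h); last first.
  move=> C C' iC iC' eh; apply/eqP; apply: contraT => CC'.
  have /and3P[_ hC /existsP[e /andP[lC /negP[]]]] := hh _ iC.
  have /and3P[_ hC' _] := hh _ iC'.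
  move: iC'; rewrite in_setD => /andP[_ /leavesW[sC' kC']].
  apply: (leaf_meet pU lC sC' (critK_crit kC')) => //; first by rewrite eq_sym.
  by rewrite eh.
apply: subset_leq_card; apply/subsetP => x /imsetP[C iC ->].
by case/and3P: (hh _ iC).
Qed.

End Gluing.

(** * Colouring a star from lists *)

Definition list_choice (I : Type) (p q s : I -> nat) : Prop :=
  forall e, s e = p e \/ s e = q e.

Section ListBalance.
Variables (I : finType) (S : {set I}) (p q : I -> nat).

Let sel (b : {ffun I -> bool}) e := if b e then p e else q e.
Let alt (b : {ffun I -> bool}) e := if b e then q e else p e.
Let flip (b : {ffun I -> bool}) e0 : {ffun I -> bool} :=
  [ffun e => if e == e0 then ~~ b e else b e].
Let cnt (A : {set I}) b c := #|[set e in A | sel b e == c]|.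
Let clashes b := \sum_(e in S) \sum_(f in S) (sel b e == sel b f).

Lemma sel_choice b : list_choice p q (sel b).
Proof. by move=> e; rewrite /sel; case: (b e); [left|right]. Qed.

Lemma sel_flip b e0 e : sel (flip b e0) e = if e == e0 then alt b e else sel b e.
Proof. by rewrite /sel /alt ffunE; case: eqP => // _; case: (b e). Qed.

Lemma cntE A b c : cnt A b c = \sum_(e in A) (sel b e == c).
Proof.
rewrite /cnt -sum1dep_card big_mkcondr; apply: eq_bigr => e _.
by case: (_ == c).
Qed.

Lemma clashes_split b e0 : e0 \in S ->
  clashes b = (cnt (S :\ e0) b (sel b e0)).*2.+1
    + \sum_(e in S :\ e0) \sum_(f in S :\ e0) (sel b e == sel b f).
Proof.
move=> e0S; rewrite /clashes (big_setD1 e0) //= (big_setD1 e0) //= eqxx.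
under [X in _ + _ + X = _]eq_bigr => e eS do rewrite (big_setD1 e0) //=.
rewrite big_split /= !cntE -addnn.
under eq_bigr => e eS do rewrite eq_sym.
by rewrite -!addnA add1n addSn -addnA.
Qed.

Lemma cnt_flip b e0 c : cnt (S :\ e0) (flip b e0) c = cnt (S :\ e0) b c.
Proof.
rewrite !cntE; apply: eq_bigr => e; rewrite !inE => /andP[ne _].
by rewrite sel_flip (negPf ne).
Qed.

Lemma cnt_split b e0 c : e0 \in S -> cnt S b c = (sel b e0 == c) + cnt (S :\ e0) b c.
Proof. by move=> e0S; rewrite !cntE (big_setD1 e0). Qed.

Lemma cnt_two b c c' : c != c' -> cnt S b c + cnt S b c' <= #|S|.
Proof.
move=> cc'; rewrite /cnt -cardsUI.
have -> : [set e in S | sel b e == c] :&: [set e in S | sel b e == c'] = set0.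
  apply/setP => e; rewrite !inE; case: (e \in S) => //=.
  by case: eqP => // ->; rewrite (negPf cc').
rewrite cards0 addn0; apply: subset_leq_card.
by apply/subsetP => e; rewrite !inE => /orP[] /andP[].
Qed.

Lemma list_balance k : 0 < k -> (forall e, p e != q e) ->
  (forall s, list_choice p q s -> exists c, k < #|[set e in S | s e == c]|) ->
  k.*2 < #|S| /\ (#|S| = k.*2.+1 -> exists r b, r != b /\
     forall e, e \in S -> (p e = r /\ q e = b) \/ (p e = b /\ q e = r)).
Proof.
move=> k0 pq hyp.
pose b := [arg min_(b' < [ffun=> true]) clashes b'].
have bmin b' : clashes b <= clashes b' by rewrite /b; case: arg_minnP => // b0 _ ->.
have sa e : sel b e != alt b e.
  by rewrite /sel /alt; case: (b e); rewrite // eq_sym.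
have step e0 : e0 \in S ->
    cnt (S :\ e0) b (sel b e0) <= cnt S b (alt b e0).
  move=> e0S; have := bmin (flip b e0); rewrite !(clashes_split _ e0S).
  under [X in _ <= _ + X]eq_bigr => e.
    rewrite !inE => /andP[ne _].
    under eq_bigr => f.
      rewrite !inE => /andP[nf _]; rewrite !sel_flip (negPf ne) (negPf nf); over.
    over.
  rewrite leq_add2r ltnS leq_double sel_flip eqxx cnt_flip.
  by rewrite (cnt_split _ (alt b e0) e0S) (negPf (sa e0)).
have [c ck] := hyp _ (sel_choice b).
have big e0 : e0 \in S -> sel b e0 = c -> k <= cnt S b (alt b e0) /\ c != alt b e0.
  move=> e0S ec; split; last by rewrite -ec.
  apply: leq_trans (step _ e0S); move: ck; rewrite -/(cnt S b c) ec.
  by rewrite (cnt_split _ _ e0S) ec eqxx.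
have [e1] : exists e, e \in [set e in S | sel b e == c].
  by apply/card_gt0P; exact: leq_ltn_trans ck.
rewrite inE => /andP[e1S /eqP e1c].
have [h1 cc1] := big _ e1S e1c.
have h2 := cnt_two b cc1.
rewrite -/(cnt S b c) in ck.
split=> [|cS]; first by rewrite -addnn; lia.
set c' := alt b e1 in h1 cc1 h2.
have nc : cnt S b c = k.+1 by lia.
have nc' : cnt S b c' = k by lia.
have two e : e \in S -> sel b e = c \/ sel b e = c'.
  move=> eS; case: (eqVneq (sel b e) c) => [|n1]; first by left.
  case: (eqVneq (sel b e) c') => [|n2]; first by right.
  have : cnt S b c + cnt S b c' <= #|S :\ e|.
    apply: leq_trans (subset_leq_card (_ : [set f in S | (sel b f == c) || (sel b f == c')] \subset _)).
      rewrite /cnt -cardsUI (_ : _ :&: _ = set0) ?cards0 ?addn0.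
        by apply: subset_leq_card; apply/subsetP => f; rewrite !inE; case: (f \in S).
      apply/setP => f; rewrite !inE; case: (f \in S) => //=.
      by case: eqP => // ->; rewrite (negPf cc1).
    apply/subsetP => f; rewrite !inE => /andP[-> h]; rewrite andbT.
    by apply: contraTneq h => ->; rewrite (negPf n1) (negPf n2).
  by have := cardsD1 e S; rewrite eS; lia.
have altc e : e \in S -> sel b e = c -> alt b e = c'.
  move=> eS ec; have [h nca] := big _ eS ec.
  have : 0 < cnt S b (alt b e) by exact: leq_trans h.
  move=> /card_gt0P[f]; rewrite inE => /andP[fS /eqP fa].
  case: (two _ fS) => h'; last by rewrite -fa.
  by move: nca; rewrite -fa h' eqxx.
have altc' f : f \in S -> sel b f = c' -> alt b f = c.
  move=> fS fc'; apply/eqP; apply: contraT => nfc.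
  have ne1f : e1 != f.
    by apply: contraNneq cc1 => ef; rewrite -e1c ef fc'.
  (* Flip one edge of either colour. If the other colour of [f] were not [c], then [c] would drop to
     [k], [c'] would stay at [k], a third colour would occur at most once, and no colour would
     exceed [k]. *)
  have [x] := hyp _ (sel_choice (flip (flip b f) e1)).
  rewrite -/(cnt S _ x) (cnt_split _ _ e1S) cnt_flip sel_flip eqxx.
  have -> : alt (flip b f) e1 = c' by rewrite /alt ffunE (negPf ne1f).
  have fS1 : f \in S :\ e1 by rewrite !inE eq_sym ne1f.
  rewrite cntE (big_setD1 f) //= sel_flip eqxx.
  rewrite (eq_bigr (fun e => (sel b e == x) : nat)); last first.
    by move=> e; rewrite !inE => /andP[ne _]; rewrite sel_flip (negPf ne).
  have := cnt_split b x e1S; rewrite e1c [cnt (S :\ e1) b x]cntE (big_setD1 f) //= fc'.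
  set y := \sum_(_ in _) _ => hx; have := sa f; rewrite fc' => sf.
  case: (eqVneq c x) hx => [<-|cx] hx.
    by rewrite [c' == c]eq_sym (negPf cc1) (negPf nfc); move: hx; rewrite nc [c' == c]eq_sym (negPf cc1); lia.
  case: (eqVneq c' x) hx => [<-|cx'] hx.
    rewrite eq_sym (negPf sf); move: hx; rewrite nc'; lia.
  have -> : y = 0.
    have : cnt S b x = 0.
      apply/eqP; rewrite cards_eq0; apply/eqP/setP => e; rewrite !inE.
      apply/negP => /andP[eS /eqP ex].
      by case: (two _ eS) => h; rewrite -ex h eqxx in cx cx'.
    by lia.
  by case: (_ == x); lia.
exists c, c'; split => // e eS.
case: (two _ eS) => h.
  by have := altc _ eS h; move: h; rewrite /sel /alt; case: (b e) => -> ->; [left|right].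
by have := altc' _ eS h; move: h; rewrite /sel /alt; case: (b e) => -> ->; [right|left].
Qed.

End ListBalance.

(** * Sparse graphs are list-colourable *)

Section Colourings.
Variable T : finType.
Implicit Types (chi : {set T} -> nat) (C U : {set {set T}}) (bad : pred {set {set T}}).

Definition mono chi C : bool :=
  [forall e in C, [forall f in C, chi e == chi f]].

Definition good bad chi U : bool :=
  [forall C : {set {set T}}, (C \subset U) && bad C ==> ~~ mono chi C].

Definition colourable bad (p q : {set T} -> nat) U : Prop :=
  exists2 chi, list_choice p q chi & good bad chi U.

Lemma monoP chi C : reflect (exists c, forall e, e \in C -> chi e = c) (mono chi C).
Proof.
apply: (iffP idP) => [/forall_inP h|[c h]].
  have [->|[e eC]] := set_0Vmem C; first by exists 0 => e; rewrite inE.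
  by exists (chi e) => f fC; move/forall_inP: (h _ fC) => /(_ _ eC) /eqP.
by apply/forall_inP => e /h ->; apply/forall_inP => f /h ->.
Qed.

Lemma goodP bad chi U :
  reflect (forall C, C \subset U -> bad C -> ~~ mono chi C) (good bad chi U).
Proof.
apply: (iffP forallP) => h C; last by apply/implyP => /andP[]; exact: h.
by move=> sC bC; move/implyP: (h C); apply; rewrite sC.
Qed.

Lemma not_goodP bad chi U : ~~ good bad chi U ->
  exists C, [/\ C \subset U, bad C & mono chi C].
Proof.
rewrite negb_forall => /existsP[C]; rewrite negb_imply negbK => /andP[/andP[]].
by exists C.
Qed.

Lemma mono_eq_in chi chi' C : {in C, chi =1 chi'} -> mono chi C = mono chi' C.
Proof.
move=> h; apply: eq_forallb_in => e eC; apply: eq_forallb_in => f fC.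
by rewrite !h.
Qed.

End Colourings.

(** * Density of unions of critical graphs *)

Section Unions.
Variables (R : realFieldType) (T : finType) (m : R).
Implicit Types (A B C D E F H U : {set {set T}}) (e f g W : {set T}) (x : T).
Local Open Scope ring_scope.
Hypothesis m1 : 1 < m.
Local Ltac mlra := have ? := m1; lra.

Lemma card_setU_R (X : finType) (A B : {set X}) :
  #|A :|: B|%:R = #|A|%:R + #|B|%:R - #|A :&: B|%:R :> R.
Proof. by apply/eqP; rewrite eq_sym subr_eq -!natrD cardsUI. Qed.

(** The common edges form a proper subgraph of [C] on the common vertices, of which [f] provides
    two; so what [C] adds to [E] is dense enough. *)
Lemma dense_union C E f : crit m C -> f \in C -> f \in E ->
  m * (#|cover E|%:R - 2) <= #|E|%:R - 1 ->
  m * (#|cover (E :|: C)|%:R - 2) <= #|E :|: C|%:R - 1.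
Proof.
move=> cC fC fE dE.
case: (boolP (C \subset E)) => [/setUidPl -> //|/subsetPn[g gC gE]].
have pJ : C :&: E \proper C.
  rewrite properE subsetIl; apply/subsetPn; exists g => //.
  by rewrite inE gC.
have W2 : (2 <= #|cover C :&: cover E|)%N.
  have /pairsP pC := crit_pairs cC; rewrite -(pC _ fC) subset_leq_card //.
  by rewrite subsetI !sub_cover.
have := crit_sub_le m1 cC pJ (coverI_sub _ _) W2.
have := crit_dense cC.
rewrite coverU !card_setU_R [E :&: C]setIC [cover E :&: _]setIC.
by mlra.
Qed.

(* Three critical graphs, each using exactly two of the three edges [a], [b],
   [c] at [x]: their union has [m - 1] edges more than density [m] requires. *)
Lemma three_paths_dense x a b c F1 F2 F3 :
  m <= 2 -> crit m F1 -> crit m F2 -> crit m F3 ->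
  a != b -> b != c -> a != c ->
  star F1 x = [set a; b] -> star F2 x = [set b; c] -> star F3 x = [set a; c] ->
  exists E : {set {set T}}, [/\ E \subset [set a; b; c] :|: (F1 :|: F2 :|: F3),
    [set a; b; c] \subset E &
    m * (#|cover E|%:R - 2) + (m - 1) <= #|E|%:R - 1].
Proof.
move=> m2 c1 c2 c3 ab bc ac s1 s2 s3.
have in1 e : x \in e -> (e \in F1) = (e == a) || (e == b).
  by move=> xe; move/setP/(_ e): s1; rewrite in_star xe andbT !inE.
have in2 e : x \in e -> (e \in F2) = (e == b) || (e == c).
  by move=> xe; move/setP/(_ e): s2; rewrite in_star xe andbT !inE.
have in3 e : x \in e -> (e \in F3) = (e == a) || (e == c).
  by move=> xe; move/setP/(_ e): s3; rewrite in_star xe andbT !inE.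
have [a1 xa] : a \in F1 /\ x \in a.
  by move/setP/(_ a): s1; rewrite in_star !inE eqxx => /andP.
have [b1 xb] : b \in F1 /\ x \in b.
  by move/setP/(_ b): s1; rewrite in_star !inE eqxx orbT => /andP.
have [c2' xc] : c \in F2 /\ x \in c.
  by move/setP/(_ c): s2; rewrite in_star !inE eqxx orbT => /andP.
have b2 : b \in F2 by rewrite in2 // eqxx.
have a3 : a \in F3 by rewrite in3 // eqxx.
have c3' : c \in F3 by rewrite in3 // eqxx orbT.
have cN1 : c \notin F1 by rewrite in1 // !(eq_sym c) (negPf ac) (negPf bc).
have aN2 : a \notin F2 by rewrite in2 // (negPf ab) (negPf ac).
have bN3 : b \notin F3 by rewrite in3 // [b == a]eq_sym (negPf ab) (negPf bc).
(* An edge added inside the vertex set of a critical graph gains one, which is at least [m - 1]. *)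
have close F d : crit m F -> d \notin F -> d \subset cover F ->
    m * (#|cover (d |: F)|%:R - 2) + (m - 1) <= #|d |: F|%:R - 1.
  move=> cF dF dc; have := crit_dense cF.
  by rewrite coverU cover_set1 (setUidPr dc) cardsU1 dF [(true + _)%N]add1n -natr1; mlra.
case: (boolP (c \subset cover F1)) => [sc|nc].
  exists (c |: F1); split; last exact: close.
    apply/subsetP => e; rewrite !inE => /orP[->|->]; by rewrite ?orbT.
  by apply/subsetP => e; rewrite !inE => /orP[/orP[]|] /eqP ->; rewrite ?a1 ?b1 ?eqxx ?orbT.
case: (boolP (a \subset cover F2)) => [sa|na].
  exists (a |: F2); split; last exact: close.
    apply/subsetP => e; rewrite !inE => /orP[->|->]; by rewrite ?orbT.
  by apply/subsetP => e; rewrite !inE => /orP[/orP[]|] /eqP ->; rewrite ?c2' ?b2 ?eqxx ?orbT.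
case: (boolP (b \subset cover F3)) => [sb|nb].
  exists (b |: F3); split; last exact: close.
    apply/subsetP => e; rewrite !inE => /orP[->|->]; by rewrite ?orbT.
  by apply/subsetP => e; rewrite !inE => /orP[/orP[]|] /eqP ->; rewrite ?c3' ?a3 ?eqxx ?orbT.
have /pairsP p1 := crit_pairs c1; have /pairsP p2 := crit_pairs c2.
have /pairsP p3 := crit_pairs c3.
pose J := F1 :&: F2; pose W := cover F1 :&: cover F2.
have bJ : b \in J by rewrite inE b1 b2.
have bW : b \subset W by rewrite subsetI !sub_cover.
have W2 : (2 <= #|W|)%N by rewrite -(p1 _ b1) subset_leq_card.
have cU : #|cover (F1 :|: F2)|%:R = #|cover F1|%:R + #|cover F2|%:R - #|W|%:R :> R.
  by rewrite coverU card_setU_R.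
have eU : #|F1 :|: F2|%:R = #|F1|%:R + #|F2|%:R - #|J|%:R :> R.
  by rewrite card_setU_R.
have d1 := crit_dense c1; have d2 := crit_dense c2; have d3 := crit_dense c3.
case: (leqP 3 #|W|) => W3.
  exists (F1 :|: F2); split.
  - by apply/subsetP => e; rewrite !inE => /orP[] ->; rewrite ?orbT.
  - by apply/subsetP => e; rewrite !inE => /orP[/orP[]|] /eqP ->; rewrite ?a1 ?b1 ?c2' ?eqxx ?orbT.
  have pJ : J :\ b \proper F2.
    rewrite properE (subset_trans (subsetDl _ _) (subsetIr _ _)).
    by apply/subsetPn; exists b => //; rewrite !inE eqxx.
  have xW : x \in W by apply: (subsetP bW).
  have sJ : cover (J :\ b) \subset W :\ x.
    apply/subsetP => y /in_coverP[e]; rewrite !inE => /and3P[eb e1 e2] ye.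
    have -> : y \in cover F1 by apply/in_coverP; exists e.
    have -> : y \in cover F2 by apply/in_coverP; exists e.
    rewrite !andbT; apply: contraNneq eb => yx; rewrite yx in ye.
    rewrite in1 // in e1; rewrite in2 // in e2.
    case/orP: e1 => /eqP ea; last by rewrite ea.
    by case/orP: e2 => /eqP eb; [rewrite eb|rewrite -ea -eb eqxx in ac].
  have cWx : #|W|%:R = #|W :\ x|%:R + 1 :> R by rewrite (cardsD1 x) xW natrD addrC.
  have cJb : #|J|%:R = #|J :\ b|%:R + 1 :> R by rewrite (cardsD1 b) bJ natrD addrC.
  have W2' : (2 <= #|W :\ x|)%N by move: W3; rewrite (cardsD1 x) xW.
  have := crit_sub_le m1 c2 pJ sJ W2'.
  by rewrite cU eU cWx cJb; mlra.
have Wb : W = b by apply/esym/eqP; rewrite eqEcard bW (p1 _ b1) -ltnS.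
have J1 : #|J|%:R <= 1 :> R.
  rewrite (ler_nat R _ 1); apply: (card_pairs_small _ (coverI_sub F1 F2)).
    by apply: pairs_sub (crit_pairs c1); exact: subsetIl.
  by rewrite -/W -ltnS.
exists (F1 :|: F2 :|: F3); split.
- by rewrite subsetUr.
- by apply/subsetP => e; rewrite !inE => /orP[/orP[]|] /eqP ->; rewrite ?a1 ?b1 ?c2' ?orbT.
pose J31 := F3 :&: F1; pose J32 := F3 :&: F2.
pose W31 := cover F3 :&: cover F1; pose W32 := cover F3 :&: cover F2.
have pJ31 : J31 \proper F3.
  by rewrite properE subsetIl; apply/subsetPn; exists c; rewrite // inE c3'.
have pJ32 : J32 \proper F3.
  by rewrite properE subsetIl; apply/subsetPn; exists a; rewrite // inE a3.
have W312 : (2 <= #|W31|)%N.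
  by rewrite -(p3 _ a3) subset_leq_card // subsetI !sub_cover.
have W322 : (2 <= #|W32|)%N.
  by rewrite -(p3 _ c3') subset_leq_card // subsetI !sub_cover.
have h31 := crit_sub_le m1 c3 pJ31 (coverI_sub _ _) W312.
have h32 := crit_sub_le m1 c3 pJ32 (coverI_sub _ _) W322.
(* Another vertex common to all three graphs would be the other end of [b], and both ends of [b]
   would lie in [F3], contrary to [nb]. *)
have I1 : (#|W31 :&: W32| <= 1)%N.
  rewrite -(cards1 x) subset_leq_card //; apply/subsetP => y.
  rewrite !inE => /andP[/andP[y3 y1] /andP[_ y2]].
  have yb : y \in b by rewrite -Wb inE y1.
  apply: contraNT nb => yx; apply/subsetP => z zb.
  have [y' _ eb] := pair_other (p1 _ b1) xb.
  move: yb zb; rewrite eb !inE (negPf yx) /= => /eqP yy.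
  case/orP => /eqP ->; last by rewrite -yy.
  by apply/in_coverP; exists a.
have cE : #|cover (F1 :|: F2 :|: F3)|%:R = #|cover (F1 :|: F2)|%:R
    + #|cover F3|%:R - #|W31 :|: W32|%:R :> R.
  by rewrite coverU card_setU_R coverU setIC setIUr.
have eE : #|F1 :|: F2 :|: F3|%:R = #|F1 :|: F2|%:R + #|F3|%:R - #|J31 :|: J32|%:R :> R.
  by rewrite card_setU_R setIC setIUr.
have hJ3 : #|J31 :|: J32|%:R <= #|J31|%:R + #|J32|%:R :> R.
  by rewrite -natrD ler_nat; exact: leq_card_setU.
have hW3 : #|W31|%:R + #|W32|%:R <= #|W31 :|: W32|%:R + 1 :> R.
  by rewrite -natrD -cardsUI natrD lerD2l (ler_nat R _ 1).
have hWm : m * (#|W31|%:R + #|W32|%:R) <= m * (#|W31 :|: W32|%:R + 1).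
  by rewrite ler_wpM2l //; mlra.
have cW2 : #|W|%:R = 2 :> R by rewrite Wb (p1 _ b1).
by rewrite cE eE cU eU cW2; mlra.
Qed.

End Unions.

Lemma subset_of_card (X : finType) (B S : {set X}) n : B \subset S ->
  #|B| <= n <= #|S| -> exists A : {set X}, [/\ B \subset A, A \subset S & #|A| = n].
Proof.
move=> sBS /andP[Bn nS]; elim: n Bn nS => [|n IH] Bn nS.
  by exists B; split => //; apply/eqP; rewrite -leqn0.
case: (ltngtP #|B| n.+1) Bn => // [Bn _|e _]; last by exists B.
have [A [sBA sAS cA]] := IH Bn (ltnW nS).
have : 0 < #|S :\: A|.
  by move: nS; rewrite -(cardsID A S) (setIidPr sAS) cA; lia.
move=> /card_gt0P[x]; rewrite inE => /andP[xA xS].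
exists (x |: A); split.
- by rewrite (subset_trans sBA) ?subsetUr.
- by rewrite subUset sub1set xS.
- by rewrite cardsU1 xA cA.
Qed.

Lemma sum_min_eq (X : finType) (A : {set X}) (f : X -> nat) d :
  (forall x, x \in A -> d <= f x) -> \sum_(x in A) f x <= d * #|A| ->
  forall x, x \in A -> f x = d.
Proof.
move=> h hs x xA; apply/eqP; rewrite eqn_leq h // andbT.
move: hs; rewrite (big_setD1 x) //= (cardsD1 x) xA mulnDr muln1 => hs.
have : d * #|A :\ x| <= \sum_(i in A :\ x) f i.
  rewrite mulnC -sum_nat_const leq_sum // => y; rewrite inE => /andP[_]; exact: h.
by lia.
Qed.

(** * Degrees in a minimal sparse counterexample *)

Section MinimalCounterexample.
Variables (R : realFieldType) (T : finType) (m : R).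
Implicit Types (A B C D E F H : {set {set T}}) (e f g W : {set T}) (x : T).
Local Open Scope ring_scope.
Variables (p q : {set T} -> nat) (U : {set {set T}}).
Hypothesis m1 : 1 < m.
Hypothesis pq : forall e, p e != q e.
Hypothesis pU : pairs U.
Hypothesis sparseU : forall E, E \subset U -> #|E|%:R <= m * #|cover E|%:R.
Hypothesis nU : ~ colourable (crit m) p q U.
Hypothesis minU : forall V : {set {set T}}, V \proper U -> colourable (crit m) p q V.
Local Ltac mlra := have ? := m1; lra.

Lemma min_nonempty : U != set0.
Proof.
apply/eqP => U0; apply: nU; exists p => [e|]; first by left.
apply/goodP => C; rewrite U0 subset0 => /eqP -> /(crit_card m1).
by rewrite cards0.
Qed.

Definition mixed x (s chi : {set T} -> nat) e := if x \in e then s e else chi e.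

Lemma star_mono x chi s : list_choice p q chi ->
  good (crit m) chi (U :\: star U x) -> list_choice p q s ->
  exists C c, [/\ C \subset U, crit m C, x \in cover C &
    forall e, e \in C -> mixed x s chi e = c].
Proof.
move=> lchi /goodP gchi ls.
have /negP/not_goodP[C [sC cC mC]] : ~ good (crit m) (mixed x s chi) U.
  move=> g; apply: nU; exists (mixed x s chi) => // e.
  by rewrite /mixed; case: ifP.
have /monoP[c hc] := mC.
exists C, c; split => //; apply: contraLR mC => xC.
have xe e : e \in C -> x \notin e.
  by move=> eC; apply: contra xC => xe; apply/in_coverP; exists e.
rewrite (mono_eq_in (chi' := chi)); last first.
  by move=> e /xe /negPf xe'; rewrite /mixed xe'.
apply: gchi => //; apply/subsetP => e eC.
by rewrite !inE (negPf (xe _ eC)) andbF (subsetP sC).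
Qed.

(** In the tight case give [c] to [A] and the other colour to the remaining [k] edges at [x]. A
    monochromatic critical graph through [x] has more than [k] edges there, so its colour is [c] and
    it uses exactly [A]. *)
Lemma star_forced x k : (0 < k)%N -> x \in cover U ->
  (forall C, crit m C -> x \in cover C -> (k < #|star C x|)%N) ->
  (k.*2 < #|star U x|)%N /\ (#|star U x| = k.*2.+1 ->
    exists (chi : {set T} -> nat) (r b : nat), r != b /\ forall (c : nat) A, c \in [:: r; b] ->
      A \subset star U x -> #|A| = k.+1 ->
      exists C, [/\ C \subset U, crit m C, star C x = A &
        forall e, e \in C -> x \notin e -> chi e = c]).
Proof.
move=> k0 xU degC.
have pV : U :\: star U x \proper U := crit_star_proper xU.
have [chi lchi gchi] := minU pV.
have sub C : C \subset U -> star C x \subset star U x.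
  move=> /subsetP sC; apply/subsetP => e.
  by rewrite !in_star => /andP[/sC -> ->].
have [s ls|h1 h2] := @list_balance _ (star U x) p q k k0 pq.
  have [C [c [sC cC xC hc]]] := star_mono lchi gchi ls.
  exists c; apply: leq_trans (degC _ cC xC) _.
  apply/subset_leq_card/subsetP => e eC; rewrite inE (subsetP (sub _ sC)) //=.
  by move: eC; rewrite in_star => /andP[/hc + xe]; rewrite /mixed xe => ->.
split=> // /[dup] cS /h2[r [b [rb hL]]].
exists chi, r, b; split=> // c A cin sA cA.
pose c' := if c == r then b else r.
have cc' : c' != c.
  by rewrite /c'; case: (eqVneq c r) => [->|]; [rewrite eq_sym|rewrite eq_sym].
pose s e := if e \in star U x then if e \in A then c else c' else p e.
have ls : list_choice p q s.
  move=> e; rewrite /s; case: ifPn => [eS|_]; last by left.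
  have := hL _ eS; move: cin; rewrite /c' !inE => /orP[] /eqP ->.
    by rewrite eqxx; case=> -[-> ->]; case: ifP; [left|right|right|left].
  rewrite [b == r]eq_sym (negPf rb).
  by case=> -[-> ->]; case: ifP; [right|left|left|right].
have [C [c0 [sC cC xC hc]]] := star_mono lchi gchi ls.
have hs e : e \in star C x -> s e = c0.
  by rewrite in_star => /andP[/hc + xe]; rewrite /mixed xe.
have hk := degC _ cC xC.
have c0c : c0 = c.
  apply/eqP; apply: contraTT hk => n0; rewrite -leqNgt.
  have : star C x \subset star U x :\: A.
    apply/subsetP => e eC; have eS := subsetP (sub _ sC) _ eC.
    rewrite inE eS andbT; apply: contra n0 => eA.
    by rewrite -(hs _ eC) /s eS eA.
  move=> /subset_leq_card; rewrite cardsD (setIidPr sA) cS cA.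
  by rewrite -addnn; lia.
exists C; split => //; last first.
  by move=> e /hc; rewrite /mixed => + /negPf xe; rewrite xe c0c.
apply/eqP; rewrite eqEcard cA hk andbT; apply/subsetP => e eC.
have eS := subsetP (sub _ sC) _ eC.
have := hs _ eC; rewrite c0c /s eS; case: ifP => // _ /eqP.
by rewrite (negPf cc').
Qed.

(** Take a maximal dense graph that has colour [c] off [x] and contains an edge at [x]. A missing
    edge of the star could be added with the critical graph forced on a set [A] that contains it and
    an edge already present; such [A] exists because [k > 0]. *)
Lemma forced_extend x k (chi : {set T} -> nat) (c : nat) : (0 < k)%N -> (k < #|star U x|)%N ->
  (forall A, A \subset star U x -> #|A| = k.+1 ->
      exists C, [/\ C \subset U, crit m C, star C x = A &
        forall e, e \in C -> x \notin e -> chi e = c]) ->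
  exists E, [/\ E \subset U, star U x \subset E,
    forall e, e \in E -> x \notin e -> chi e = c &
    m * (#|cover E|%:R - 2) <= #|E|%:R - 1].
Proof.
move=> k0 kS hC.
pose P E := [&& E \subset U, [forall e in E, (x \in e) || (chi e == c)],
  m * (#|cover E|%:R - 2) <= #|E|%:R - 1 & E :&: star U x != set0].
have k1S : (#|set0 : {set {set T}}| <= k.+1 <= #|star U x|)%N by rewrite cards0.
have [A [_ sA cA]] := subset_of_card (sub0set _) k1S.
have [C [sC cC stC monC]] := hC _ sA cA.
have PC : P C.
  apply/and4P; split => //.
  - apply/forall_inP => e eC; case: (boolP (x \in e)) => //= xe.
    by rewrite (monC _ eC xe).
  - exact: crit_dense.
  have [e eA] : exists e, e \in A by apply/card_gt0P; rewrite cA.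
  apply/set0Pn; exists e; rewrite inE (subsetP sA) // andbT.
  by move: eA; rewrite -stC in_star => /andP[].
have [E /maxsetP[/and4P[sE monE dE /set0Pn[t tI]] maxE] _] := maxset_exists PC.
move: tI; rewrite inE => /andP[tE tS].
exists E; split => //; last first.
  by move=> e eE xe; move/forall_inP: monE => /(_ _ eE); rewrite (negPf xe) => /eqP.
apply/subsetP => s sS; apply: contraT => sNE.
have st : s != t by apply: contraNneq sNE => ->.
have [A' [sA' sA'S cA']] : exists A', [/\ [set s; t] \subset A', A' \subset star U x & #|A'| = k.+1].
  apply: subset_of_card; first by rewrite subUset !sub1set sS tS.
  by rewrite cards2 st kS andbT.
have [D [sD cD stD monD]] := hC _ sA'S cA'.
have inD e : e \in A' -> e \in D by rewrite -stD in_star => /andP[].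
have sD' : s \in D by apply/inD/(subsetP sA'); rewrite !inE eqxx.
have tD : t \in D by apply/inD/(subsetP sA'); rewrite !inE eqxx orbT.
case/negP: sNE; rewrite -(maxE (E :|: D)) ?subsetUl ?inE ?sD' ?orbT //.
apply/and4P; split.
- by rewrite subUset sE.
- apply/forall_inP => e; rewrite inE => /orP[eE|eD].
    by move/forall_inP: monE; apply.
  by case: (boolP (x \in e)) => //= xe; rewrite (monD _ eD xe).
- exact: dense_union tD tE dE.
- by apply/set0Pn; exists t; rewrite !inE tE -in_star tS.
Qed.

(** Off [x] the two graphs have different colours and so share no edge, whereas they share [x] and
    all its neighbours. Sparsity is applied to their union. *)
Lemma two_colours_cut x (chi : {set T} -> nat) (r b : nat) E F : r != b -> E \subset U -> F \subset U ->
  star U x \subset E -> star U x \subset F ->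
  (forall e, e \in E -> x \notin e -> chi e = r) ->
  (forall e, e \in F -> x \notin e -> chi e = b) -> x \in cover U ->
  #|E|%:R + #|F|%:R - #|star U x|%:R
    <= m * (#|cover E|%:R + #|cover F|%:R - #|star U x|%:R - 1).
Proof.
move=> rb sE sF SE SF cE cF xU.
have EF : E :&: F = star U x.
  apply/eqP; rewrite eqEsubset subsetI SE SF !andbT; apply/subsetP => e.
  rewrite inE in_star => /andP[eE eF]; rewrite (subsetP sE) //=.
  by apply: contraNT rb => xe; rewrite -(cE _ eE xe) (cF _ eF xe).
have := sparseU (_ : E :|: F \subset U); rewrite subUset sE sF => /(_ isT).
rewrite coverU !card_setU_R EF => h; apply: le_trans h _.
have : #|star U x|%:R + 1 <= #|cover E :&: cover F|%:R :> R.
  rewrite natr1 -card_cover_star // ler_nat subset_leq_card //.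
  by rewrite subsetI !coverS.
by move=> h; apply: ler_wpM2l; mlra.
Qed.

Lemma deg_ge_big x k : (2 <= k)%N -> k%:R <= m -> x \in cover U ->
  (forall C, crit m C -> x \in cover C -> (k < #|star C x|)%N) ->
  (k.*2.+2 <= #|star U x|)%N.
Proof.
move=> k2 km xU degC.
have [h1 h2] := star_forced (ltnW k2) xU degC.
rewrite ltn_neqAle h1 andbT; apply/eqP => /esym cS.
have [chi [r [b [rb hC]]]] := h2 cS.
have kS : (k < #|star U x|)%N by rewrite cS -addnn; lia.
have rin : r \in [:: r; b] by rewrite inE eqxx.
have bin : b \in [:: r; b] by rewrite !inE eqxx orbT.
have [E [sE SE cE dE]] := forced_extend (ltnW k2) kS (fun A => hC r A rin).
have [F [sF SF cF dF]] := forced_extend (ltnW k2) kS (fun A => hC b A bin).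
have := two_colours_cut rb sE sF SE SF cE cF xU.
rewrite cS -addnn -natr1 natrD => h.
(* The inequalities so far combine to [m (2k - 2) <= 2k - 1], which fails for [m >= k >= 2]. *)
have k2R : 2 <= k%:R :> R by rewrite (ler_nat R 2).
have : 0 <= (m - k%:R) * (k%:R - 1) by rewrite mulr_ge0; mlra.
have : 0 <= (k%:R - 2) * k%:R :> R by rewrite mulr_ge0; mlra.
by mlra.
Qed.

(** For [k = 1] the density supplied by [forced_extend] does not contradict sparsity. The surplus
    [m - 1] from [three_paths_dense] in both colours does: it leads to [2 m <= 3]. *)
Lemma deg_ge_four x : 3 / 2 < m -> m <= 2 -> x \in cover U -> (4 <= #|star U x|)%N.
Proof.
move=> m32 m2 xU.
have degC C : crit m C -> x \in cover C -> (1 < #|star C x|)%N.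
  exact: crit_deg2.
have [h1 h2] := star_forced (ltnSn 0) xU degC.
rewrite ltn_neqAle h1 andbT; apply/eqP => /esym cS.
have [chi [r [b [rb hC]]]] := h2 cS.
have [s1 [s2 [s3 [n12 n23 n13 eS]]]] : exists s1 s2 s3, [/\ s1 != s2, s2 != s3, s1 != s3 &
    star U x = [set s1; s2; s3]].
  have : size (enum (star U x)) = 3 by rewrite -cardE cS.
  have := enum_uniq (star U x); case E : (enum _) => [|s1 [|s2 [|s3 [|]]]] //=.
  rewrite !inE negb_or andbT => /andP[/andP[n12 n13] n23] _.
  exists s1, s2, s3; split=> //; apply/setP => e.
  by rewrite -mem_enum E !inE orbA.
have H c : c \in [:: r; b] -> exists E, [/\ E \subset U, star U x \subset E,
    forall e, e \in E -> x \notin e -> chi e = c &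
    m * (#|cover E|%:R - 2) + (m - 1) <= #|E|%:R - 1].
  move=> cin.
  have [||F1 [sF1 cF1 st1 mon1]] := hC c [set s1; s2] cin.
  - by rewrite eS subsetUl.
  - by rewrite cards2 n12.
  have [||F2 [sF2 cF2 st2 mon2]] := hC c [set s2; s3] cin.
  - by rewrite eS -setUA subsetUr.
  - by rewrite cards2 n23.
  have [||F3 [sF3 cF3 st3 mon3]] := hC c [set s1; s3] cin.
  - by rewrite eS setUAC subsetUl.
  - by rewrite cards2 n13.
  have [E [sE SE dE]] := three_paths_dense m1 m2 cF1 cF2 cF3 n12 n23 n13 st1 st2 st3.
  have sS : [set s1; s2; s3] \subset U by rewrite -eS star_sub.
  exists E; split => //.
  - by apply: subset_trans sE _; rewrite subUset sS !subUset sF1 sF2 sF3.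
  - by rewrite eS.
  move=> e /(subsetP sE); rewrite inE -eS in_star => /orP[/andP[_ -> //]|].
  rewrite !inE => /orP[/orP[]|]; [exact: mon1|exact: mon2|exact: mon3].
have [|E [sE SE cE dE]] := H r; first by rewrite inE eqxx.
have [|F [sF SF cF dF]] := H b; first by rewrite !inE eqxx orbT.
have := two_colours_cut rb sE sF SE SF cE cF xU.
by rewrite cS; mlra.
Qed.

Lemma deg_ge_three x : x \in cover U -> (3 <= #|star U x|)%N.
Proof.
move=> xU.
by have [] := star_forced (ltnSn 0) xU (fun C cC xC => crit_deg2 m1 cC xC).
Qed.

End MinimalCounterexample.

(** * Graphs of maximum degree three: list colourings into forests *)

Section Forests.
Variable T : finType.
Implicit Types (A B C D E F H U V : {set {set T}}) (e f g W : {set T}) (x y a b d : T).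

(** A graph contains a cycle exactly when it has such a subgraph, so avoiding monochromatic [cyclic]
    sets makes every colour class a forest. Minimum degree two is the property that critical graphs
    provide. *)
Definition cyclic E : bool :=
  (E != set0) && [forall x in cover E, 2 <= #|star E x|].

Lemma pair_inj x y z : [set x; y] = [set x; z] :> {set T} -> y = z.
Proof.
move=> h; have : y \in [set x; z] by rewrite -h !inE eqxx orbT.
rewrite !inE => /orP[/eqP yx|/eqP //].
have : z \in [set x; y] by rewrite h !inE eqxx orbT.
by rewrite yx !inE orbb => /eqP.
Qed.

Lemma star_set3 E x : pairs E -> #|star E x| = 3 ->
  exists a b d, [/\ a != b, b != d, a != d, x \notin [set a; b; d] &
    star E x = [set [set x; a]; [set x; b]; [set x; d]]].
Proof.
move=> /pairsP pE c3.
have nb e : e \in star E x -> exists2 y, y != x & e = [set x; y].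
  by rewrite in_star => /andP[/pE ce xe]; exact: pair_other.
have : size (enum (star E x)) = 3 by rewrite -cardE c3.
have := enum_uniq (star E x); case EE : (enum _) => [|s1 [|s2 [|s3 [|]]]] //=.
rewrite !inE negb_or andbT => /andP[/andP[n12 n13] n23] _.
have eS : star E x = [set s1; s2; s3].
  by apply/setP => e; rewrite -mem_enum EE !inE orbA.
have [a ax e1] : exists2 y, y != x & s1 = [set x; y].
  by apply: nb; rewrite eS !inE eqxx.
have [b bx e2] : exists2 y, y != x & s2 = [set x; y].
  by apply: nb; rewrite eS !inE eqxx orbT.
have [d dx e3] : exists2 y, y != x & s3 = [set x; y].
  by apply: nb; rewrite eS !inE eqxx !orbT.
exists a, b, d; rewrite eS e1 e2 e3; split => //.
- by apply: contraNneq n12 => h; rewrite e1 e2 h.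
- by apply: contraNneq n23 => h; rewrite e2 e3 h.
- by apply: contraNneq n13 => h; rewrite e1 e3 h.
- by rewrite !inE !negb_or ![x == _]eq_sym ax bx dx.
Qed.

Lemma starS C U x : C \subset U -> star C x \subset star U x.
Proof. by move=> /subsetP s; apply/subsetP => e; rewrite !in_star => /andP[/s -> ->]. Qed.

Lemma sub_diff_star C U x : C \subset U -> x \notin cover C -> C \subset U :\: star U x.
Proof.
move=> /subsetP s nx; apply/subsetP => e eC; rewrite inE s // andbT in_star s //=.
by apply: contra nx => xe; apply/in_coverP; exists e.
Qed.

Lemma cyclic_avoid C U x e1 e2 e3 : cyclic C -> C \subset U ->
  star U x = [set e1; e2; e3] -> e2 \notin C -> e3 \notin C -> x \notin cover C.
Proof.
move=> /andP[_ /forall_inP h] sC st n2 n3; apply: contraL (subxx C) => /h.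
apply: contraLR => _; rewrite -leqNgt -(cards1 e1) subset_leq_card //.
apply/subsetP => e eC; have := subsetP (starS x sC) _ eC.
rewrite st !inE => /orP[/orP[//|]|] /eqP ee; move: eC; rewrite in_star ee.
  by rewrite (negPf n2).
by rewrite (negPf n3).
Qed.

Lemma rainbow_colourable p q U x s : list_choice p q s ->
  (forall c, #|[set e in star U x | s e == c]| <= 1) ->
  colourable cyclic p q (U :\: star U x) -> colourable cyclic p q U.
Proof.
move=> ls hs [chi lchi /goodP gchi]; exists (mixed x s chi) => [e|].
  by rewrite /mixed; case: ifP.
apply/goodP => C sC cC; apply/negP => mC; have /monoP[c hc] := mC.
case: (boolP (x \in cover C)) => xC.
  case/andP: (cC) => _ /forall_inP /(_ _ xC); rewrite leqNgt ltnS => /negP; apply.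
  apply: leq_trans (hs c); apply/subset_leq_card/subsetP => e eC.
  rewrite inE (subsetP (starS x sC)) //=.
  by move: eC; rewrite in_star => /andP[/hc + xe]; rewrite /mixed xe => ->.
have /negP := gchi _ (sub_diff_star sC xC) cC; apply.
rewrite -(mono_eq_in (chi := mixed x s chi)) // => e eC.
rewrite /mixed ifN //; apply: contra xC => xe.
by apply/in_coverP; exists e.
Qed.

Lemma set3C (X : finType) (e1 e2 e3 : X) : [set e1; e2; e3] = [set e2; e1; e3].
Proof. by rewrite [[set e1; e2]]setUC. Qed.

Lemma set3R (X : finType) (e1 e2 e3 : X) : [set e1; e2; e3] = [set e3; e1; e2].
Proof. by rewrite setUC setUA. Qed.

(** Replace the star of [x] by a single edge from [a] to [b] with list [{r, l}], and colour this
    smaller graph. The edges from [x] to [a] and [b] inherit the colour of the new edge, and the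
    third edge gets the other colour; a monochromatic cycle through [x] would shortcut through the
    new edge. The induction hypothesis ranges over all lists because the new edge needs a prescribed
    one. *)
Lemma bypass_colourable p q U x a b d r l : pairs U ->
  (forall e, p e != q e) -> r != l ->
  (forall e, e \in star U x -> (p e = r /\ q e = l) \/ (p e = l /\ q e = r)) ->
  star U x = [set [set x; a]; [set x; b]; [set x; d]] ->
  a != b -> b != d -> a != d -> x \notin [set a; b; d] -> [set a; b] \notin U ->
  (forall p q V, pairs V -> (forall y, #|star V y| <= 3) -> (forall e, p e != q e) ->
     #|V| < #|U| -> colourable cyclic p q V) ->
  (forall y, #|star U y| <= 3) -> colourable cyclic p q U.
Proof.
move=> pU pq rl hL st ab bd ad nx nab IH deg.
have [xa xb xd] : [/\ x != a, x != b & x != d].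
  by move: nx; rewrite !inE !negb_or => /andP[/andP[-> ->] ->].
pose f := [set a; b].
pose p' e := if e == f then r else p e.
pose q' e := if e == f then l else q e.
pose V := f |: (U :\: star U x).
have inU y : [set x; y] \in star U x -> [set x; y] \in U.
  by rewrite in_star => /andP[].
have aS : [set x; a] \in star U x by rewrite st !inE eqxx.
have bS : [set x; b] \in star U x by rewrite st !inE eqxx orbT.
have dS : [set x; d] \in star U x by rewrite st !inE eqxx orbT.
have pV : pairs V.
  apply/pairsP => e; rewrite !inE => /orP[/eqP ->|/andP[_]].
    by rewrite cards2 ab.
  by move/pairsP: pU; apply.
have degV y : #|star V y| <= 3.
  have [yf|yf] := boolP (y \in f); last first.
    apply: leq_trans (deg y); apply/subset_leq_card/subsetP => e.
    rewrite !inE => /andP[/orP[/eqP ef|/andP[_ ->] //] ye].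
    by rewrite -ef ye in yf.
  have yS : [set x; y] \in star U x.
    by move: yf; rewrite in_set2 => /orP[] /eqP ->.
  have xyU : [set x; y] \in star U y.
    by rewrite in_star inU //= !inE eqxx orbT.
  have := deg y; rewrite (cardsD1 [set x; y]) xyU add1n => h.
  apply: leq_trans (subset_leq_card (_ : star V y \subset f |: (star U y :\ [set x; y]))) _.
    apply/subsetP => e; rewrite in_star in_setU1 in_setD in_star in_setU1.
    move=> /andP[/orP[->//|/andP[nS eU]] ye].
    rewrite in_setD1 in_star eU ye !andbT; apply/orP; right.
    by apply: contra nS => /eqP ->; rewrite inU //= !inE eqxx.
  by rewrite cardsU1; apply: leq_trans h; rewrite -add1n leq_add2r leq_b1.
have pq' e : p' e != q' e by rewrite /p' /q'; case: ifP.
have cardV : #|V| < #|U|.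
  have c3 : #|star U x| = 3.
    rewrite st -setUA cardsU1 !inE cards2.
    have h y z : y != z -> [set x; y] != [set x; z].
      by apply: contra_neq => /pair_inj.
    by rewrite (negPf (h _ _ ab)) (negPf (h _ _ ad)) (h _ _ bd).
  rewrite cardsU1 -(cardsID (star U x) U) (setIidPr (star_sub U x)) c3.
  apply: leq_ltn_trans (leq_add (leq_b1 _) (leqnn _)) _.
  by rewrite ltn_add2r.
have [chi lchi /goodP gchi] := IH p' q' V pV degV pq' cardV.
pose c := chi f; pose c' := if c == r then l else r.
have cin : c = r \/ c = l.
  by have := lchi f; rewrite /p' /q' eqxx.
have cc' : c' != c.
  by rewrite /c'; case: cin => ->; rewrite ?eqxx ?[l == r]eq_sym ?(negPf rl) //= eq_sym.
pose s e := if e \in star U x then (if e == [set x; d] then c' else c) else p e.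
have ls : list_choice p q s.
  move=> e; rewrite /s; case: ifPn => [eS|_]; last by left.
  rewrite /c'; have := hL _ eS; case: cin => ->.
    by rewrite eqxx; case=> -[-> ->]; case: ifP; [right|left|left|right].
  rewrite [l == r]eq_sym (negPf rl).
  by case=> -[-> ->]; case: ifP; [left|right|right|left].
exists (fun e => if e == f then p e else mixed x s chi e) => [e|].
  case: eqP => [_|/eqP nf]; first by left.
  rewrite /mixed; case: ifP => // _.
  by have := lchi e; rewrite /p' /q' (negPf nf).
apply/goodP => C sC cC.
rewrite (mono_eq_in (chi' := mixed x s chi)); last first.
  by move=> e eC; rewrite ifN //; apply: contraNneq nab => ef; rewrite -/f -ef; apply: (subsetP sC).
apply/negP => mC; have /monoP[k hk] := mC.
case: (boolP (x \in cover C)) => xC; last first.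
  have sCV : C \subset V by rewrite (subset_trans (sub_diff_star sC xC)) ?subsetUr.
  case/negP: (gchi C sCV cC); rewrite -(mono_eq_in (chi := mixed x s chi)) // => e eC.
  rewrite /mixed ifN //; apply: contra xC => xe.
  by apply/in_coverP; exists e.
have hs e : e \in star C x -> s e = k.
  by rewrite in_star => /andP[/hk + xe]; rewrite /mixed xe.
case/andP: (cC) => _ /forall_inP degC.
have dNC : [set x; d] \notin C.
  apply/negP => dC.
  have dSC : [set x; d] \in star C x by rewrite in_star dC !inE eqxx.
  have kc' : c' = k by rewrite -(hs _ dSC) /s dS eqxx.
  have := degC _ xC; rewrite ltnNge => /negP; apply.
  rewrite -(cards1 [set x; d]); apply/subset_leq_card/subsetP => e eC.
  rewrite inE; apply: contraNT cc' => ne.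
  by rewrite kc' -(hs _ eC) /s (subsetP (starS x sC)) // (negPf ne).
have [aC bC] : [set x; a] \in C /\ [set x; b] \in C.
  split; apply: contraTT xC => nC.
    by apply: (cyclic_avoid (e1 := [set x; b]) (e2 := [set x; a]) cC sC _ nC dNC);
       rewrite st set3C.
  by apply: (cyclic_avoid (e1 := [set x; a]) (e2 := [set x; b]) cC sC st nC dNC).
have stC e : e \in star C x -> e = [set x; a] \/ e = [set x; b].
  move=> eC; have := subsetP (starS x sC) _ eC.
  rewrite st !inE => /orP[/orP[/eqP|/eqP]|/eqP ed]; [by left|by right|].
  by move: eC; rewrite in_star ed (negPf dNC).
have kc : k = c.
  have aSC : [set x; a] \in star C x by rewrite in_star aC !inE eqxx.
  rewrite -(hs _ aSC) /s aS ifN //.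
  by apply: contraNneq ad => /pair_inj ->.
(* The shortcut: at [a] and [b] the new edge makes up for the lost edge to [x], so degrees do not
   drop. *)
pose C' := f |: (C :\: star C x).
have xin e : e \in C -> x \in e -> e \in star C x by rewrite in_star => -> ->.
have sC' : C' \subset V.
  apply: setUS; apply/subsetP => e; rewrite !in_setD !in_star => /andP[+ eC].
  by rewrite eC (subsetP sC _ eC) andbT.
have cC' : cyclic C'.
  apply/andP; split; first by apply/set0Pn; exists f; rewrite !inE eqxx.
  apply/forall_inP => y /in_coverP[e eC' ye].
  have yx : y != x.
    apply: contraTneq eC' => yx; rewrite yx in ye; rewrite !inE negb_or ye andbT andNb andbT.
    by apply: contraTneq ye => ->; rewrite !inE negb_or xa xb.
  have yC : y \in cover C.
    move: eC'; rewrite in_setU1 => /orP[/eqP ef|]; last first.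
      by rewrite inE => /andP[_ eC]; apply/in_coverP; exists e.
    move: ye; rewrite ef !inE => /orP[] /eqP ->; apply/in_coverP.
      by exists [set x; a]; rewrite // !inE eqxx orbT.
    by exists [set x; b]; rewrite // !inE eqxx orbT.
  apply: leq_trans (degC _ yC) _.
  have [yf|yf] := boolP (y \in f); last first.
    apply/subset_leq_card/subsetP => g; rewrite !in_star => /andP[gC yg].
    rewrite yg andbT !inE gC andbT; apply/orP; right; apply/negP => xg.
    have [] := stC g _; rewrite ?in_star ?gC // => gE; move: yg yf; rewrite gE !inE (negPf yx) /=;
      by move=> ->; rewrite ?orbT.
  have xyC : [set x; y] \in star C y.
    rewrite in_star !inE eqxx orbT andbT.
    by move: yf; rewrite !inE => /orP[] /eqP ->.
  rewrite (cardsD1 [set x; y]) xyC add1n.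
  have fN : f \notin star C y :\ [set x; y].
    rewrite !inE !negb_and; apply/orP; right; apply/orP; left.
    by apply: contra nab => /(subsetP sC).
  have <- : #|f |: (star C y :\ [set x; y])| = #|star C y :\ [set x; y]|.+1.
    by rewrite cardsU1 fN.
  apply/subset_leq_card/subsetP => g; rewrite in_setU1 => /orP[/eqP ->|].
    by rewrite in_star !inE eqxx /=; move: yf; rewrite !inE.
  rewrite in_setD1 in_star => /and3P[gn gC yg].
  rewrite in_star yg andbT in_setU1 in_setD gC andbT; apply/orP; right.
  apply: contra gn => /stC[] gE; move: yg; rewrite gE !inE (negPf yx) /= => /eqP ->; exact: eqxx.
case/negP: (gchi C' sC' cC'); apply/monoP; exists c => e; rewrite in_setU1 => /orP[/eqP -> //|].
rewrite in_setD => /andP[nS eC]; rewrite -kc -(hk _ eC) /mixed ifN //.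
by apply: contra nS => /(xin _ eC).
Qed.

End Forests.

Section CubicForests.
Variable T : finType.
Implicit Types (A B C D E F H U V : {set {set T}}) (e f g W : {set T}) (x y a b d : T).

Lemma star_eq3 U x a b d : #|star U x| <= 3 -> a != b -> b != d -> a != d ->
  [set x; a] \in U -> [set x; b] \in U -> [set x; d] \in U ->
  star U x = [set [set x; a]; [set x; b]; [set x; d]].
Proof.
move=> c3 ab bd ad aU bU dU; apply/esym/eqP; rewrite eqEcard; apply/andP; split.
  by rewrite !subUset !sub1set !in_star aU bU dU !inE !eqxx.
apply: leq_trans c3 _.
have h y z : y != z -> [set x; y] != [set x; z] by apply: contra_neq => /pair_inj.
by rewrite -setUA cardsU1 !inE cards2 (negPf (h _ _ ab)) (negPf (h _ _ ad)) (h _ _ bd).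
Qed.

Lemma pair_neql a c x y : a != x -> a != y -> [set a; c] != [set x; y].
Proof.
move=> ax ay; apply/eqP => /setP/(_ a); rewrite !inE eqxx.
by rewrite (negPf ax) (negPf ay).
Qed.

Lemma pair_neqr a c x y : c != x -> c != y -> [set a; c] != [set x; y].
Proof. by rewrite setUC; exact: pair_neql. Qed.

Definition same_list (p q : {set T} -> nat) (r l : nat) e : Prop :=
  (p e = r /\ q e = l) \/ (p e = l /\ q e = r).

Lemma same_list_trans p q r l r' l' e f : r != l -> same_list p q r l e ->
  same_list p q r' l' e -> same_list p q r' l' f -> same_list p q r l f.
Proof.
rewrite /same_list => rl [[-> ->]|[-> ->]] [[<- <-]|[<- <-]] [[-> ->]|[-> ->]];
by [left|right].
Qed.

(** The six edges split into the paths [x a b d] and [b x d a], one for each colour. By the degree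
    bound no other edge meets these four vertices, so the rest is coloured independently. *)
Lemma complete4_colourable p q U x a b d r l : pairs U -> r != l ->
  (forall y, #|star U y| <= 3) ->
  [/\ a != b, b != d & a != d] -> x \notin [set a; b; d] ->
  [/\ [set x; a] \in U, [set x; b] \in U & [set x; d] \in U] ->
  [/\ [set a; b] \in U, [set b; d] \in U & [set a; d] \in U] ->
  (forall e, e \in [set [set x; a]; [set a; b]; [set b; d]] -> same_list p q r l e) ->
  (forall e, e \in [set [set x; b]; [set x; d]; [set a; d]] -> same_list p q r l e) ->
  (forall V, V \proper U -> colourable (@cyclic T) p q V) -> colourable (@cyclic T) p q U.
Proof.
move=> pU rl deg [ab bd ad] nx [xaU xbU xdU] [abU bdU adU] hr hl IH.
have [xa xb xd] : [/\ x != a, x != b & x != d].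
  by move: nx; rewrite !inE !negb_or => /andP[/andP[-> ->] ->].
pose Yr := [set [set x; a]; [set a; b]; [set b; d]].
pose Yl := [set [set x; b]; [set x; d]; [set a; d]].
have stx := star_eq3 (deg x) ab bd ad xaU xbU xdU.
have sta : star U a = [set [set a; x]; [set a; b]; [set a; d]].
  by apply: star_eq3 => //; rewrite ?[[set a; x]]setUC.
have stb : star U b = [set [set b; x]; [set b; a]; [set b; d]].
  by apply: star_eq3 => //; rewrite ?[[set b; x]]setUC ?[[set b; a]]setUC.
have std : star U d = [set [set d; x]; [set d; a]; [set d; b]].
  by apply: star_eq3 => //; rewrite 1?eq_sym // ?[[set d; x]]setUC ?[[set d; a]]setUC ?[[set d; b]]setUC.
have pV : U :\: (Yr :|: Yl) \proper U.
  rewrite properE subsetDl; apply/subsetPn; exists [set x; a] => //.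
  by rewrite !inE eqxx.
have [chi lchi /goodP gchi] := IH _ pV.
have dis e : e \in Yl -> e \notin Yr.
  have [ax bx dx] : [/\ a != x, b != x & d != x] by rewrite ![_ == x]eq_sym.
  have [ba db da] : [/\ b != a, d != b & d != a] by rewrite ![_ == a]eq_sym [d == b]eq_sym.
  rewrite !inE => h; rewrite !negb_or; move: h => /orP[/orP[]|] /eqP ->.
  - by rewrite pair_neqr ?(pair_neql _ (x := a)) ?(pair_neql _ (x := b)) //.
  - by rewrite pair_neqr ?(pair_neql _ (x := a)) ?(pair_neql _ (x := b)) //.
  - by rewrite (pair_neqr _ (x := x)) ?(pair_neqr _ (x := a)) ?(pair_neql _ (x := b)) //.
pose chi' e := if e \in Yr then r else if e \in Yl then l else chi e.
exists chi' => [e|].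
  rewrite /chi'; case: ifPn => [/hr[[-> ->]|[-> ->]]|_]; [by left|by right|].
  by case: ifPn => [/hl[[-> ->]|[-> ->]]|_]; [by right|by left|].
apply/goodP => C sC cC; apply/negP => mC; have /monoP[c hc] := mC.
have out y e : y \notin cover C -> y \in e -> e \notin C.
  by move=> yC ye; apply: contra yC => eC; apply/in_coverP; exists e.
have av y e1 e2 e3 := @cyclic_avoid _ C U y e1 e2 e3 cC sC.
suff [[xC aC] [bC dC]] : (x \notin cover C /\ a \notin cover C) /\ (b \notin cover C /\ d \notin cover C).
  have sCV : C \subset U :\: (Yr :|: Yl).
    apply/subsetP => e eC; rewrite in_setD (subsetP sC) // andbT.
    apply: contraL eC; rewrite !inE => h.
    case/orP: h => /orP[/orP[]|] /eqP ->.
    - by apply: (out x) => //; rewrite !inE eqxx.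
    - by apply: (out a) => //; rewrite !inE eqxx.
    - by apply: (out b) => //; rewrite !inE eqxx.
    - by apply: (out x) => //; rewrite !inE eqxx.
    - by apply: (out x) => //; rewrite !inE eqxx.
    - by apply: (out a) => //; rewrite !inE eqxx.
  case/negP: (gchi C sCV cC); rewrite -(mono_eq_in (chi := chi')) // => e eC.
  have := subsetP sCV _ eC; rewrite in_setD in_setU negb_or => /andP[/andP[n1 n2] _].
  by rewrite /chi' (negPf n1) (negPf n2).
have nYl : c != l -> forall e, e \in Yl -> e \notin C.
  move=> cl e eY; apply: contra cl => /hc <-.
  by rewrite /chi' (negPf (dis _ eY)) eY.
have nYr : c != r -> forall e, e \in Yr -> e \notin C.
  by move=> cr e eY; apply: contra cr => /hc <-; rewrite /chi' eY.
case: (eqVneq c l) => [cl|cl].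
  have {}nYr := nYr (_ : c != r); rewrite cl eq_sym in nYr; have {}nYr := nYr rl.
  have xaN : [set x; a] \notin C by apply: nYr; rewrite !inE eqxx.
  have abN : [set a; b] \notin C by apply: nYr; rewrite !inE eqxx orbT.
  have bdN : [set b; d] \notin C by apply: nYr; rewrite !inE eqxx !orbT.
  have bN : b \notin cover C by apply: av stb _ bdN; rewrite setUC.
  have xbN : [set x; b] \notin C by apply: (out b) => //; rewrite !inE eqxx orbT.
  have xN : x \notin cover C.
    by apply: av (_ : _ = [set [set x; d]; [set x; a]; [set x; b]]) xaN xbN; rewrite stx set3R.
  have xdN : [set x; d] \notin C by apply: (out x) => //; rewrite !inE eqxx.
  have dN : d \notin cover C.
    have std' : star U d = [set [set d; a]; [set d; x]; [set d; b]] by rewrite std set3C.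
    by apply: av std' _ _; rewrite setUC.
  have adN : [set a; d] \notin C by apply: (out d) => //; rewrite !inE eqxx orbT.
  have aN : a \notin cover C by apply: av sta abN adN.
  by [].
have {}nYl := nYl cl.
have xbN : [set x; b] \notin C by apply: nYl; rewrite !inE eqxx.
have xdN : [set x; d] \notin C by apply: nYl; rewrite !inE eqxx orbT.
have adN : [set a; d] \notin C by apply: nYl; rewrite !inE eqxx !orbT.
have xN : x \notin cover C by apply: av stx xbN xdN.
have xaN : [set a; x] \notin C by apply: (out x) => //; rewrite !inE eqxx orbT.
have aN : a \notin cover C.
  by apply: av (_ : _ = [set [set a; b]; [set a; x]; [set a; d]]) xaN adN; rewrite sta set3C.
have abN : [set b; a] \notin C by apply: (out a) => //; rewrite !inE eqxx orbT.
have bN : b \notin cover C.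
  apply: av (_ : _ = [set [set b; d]; [set b; x]; [set b; a]]) _ abN; first by rewrite stb set3R.
  by rewrite setUC.
have bdN : [set d; b] \notin C by apply: (out b) => //; rewrite !inE eqxx orbT.
have dN : d \notin cover C.
  apply: av (_ : _ = [set [set d; x]; [set d; a]; [set d; b]]) _ bdN; first by rewrite std.
  by rewrite setUC.
by [].
Qed.

Lemma cubic_forests p q U : pairs U -> (forall x, #|star U x| <= 3) ->
  (forall e, p e != q e) -> colourable (@cyclic T) p q U.
Proof.
have [n] := ubnP #|U|; elim: n => // n IHn in p q U * => cU pU deg pq.
apply: contrapT => nU.
have IH V : V \proper U -> colourable (@cyclic T) p q V.
  move=> pV; apply: IHn => //.
  - exact: leq_trans (proper_card pV) _.
  - exact: pairs_sub (proper_sub pV) pU.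
  - move=> x; apply: leq_trans (deg x); apply: subset_leq_card.
    exact: starS (proper_sub pV).
have forced x : x \in cover U -> #|star U x| = 3 /\
    exists r l, r != l /\ forall e, e \in star U x -> same_list p q r l e.
  move=> xU; have [s ls|h1 h2] := @list_balance _ (star U x) p q 1 (ltnSn 0) pq.
    apply: contrapT => h; apply: nU.
    apply: (rainbow_colourable ls) => [c|].
      rewrite leqNgt; apply/negP => hc. apply: h; exists c. exact: hc.
    exact: IH (crit_star_proper xU).
  have c3 : #|star U x| = 3 by apply/eqP; rewrite eqn_leq deg.
  by split => //; have [r [b [rb h]]] := h2 c3; exists r, b.
have [U0|[e0 e0U]] := set_0Vmem U.
  apply: nU; exists p => [e|]; first by left.
  apply/goodP => C; rewrite U0 subset0 => /eqP ->.
  by rewrite /cyclic eqxx.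
have /card_gt0P[x xe0] : 0 < #|e0| by rewrite (pairsP _ pU _ e0U).
have xU : x \in cover U by apply/in_coverP; exists e0.
(* No star can be bypassed, so the neighbours of every vertex are pairwise adjacent and only the
   complete graph on four vertices remains. *)
have bypass x' a b d : x' \in cover U -> a != b -> b != d -> a != d ->
    x' \notin [set a; b; d] ->
    star U x' = [set [set x'; a]; [set x'; b]; [set x'; d]] -> [set a; b] \in U.
  move=> xU' ab bd ad nx st; apply: contrapT => /negP nab; apply: nU.
  have [_ [r [l [rl hL]]]] := forced _ xU'.
  apply: (bypass_colourable pU pq rl hL st ab bd ad nx nab) => // p' q' V pV dV pq' cV.
  by apply: IHn => //; apply: leq_trans cV _.
have [c3 [r [l [rl hL]]]] := forced _ xU.
have [a [b [d [ab bd ad nx st]]]] := star_set3 pU c3.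
have abU := bypass _ _ _ _ xU ab bd ad nx st.
have adU : [set a; d] \in U.
  apply: (bypass x a d b) => //; first by rewrite eq_sym.
    by rewrite setUAC.
  by rewrite st setUAC.
have bdU : [set b; d] \in U.
  apply: (bypass x b d a) => //; first by rewrite eq_sym.
  - by rewrite eq_sym.
  - by rewrite set3R.
  by rewrite st [RHS]set3R.
have xaS : [set x; a] \in star U x by rewrite st !inE eqxx.
have xbS : [set x; b] \in star U x by rewrite st !inE eqxx orbT.
have xdS : [set x; d] \in star U x by rewrite st !inE eqxx !orbT.
have via y z : [set x; y] \in star U x -> [set y; z] \in U -> same_list p q r l [set y; z].
  move=> yS yzU.
  have yU : y \in cover U by apply/in_coverP; exists [set y; z]; rewrite // !inE eqxx.
  have [_ [r' [l' [rl' hL']]]] := forced _ yU.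
  apply: (same_list_trans rl (hL _ yS)).
    by apply: hL'; rewrite in_star !inE eqxx orbT andbT; move: yS; rewrite in_star => /andP[].
  by apply: hL'; rewrite in_star yzU !inE eqxx.
have inU y : [set x; y] \in star U x -> [set x; y] \in U by rewrite in_star => /andP[].
apply: nU; apply: (complete4_colourable pU rl deg (And3 ab bd ad) nx) => //.
- by split; apply: inU.
- move=> e; rewrite !inE => /orP[/orP[]|] /eqP ->; [exact: hL|exact: via|exact: via].
- move=> e; rewrite !inE => /orP[/orP[]|] /eqP ->; [exact: hL|exact: hL|exact: via].
Qed.

End CubicForests.

(** * Extending a list colouring to four edges at a vertex *)

Section FourStar.

Definition list2 (L : nat -> Prop) : Prop :=
  exists a b, a <> b /\ forall x, L x <-> (x = a \/ x = b).

Lemma list2_other L c : list2 L -> exists2 y, L y & y <> c.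
Proof.
move=> [a [b [ab h]]]; case: (eqVneq a c) => [ac|/eqP ac].
  by exists b; [apply/h; right|rewrite -ac => /esym].
by exists a => //; apply/h; left.
Qed.

Lemma list2_third L x y z : list2 L -> L x -> L y -> L z -> x <> y -> z = x \/ z = y.
Proof. by move=> [a [b [ab h]]] /h[]-> /h[]-> /h[]->; tauto. Qed.

(** [s], [t], [u], [w] are four edges at a vertex, and [Kst c] says that the far ends of [s] and [t]
    are joined by an edge of colour [c]. The first block excludes monochromatic triangles, the
    second three equal colours. *)
Definition spread (Kst Ksu Ksw Ktu Ktw Kuw : nat -> Prop) cs ct cu cw : Prop :=
  ((cs = ct -> ~ Kst cs) /\ (cs = cu -> ~ Ksu cs) /\ (cs = cw -> ~ Ksw cs) /\
   (ct = cu -> ~ Ktu ct) /\ (ct = cw -> ~ Ktw ct) /\ (cu = cw -> ~ Kuw cu)) /\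
  (~ (cs = ct /\ ct = cu) /\ ~ (cs = ct /\ ct = cw) /\
   ~ (cs = cu /\ cu = cw) /\ ~ (ct = cu /\ cu = cw)).

Variables (Ls Lt Lu Lw : nat -> Prop).
Hypotheses (t2 : list2 Lt) (u2 : list2 Lu) (w2 : list2 Lw).

Let single (K : nat -> Prop) := forall c c', K c -> K c' -> c = c'.

(** Give [a] to [u] and [b] to [w]; only a triangle through [s] can then fail. If it does for both
    colours of [s], then [u] or [w] is recoloured, or their colours are swapped. *)
Lemma four_star_half Kst Ksu Ksw Ktu Ktw Kuw a b : single Ksw ->
  (forall c, Ls c -> ~ Lt c) -> Lu a -> Lw b -> a <> b -> Ls a -> Ls b ->
  exists cs ct cu cw, [/\ Ls cs, Lt ct, Lu cu & Lw cw] /\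
    spread Kst Ksu Ksw Ktu Ktw Kuw cs ct cu cw.
Proof.
move=> sK dis ua wb ab sa sb.
have ta ct : Lt ct -> ct <> a by move=> h e; subst ct; exact: (dis a).
have tb ct : Lt ct -> ct <> b by move=> h e; subst ct; exact: (dis b).
have [ct tct _] := list2_other 0 t2.
have na := ta _ tct; have nb := tb _ tct.
case: (pselect (Ksu a)) => [Ka|nKa]; last first.
  by exists a, ct, a, b; split=> //; rewrite /spread; intuition (subst; tauto || congruence).
case: (pselect (Ksw b)) => [Kb|nKb]; last first.
  by exists b, ct, a, b; split=> //; rewrite /spread; intuition (subst; tauto || congruence).
have [a' ua' na'] := list2_other a u2.
case: (eqVneq a' b) => [a'b|/eqP a'b]; last first.
  have [c tc nc] := list2_other a' t2.
  have := ta _ tc; have := tb _ tc => h1 h2.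
  by exists a, c, a', b; split=> //; rewrite /spread; intuition congruence.
have [b' wb' nb'] := list2_other b w2.
case: (eqVneq b' a) => [b'a|/eqP b'a]; last first.
  have [c tc nc] := list2_other b' t2.
  have := ta _ tc; have := tb _ tc => h1 h2.
  by exists b, c, a, b'; split=> //; rewrite /spread; intuition congruence.
have nKa : ~ Ksw a by move=> h; apply: ab; apply: sK.
exists a, ct, b, a; split; first by split=> //; congruence.
by rewrite /spread; intuition (subst; tauto || congruence).
Qed.

End FourStar.

(** If [s] and [t] have a common colour [c], both take it, and [u], [w] should take different
    colours other than [c]. If they cannot, their lists coincide and they take the same colour,
    since [Kuw] forbids at most one. If the lists of [s] and [t] are disjoint, [u] and [w] take
    different colours [a], [b], and [s], [t] avoid both unless one of their lists is [{a, b}]. *)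
Lemma four_star (Ls Lt Lu Lw : nat -> Prop) (Kst Ksu Ksw Ktu Ktw Kuw : nat -> Prop) :
  list2 Ls -> list2 Lt -> list2 Lu -> list2 Lw ->
  (forall c c', Ksw c -> Ksw c' -> c = c') ->
  (forall c c', Ktw c -> Ktw c' -> c = c') ->
  (forall c c', Kuw c -> Kuw c' -> c = c') ->
  (forall c, Ls c -> Lt c -> ~ Kst c) ->
  exists cs ct cu cw, [/\ Ls cs, Lt ct, Lu cu & Lw cw] /\
    spread Kst Ksu Ksw Ktu Ktw Kuw cs ct cu cw.
Proof.
move=> s2 t2 u2 w2 ksw ktw kuw H.
case: (pselect (exists c, Ls c /\ Lt c)) => [[c [sc tc]]|dis].
  have Hc := H c sc tc.
  case: (pselect (exists a b, [/\ Lu a, Lw b, a <> c, b <> c & a <> b])) => [[a [b [ua wb ac bc ab]]]|nab].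
    by exists c, c, a, b; split=> //; rewrite /spread; intuition (subst; tauto || congruence).
  have [x ux xc] := list2_other c u2.
  have [x' wx x'c] := list2_other c w2.
  have xx : x' = x.
    by apply: contrapT => h; apply: nab; exists x, x'; split=> //; congruence.
  subst x'.
  have uc : Lu c.
    have [z uz zx] := list2_other x u2.
    suff <- : z = c by [].
    by apply: contrapT => zc; apply: nab; exists z, x.
  have wc : Lw c.
    have [z wz zx] := list2_other x w2.
    suff <- : z = c by [].
    by apply: contrapT => zc; apply: nab; exists x, z; split=> //; congruence.
  case: (pselect (Kuw x)) => [Kx|nKx]; last first.
    by exists c, c, x, x; split=> //; rewrite /spread; intuition (subst; tauto || congruence).
  have nKc : ~ Kuw c by move=> h; apply: xc; apply: kuw.
  have [y sy yc] := list2_other c s2.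
  have [z tz zc] := list2_other c t2.
  have Hyz : y = z -> ~ Kst y by move=> yz; apply: H => //; rewrite yz.
  by exists y, z, c, c; split=> //; rewrite /spread; intuition (subst; tauto || congruence).
have [a ua _] := list2_other 0 u2.
have [b wb ba] := list2_other a w2.
have ab : a <> b by congruence.
have dst c : Ls c -> ~ Lt c by move=> sc tc; apply: dis; exists c.
have full L : list2 L -> ~ (exists2 c, L c & c <> a /\ c <> b) -> L a /\ L b.
  move=> L2 h; have L2' := L2; case: L2' => [x [y [xy hL]]].
  have lx : L x by apply/hL; left.
  have ly : L y by apply/hL; right.
  have hx : x = a \/ x = b.
    by apply: contrapT => n; apply: h; exists x => //; tauto.
  have hy : y = a \/ y = b.
    by apply: contrapT => n; apply: h; exists y => //; tauto.
  by case: hx => ?; case: hy => ?; subst; tauto.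
case: (pselect (exists2 c, Ls c & c <> a /\ c <> b)) => [[cs ss [sa sb]]|/(full _ s2)[sa sb]]; last first.
  by apply: four_star_half ua wb ab sa sb.
case: (pselect (exists2 c, Lt c & c <> a /\ c <> b)) => [[ct tt [ta tb]]|/(full _ t2)[ta tb]]; last first.
  have [|ct [cs' [cu [cw [[h1 h2 h3 h4] h]]]]] :=
    @four_star_half Lt Ls Lu Lw s2 u2 w2 Kst Ktu Ktw Ksu Ksw Kuw a b ktw _ ua wb ab ta tb.
    by move=> c tc sc; apply: dst tc.
  exists cs', ct, cu, cw; split=> //; move: h; rewrite /spread => h.
  by intuition (subst; tauto || congruence).
have st : cs <> ct by move=> e; apply: (dst cs) => //; rewrite e.
by exists cs, ct, a, b; split=> //; rewrite /spread; intuition congruence.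
Qed.

(** * The complete graph on five vertices *)

Section CompleteFive.
Variable T : finType.
Implicit Types (x y z v a b d e : T) (K : {set T}).

Lemma set2_eq x y z t : [set x; y] = [set z; t] :> {set T} ->
  (x = z /\ y = t) \/ (x = t /\ y = z).
Proof.
move=> h; have : x \in [set z; t] by rewrite -h !inE eqxx.
rewrite !inE => /orP[] /eqP xz; subst x.
  by left; split => //; exact: pair_inj h.
by right; split => //; apply: (@pair_inj _ t); rewrite h setUC.
Qed.

Definition in_list (p q : {set T} -> nat) g c : Prop := c = p g \/ c = q g.

Lemma in_list2 p q g : (forall g, p g != q g) -> list2 (in_list p q g).
Proof. by move=> pq; exists (p g), (q g); split => //; apply/eqP. Qed.

Definition no_mono_triangle (chi : {set T} -> nat) K : Prop :=
  forall x y z, x \in K -> y \in K -> z \in K -> x != y -> y != z -> x != z ->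
    ~ (chi [set x; y] = chi [set x; z] /\ chi [set x; z] = chi [set y; z]).

Lemma table5 p q K v s (N : nat -> nat -> nat) :
  (forall x, (x \in K) = (x \in s)) -> uniq s -> size s = 5 ->
  (forall i j, i < j < 5 -> in_list p q [set nth v s i; nth v s j] (N i j)) ->
  (forall i j k, i < j < k -> k < 5 -> ~ (N i j = N i k /\ N i k = N j k)) ->
  exists2 chi, list_choice p q chi & no_mono_triangle chi K.
Proof.
move=> Ks us s5 hN htri.
pose f (i : 'I_5) := nth v s i.
have finj : injective f.
  move=> i j /eqP; rewrite nth_uniq ?s5 // => /eqP; exact: val_inj.
pose M (i j : nat) := if i < j then N i j else N j i.
pose Q g (ij : 'I_5 * 'I_5) := (ij.1 != ij.2) && (g == [set f ij.1; f ij.2]).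
pose chi g := if [pick ij | Q g ij] is Some ij then M ij.1 ij.2 else p g.
have Msym i j : M i j = M j i.
  by rewrite /M; case: ltngtP => // ->.
have chiE (i j : 'I_5) : i != j -> chi [set f i; f j] = M i j.
  move=> ij; rewrite /chi; case: pickP => [[k l] /andP[/= kl /eqP h]|/(_ (i, j))]; last first.
    by rewrite /Q /= ij eqxx.
  by have [[/finj -> /finj ->]|[/finj -> /finj ->]] := set2_eq h.
have hM (i j : 'I_5) : i != j -> in_list p q [set f i; f j] (M i j).
  move=> ij; rewrite /M; case: ltngtP => h.
  - by apply: hN; rewrite h ltn_ord.
  - by rewrite setUC; apply: hN; rewrite h ltn_ord.
  - by case/eqP: ij; exact: val_inj.
exists chi => [g|].
  rewrite /chi; case: pickP => [[k l] /andP[/= kl /eqP ->]|_]; last by left.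
  exact: hM.
have fK x : x \in K -> exists i, x = f i.
  rewrite Ks => /(nthP v)[i]; rewrite s5 => i5 <-.
  by exists (Ordinal i5).
have main (i j k : nat) : i < j < k -> k < 5 -> ~ (M i j = M i k /\ M i k = M j k).
  move=> /[dup] h /andP[ij jk] k5; rewrite /M ij jk (ltn_trans ij jk); exact: htri.
have any (i j k : 'I_5) : i != j -> j != k -> i != k -> ~ (M i j = M i k /\ M i k = M j k).
  move=> ij jk ik; rewrite -!(inj_eq val_inj) /= in ij jk ik.
  case: (ltngtP i j) ij => // ij _; case: (ltngtP j k) jk => // jk _;
    case: (ltngtP i k) ik => // ik _; try lia.
  - by apply: main; rewrite ?ij.
  - by have := @main i k j; rewrite ik jk (Msym k j) => /(_ isT (ltn_ord j)) h [h1 h2]; apply: h; split; congruence.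
  - by have := @main k i j; rewrite ij ik (Msym k i) (Msym k j) => /(_ isT (ltn_ord j)) h [h1 h2]; apply: h; split; congruence.
  - by have := @main j i k; rewrite ij ik (Msym j i) => /(_ isT (ltn_ord k)) h [h1 h2]; apply: h; split; congruence.
  - by have := @main j k i; rewrite jk ik (Msym j i) (Msym k i) => /(_ isT (ltn_ord i)) h [h1 h2]; apply: h; split; congruence.
  - by have := @main k j i; rewrite jk ij (Msym k j) (Msym k i) (Msym j i) => /(_ isT (ltn_ord i)) h [h1 h2]; apply: h; split; congruence.
move=> x y z /fK[i ->] /fK[j ->] /fK[k ->]; rewrite !(inj_eq finj) => ij jk ik.
by rewrite !chiE //; apply: any.
Qed.

(** If all lists agree, use a pentagon and the complementary pentagram. Otherwise two edges from
    some [v] to [a] and [b] have at most one common colour, and the edge [ab] can avoid it. The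
    other edges off [v] are chosen one after the other so that no triangle off [v] is monochromatic,
    and [four_star] colours the star of [v]. *)
Lemma complete5_colouring p q K : #|K| = 5 -> (forall g, p g != q g) ->
  exists2 chi, list_choice p q chi & no_mono_triangle chi K.
Proof.
move=> K5 pq; have l2 g := in_list2 g pq.
case: (pselect (exists v a b c, [/\ v \in K, a \in K & b \in K] /\
    [/\ v != a, v != b, a != b & in_list p q [set v; a] c /\ ~ in_list p q [set v; b] c])); last first.
  move=> h.
  have step v a b c : v \in K -> a \in K -> b \in K -> v != a -> v != b ->
      in_list p q [set v; a] c -> in_list p q [set v; b] c.
    move=> vK aK bK va vb hc; case: (eqVneq a b) => [<- //|ab].
    by apply: contrapT => hn; apply: h; exists v, a, b, c.
  have : size (enum K) = 5 by rewrite -cardE.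
  have := enum_uniq K; have := mem_enum K; set s := enum K => sK us s5.
  have [x0 _] : exists x, x \in K by apply/card_gt0P; rewrite K5.
  have nK i : i < 5 -> nth x0 s i \in K by move=> i5; rewrite -sK mem_nth ?s5.
  have nn i j : i < j < 5 -> nth x0 s i != nth x0 s j.
    by move=> /andP[ij j5]; rewrite nth_uniq ?s5 ?(ltn_trans ij j5) // neq_ltn ij.
  pose g0 := [set nth x0 s 0; nth x0 s 1].
  have all0 i j c : i < j < 5 -> in_list p q g0 c -> in_list p q [set nth x0 s i; nth x0 s j] c.
    move=> ij h0; have /andP[ij' j5] := ij.
    have i5 := ltn_trans ij' j5.
    case: i ij ij' i5 => [|i] ij ij' i5.
      exact: (step _ _ _ _ (nK 0 isT) (nK 1 isT) (nK j j5) (nn 0 1 isT) (nn 0 j ij) h0).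
    have h1 : in_list p q [set nth x0 s 0; nth x0 s j] c.
      have h0j : 0 < j < 5 by rewrite j5 (leq_ltn_trans _ ij').
      exact: (step _ _ _ _ (nK 0 isT) (nK 1 isT) (nK j j5) (nn 0 1 isT) (nn 0 j h0j) h0).
    rewrite setUC; rewrite setUC in h1.
    have h0j : 0 < j < 5 by rewrite j5 (leq_ltn_trans _ ij').
    apply: (step _ _ _ _ (nK j j5) (nK 0 isT) (nK _ i5) _ _ h1).
      by rewrite eq_sym nn.
    by rewrite eq_sym nn.
  pose N i j := match i, j with
    | 0, 1 | 0, 4 | 1, 2 | 2, 3 | 3, 4 => p g0 | _, _ => q g0 end.
  apply: (@table5 p q K x0 s N) => // [i j ij|i j k].
    apply: all0 => //; rewrite /N.
    by case: i j ij => [|[|[|[|[|i]]]]] [|[|[|[|[|j]]]]] //= _; by [left|right].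
  have := pq g0; rewrite /N => /eqP.
  case: i j k => [|[|[|[|[|i]]]]] [|[|[|[|[|j]]]]] [|[|[|[|[|k]]]]] //= n h3 h4 [h1 h2];
    first [congruence | lia].
move=> [v [a [b [c0 [[vK aK bK] [va vb ab [hva hvb]]]]]]].
have [d [e [[de dK eK [dv da db] [ev ea eb]] Kin]]] : exists d e, [/\ d != e, d \in K, e \in K,
    [/\ d != v, d != a & d != b] & [/\ e != v, e != a & e != b]] /\
    forall x, (x \in K) = (x \in [:: v; a; b; d; e]).
  have : #|K :\ v :\ a :\ b| == 2.
    have := cardsD1 v K; rewrite vK K5.
    have := cardsD1 a (K :\ v); rewrite !inE aK eq_sym va.
    have := cardsD1 b (K :\ v :\ a); rewrite !inE bK ![b == _]eq_sym ab vb /=.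
    by lia.
  move/cards2P => [d [e [de h]]].
  have inx x : (x \in K :\ v :\ a :\ b) = (x == d) || (x == e) by rewrite h !inE.
  have := inx d; rewrite !inE eqxx => /and4P[db da dv dK].
  have := inx e; rewrite !inE eqxx orbT => /and4P[eb ea ev eK].
  exists d, e; split=> // x; have := inx x; rewrite !inE.
  case: (eqVneq x v) => [->|_] //=; case: (eqVneq x a) => [->|_] //=.
  by case: (eqVneq x b) => [->|_].
have [cab hab nab] : exists2 c, in_list p q [set a; b] c &
    forall c', in_list p q [set v; a] c' -> in_list p q [set v; b] c' -> c' <> c.
  case: (pselect (exists c, in_list p q [set v; a] c /\ in_list p q [set v; b] c)) => [[c [h1 h2]]|n].
    have [y hy yc] := list2_other c (l2 [set a; b]).
    exists y => // c' h1' h2'.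
    have c0c : c0 <> c by move=> h; apply: hvb; rewrite h.
    have [h|->] := list2_third (l2 [set v; a]) hva h1 h1' c0c; last by move/esym.
    by case: hvb; rewrite -h.
  have [y hy _] := list2_other 0 (l2 [set a; b]).
  by exists y => // c' h1 h2; case: n; exists c'.
have [cad had nad] := list2_other cab (l2 [set a; d]).
have [cae hae nae] := list2_other cab (l2 [set a; e]).
have [cde hde nde] := list2_other cad (l2 [set d; e]).
have [cbd hbd nbd] := list2_other cde (l2 [set b; d]).
have [cbe hbe _] := list2_other 0 (l2 [set b; e]).
have [||||cva [cvb [cvd [cve [[h1 h2 h3 h4] hs]]]]] := @four_star _ _ _ _
    (eq cab) (eq cad) (eq cae) (eq cbd) (eq cbe) (eq cde)
    (l2 [set v; a]) (l2 [set v; b]) (l2 [set v; d]) (l2 [set v; e]).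
- by move=> ? ? <-.
- by move=> ? ? <-.
- by move=> ? ? <-.
- by move=> c ha hb hc; apply: (nab c).
pose N i j := match i, j with
  | 0, 1 => cva | 0, 2 => cvb | 0, 3 => cvd | 0, 4 => cve
  | 1, 2 => cab | 1, 3 => cad | 1, 4 => cae | 2, 3 => cbd | 2, 4 => cbe
  | 3, 4 => cde | _, _ => 0 end.
apply: (@table5 p q K v [:: v; a; b; d; e] N) => //.
- by rewrite /= !inE !negb_or va vb ab de ![v == _]eq_sym dv ev ![a == _]eq_sym da ea ![b == _]eq_sym db eb.
- move=> i j /andP[]; clear - h1 h2 h3 h4 hab had hae hde hbd hbe.
  by move: i j => [|[|[|[|[|i]]]]] [|[|[|[|[|j]]]]].
have [[k1 [k2 [k3 [k4 [k5 k6]]]]] _] := hs.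
clear - k1 k2 k3 k4 k5 k6 nad nae nde nbd.
move=> i j k /andP[].
case: i j k => [|[|[|[|[|i]]]]] [|[|[|[|[|j]]]]] [|[|[|[|[|k]]]]] // _ _ _ [/= e1 e2];
    first [congruence | apply: k1; congruence | apply: k2; congruence
      | apply: k3; congruence | apply: k4; congruence | apply: k5; congruence
      | apply: k6; congruence].
Qed.

End CompleteFive.

(** * Four-regular graphs with [m] at least two *)

Section FourRegular.
Variables (R : realFieldType) (T : finType) (m : R).
Implicit Types (C D E V : {set {set T}}) (f g : {set T}) (x y a b d e i j : T).
Local Open Scope ring_scope.
Variables (p q : {set T} -> nat) (U : {set {set T}}).
Hypothesis m1 : 1 < m.
Hypothesis m2 : 2 <= m.
Hypothesis pq : forall g, p g != q g.
Hypothesis pU : pairs U.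

Definition nb E x : {set T} := [set y | [set x; y] \in E].

Lemma in_nb E x y : (y \in nb E x) = ([set x; y] \in E).
Proof. by rewrite inE. Qed.

Lemma nb_neq E x y : pairs E -> y \in nb E x -> x != y.
Proof. by move=> /pairsP pE; rewrite in_nb => /pE; rewrite cards2; case: eqP. Qed.

Lemma star_imset E x : pairs E -> star E x = [set [set x; y] | y in nb E x].
Proof.
move=> /pairsP pE; apply/setP => g; apply/idP/imsetP => [|[y]]; last first.
  by rewrite in_nb => yE ->; rewrite in_star yE !inE eqxx.
rewrite in_star => /andP[gE xg].
have [y yx gy] := pair_other (pE _ gE) xg.
by exists y; rewrite // in_nb -gy.
Qed.

Lemma card_nb E x : pairs E -> #|nb E x| = #|star E x|.
Proof.
by move=> pE; rewrite star_imset // card_imset // => y z; exact: pair_inj.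
Qed.

Lemma crit_triangle_or_cubic C : crit m C ->
  (forall x y, x \in cover C -> y \in cover C -> x != y -> [set x; y] \in C) \/
  (forall x, x \in cover C -> (3 <= #|star C x|)%N).
Proof.
move=> cC; case: (leqP 4 #|cover C|) => c4; [right => x xC|left].
  have := crit_deg_big m1 cC xC c4; have := m2 => h h'.
  by rewrite -(ltr_nat R); apply: le_lt_trans h'.
have /pairsP pC := crit_pairs cC.
have c3 : #|cover C| = 3%N by apply/eqP; rewrite eqn_leq -ltnS c4 (crit_cover cC).
have eC : C = [set g : {set T} | (g \subset cover C) && (#|g| == 2%N)].
  apply/eqP; rewrite eqEcard; apply/andP; split.
    by apply/subsetP => g gC; rewrite inE (pC _ gC) sub_cover ?eqxx.
  by rewrite cards_draws c3; apply: crit_card m1 _ _.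
move=> x y xC yC xy; rewrite eC inE cards2 xy subUset !sub1set xC yC.
by rewrite eqxx.
Qed.

(** A critical graph is a triangle or has three edges at each of its vertices, so [four_star]
    extends [chi] to the star of [x] unless its last hypothesis fails for the pair [a], [b]. *)
Lemma extend_degree4 x a b d e chi :
  ~ colourable (crit m) p q U ->
  star U x = [set [set x; a]; [set x; b]; [set x; d]; [set x; e]] ->
  uniq [:: a; b; d; e] -> x \notin [:: a; b; d; e] ->
  list_choice p q chi -> good (crit m) chi (U :\: star U x) ->
  exists c, [/\ in_list p q [set x; a] c, in_list p q [set x; b] c,
    [set a; b] \in U & chi [set a; b] = c].
Proof.
move=> nU st un nx lchi gchi; apply: contrapT => hn; apply: nU.
move: un; rewrite /= !inE !negb_or !andbT => /and3P[/and3P[ab ad ae] /andP[bd be] de].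
move: nx; rewrite !inE !negb_or => /and4P[xa xb xd xe].
pose K i j c := ([set i; j] \in U) /\ chi [set i; j] = c.
have sK i j c c' : K i j c -> K i j c' -> c = c' by move=> [_ <-] [_ <-].
have l2 g := in_list2 g pq.
have [|ca [cb [cd [ce [[ha hb hd he] [hs ht]]]]]] := @four_star _ _ _ _
    (K a b) (K a d) (K a e) (K b d) (K b e) (K d e)
    (l2 [set x; a]) (l2 [set x; b]) (l2 [set x; d]) (l2 [set x; e])
    (@sK a e) (@sK b e) (@sK d e).
  by move=> c h1 h2 [h3 h4]; apply: hn; exists c.
have nn y z : y != z -> [set x; y] != [set x; z] by apply: contra_neq => /pair_inj.
pose s g := if g == [set x; a] then ca else if g == [set x; b] then cb else
  if g == [set x; d] then cd else if g == [set x; e] then ce else p g.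
have ls : list_choice p q s.
  move=> g; rewrite /s; case: eqP => [->//|_]; case: eqP => [->//|_].
  by case: eqP => [->//|_]; case: eqP => [->//|_]; left.
have sa : s [set x; a] = ca by rewrite /s eqxx.
have sb : s [set x; b] = cb by rewrite /s eqxx (negPf (nn _ _ _)) // eq_sym.
have sd : s [set x; d] = cd.
  by rewrite /s eqxx !(negPf (nn _ _ _)) // eq_sym.
have se : s [set x; e] = ce.
  by rewrite /s eqxx !(negPf (nn _ _ _)) // eq_sym.
exists (mixed x s chi) => [g|]; first by rewrite /mixed; case: ifP.
apply/goodP => C sC cC; apply/negP => mC; have /monoP[c hc] := mC.
have mixE g : x \notin g -> mixed x s chi g = chi g by rewrite /mixed => /negPf ->.
have mixI y : mixed x s chi [set x; y] = s [set x; y] by rewrite /mixed !inE eqxx.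
case: (boolP (x \in cover C)) => xC; last first.
  case/negP: (goodP _ _ _ gchi C (sub_diff_star sC xC) cC).
  rewrite -(mono_eq_in (chi := mixed x s chi)) // => g gC.
  by apply: mixE; apply: contra xC => xg; apply/in_coverP; exists g.
have cstar : #|star C x| = (([set x; a] \in C) + ([set x; b] \in C)
    + ([set x; d] \in C) + ([set x; e] \in C))%N.
  have -> : star C x = star U x :&: C.
    apply/setP => g; rewrite in_setI !in_star; case gC: (g \in C); last by rewrite andbF.
    by rewrite (subsetP sC _ gC) andbT.
  rewrite -sum1_card (eq_bigl (fun g => (g \in star U x) && (g \in C))); last first.
    by move=> g; rewrite in_setI.
  rewrite big_mkcondr st -!setUA /=.
  have ones (b0 : bool) : (if b0 then 1 else 0)%N = b0 by case: b0.
  rewrite big_setU1 /= ?inE ?negb_or ?nn // big_setU1 /= ?inE ?negb_or ?nn //.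
  by rewrite big_setU1 /= ?inE ?nn // big_set1 !ones !addnA.
have Ca : [set x; a] \in C -> ca = c by move=> /hc; rewrite mixI sa.
have Cb : [set x; b] \in C -> cb = c by move=> /hc; rewrite mixI sb.
have Cd : [set x; d] \in C -> cd = c by move=> /hc; rewrite mixI sd.
have Ce : [set x; e] \in C -> ce = c by move=> /hc; rewrite mixI se.
case: (crit_triangle_or_cubic cC) => [tri|/(_ _ xC)]; last first.
  have [t1 [t2 [t3 t4]]] := ht.
  rewrite cstar; move: Ca Cb Cd Ce; clear - t1 t2 t3 t4.
  case: (_ \in C) => [/(_ isT) ?|_]; case: (_ \in C) => [/(_ isT) ?|_];
    case: (_ \in C) => [/(_ isT) ?|_]; case: (_ \in C) => [/(_ isT) ?|_] //= _;
    first [by apply: t1; split; congruence | by apply: t2; split; congruence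
      | by apply: t3; split; congruence | by apply: t4; split; congruence].
have tK i j : x != i -> x != j -> i != j -> [set x; i] \in C -> [set x; j] \in C -> K i j c.
  move=> xi xj ij iC jC.
  have ijC : [set i; j] \in C.
    by apply: tri => //; apply/in_coverP; [exists [set x; i]|exists [set x; j]] => //;
      rewrite !inE eqxx orbT.
  split; first exact: (subsetP sC).
  by rewrite -(hc _ ijC) mixE // !inE negb_or xi.
have := crit_deg2 m1 cC xC; rewrite cstar.
have Kab := tK _ _ xa xb ab; have Kad := tK _ _ xa xd ad; have Kae := tK _ _ xa xe ae.
have Kbd := tK _ _ xb xd bd; have Kbe := tK _ _ xb xe be; have Kde := tK _ _ xd xe de.
have [k1 [k2 [k3 [k4 [k5 k6]]]]] := hs.
move: Ca Cb Cd Ce Kab Kad Kae Kbd Kbe Kde; clear - k1 k2 k3 k4 k5 k6.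
case: (_ \in C) => Ca; case: (_ \in C) => Cb; case: (_ \in C) => Cd;
  case: (_ \in C) => Ce //= Kab Kad Kae Kbd Kbe Kde _;
  first [by apply: k1; rewrite Ca ?Cb //; apply: Kab
    | by apply: k2; rewrite Ca ?Cd //; apply: Kad
    | by apply: k3; rewrite Ca ?Ce //; apply: Kae
    | by apply: k4; rewrite Cb ?Cd //; apply: Kbd
    | by apply: k5; rewrite Cb ?Ce //; apply: Kbe
    | by apply: k6; rewrite Cd ?Ce //; apply: Kde].
Qed.

Hypothesis nU : ~ colourable (crit m) p q U.
Hypothesis minU : forall V : {set {set T}}, V \proper U -> colourable (crit m) p q V.
Hypothesis deg4 : forall x, x \in cover U -> #|star U x| = 4%N.

Lemma nb_adjacent x a b : x \in cover U -> a \in nb U x -> b \in nb U x -> a != b ->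
  [set a; b] \in U.
Proof.
move=> xU aN bN ab.
have [chi lchi gchi] := minU (crit_star_proper xU).
have : #|nb U x :\ a :\ b| == 2%N.
  have := cardsD1 a (nb U x); rewrite aN card_nb // deg4 //.
  have := cardsD1 b (nb U x :\ a); rewrite in_setD1 bN eq_sym ab /=.
  by rewrite !add1n => -> [<-].
move/cards2P => [d [e [de h]]].
have inx y : (y \in nb U x :\ a :\ b) = (y == d) || (y == e) by rewrite h !inE.
have := inx d; rewrite !in_setD1 eqxx => /and3P[db da dN].
have := inx e; rewrite !in_setD1 eqxx orbT => /and3P[eb ea eN].
have Nab : nb U x = [set a; b; d; e].
  apply/setP => y; have := inx y; rewrite !in_setD1 !in_setU !in_set1.
  case: (eqVneq y a) => [->|_] /=; first by rewrite aN.
  by case: (eqVneq y b) => [->|_] /=; first by rewrite bN.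
have st : star U x = [set [set x; a]; [set x; b]; [set x; d]; [set x; e]].
  by rewrite star_imset // Nab !imsetU !imset_set1.
have [||c [_ _ abU _]] // := extend_degree4 nU st _ _ lchi gchi.
- by rewrite /= !inE !negb_or ab ![a == _]eq_sym da ea ![b == _]eq_sym db eb de.
- by rewrite !inE !negb_or (nb_neq pU aN) (nb_neq pU bN) (nb_neq pU dN) (nb_neq pU eN).
Qed.

(** By [nb_adjacent], [x] and its neighbours form a complete component on five vertices, which is
    coloured separately by [complete5_colouring]. *)
Lemma no_four_regular : U != set0 -> False.
Proof.
move=> /set0Pn[f0 f0U].
have /card_gt0P[x xf0] : (0 < #|f0|)%N by rewrite (pairsP _ pU _ f0U).
have xU : x \in cover U by apply/in_coverP; exists f0.
pose K := x |: nb U x.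
have xN : x \notin nb U x by apply/negP => /(nb_neq pU); rewrite eqxx.
have K5 : #|K| = 5%N by rewrite cardsU1 xN card_nb // deg4.
have nbK y : y \in K -> nb U y = K :\ y.
  rewrite in_setU1 => /orP[/eqP ->|yN]; first by rewrite setU1K.
  have yU : y \in cover U.
    by apply/in_coverP; exists [set x; y]; rewrite -?in_nb // !inE eqxx orbT.
  have yK : y \in K by rewrite in_setU1 yN orbT.
  apply/esym/eqP; rewrite eqEcard; apply/andP; split; last first.
    by rewrite card_nb // deg4 //; have := cardsD1 y K; rewrite yK K5 add1n => -[<-].
  apply/subsetP => z; rewrite in_setD1 in_setU1 => /andP[zy /orP[/eqP ->|zN]].
    by rewrite in_nb setUC -in_nb.
  by rewrite in_nb; apply: nb_adjacent xU yN zN _; rewrite eq_sym.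
have inK y z : y \in K -> [set y; z] \in U -> z \in K.
  by move=> yK; rewrite -in_nb nbK // => /setD1P[].
pose Y := [set g in U | g \subset K].
have pV : U :\: Y \proper U.
  rewrite properE subsetDl; apply/subsetPn; exists f0 => //.
  rewrite !inE f0U /= andbT negbK; apply/subsetP => y yf.
  have [z zx fE] := pair_other (pairsP _ pU _ f0U) xf0.
  rewrite fE !inE in yf *; case/orP: yf => /eqP ->; first by rewrite eqxx.
  by rewrite -fE f0U orbT.
have [chi1 l1 g1] := minU pV.
have [chi5 l5 t5] := complete5_colouring K5 pq.
apply: nU; exists (fun g => if g \subset K then chi5 g else chi1 g) => [g|].
  by case: ifP.
apply/goodP => C sC cC; apply/negP => mC; have /monoP[c hc] := mC.
have pC := crit_pairs cC.
have nbC y : nb C y \subset nb U y by apply/subsetP => z; rewrite !in_nb; exact: (subsetP sC).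
case: (boolP [disjoint cover C & K]) => [hK|].
  have nK g : g \in C -> (g \subset K) = false.
    move=> gC; apply/negP => gK.
    have /card_gt0P[z zg] : (0 < #|g|)%N by rewrite (pairsP _ pC _ gC).
    have zC : z \in cover C by apply/in_coverP; exists g.
    by have := disjointFr hK zC; rewrite (subsetP gK _ zg).
  have sCV : C \subset U :\: Y.
    by apply/subsetP => g gC; rewrite !inE (subsetP sC _ gC) nK.
  case/negP: (goodP _ _ _ g1 C sCV cC).
  rewrite -(mono_eq_in (chi := fun g => if g \subset K then chi5 g else chi1 g)) // => g gC.
  by rewrite nK.
rewrite -setI_eq0 => /set0Pn[y]; rewrite inE => /andP[yC yK].
have nbsub z : z \in K -> nb C z \subset K :\ z by move=> zK; rewrite -nbK.
have [i [j [yi yj ij]]] : exists i j, [/\ [set y; i] \in C, [set y; j] \in C & [set i; j] \in C].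
  case: (crit_triangle_or_cubic cC) => [tri|d3].
    have := crit_deg2 m1 cC yC; rewrite -card_nb // => /card_gt1P[i [j [iN jN ij]]].
    exists i, j; rewrite -!in_nb; split => //; rewrite in_nb; apply: tri => //.
      by apply/in_coverP; exists [set y; i]; rewrite -?in_nb // !inE eqxx orbT.
    by apply/in_coverP; exists [set y; j]; rewrite -?in_nb // !inE eqxx orbT.
  have := d3 _ yC; rewrite -card_nb // => y3.
  have [i iN] : exists i, i \in nb C y by apply/card_gt0P; apply: leq_trans y3.
  have iC : i \in cover C.
    by apply/in_coverP; exists [set y; i]; rewrite -?in_nb // !inE eqxx orbT.
  have iK : i \in K by have := subsetP (nbsub _ yK) _ iN; rewrite in_setD1 => /andP[].
  have := d3 _ iC; rewrite -card_nb // => i3.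
  (* Two sets of three neighbours among five vertices intersect, so a critical graph that meets [K]
     contains a triangle there. *)
  have : (0 < #|nb C y :&: nb C i|)%N.
    have le5 : (#|nb C y :|: nb C i| <= 5)%N.
      rewrite -K5 subset_leq_card // subUset.
      by rewrite !(subset_trans (nbsub _ _)) ?subsetDl.
    rewrite lt0n; apply/eqP => I0; have := leq_add y3 i3.
    by rewrite -cardsUI I0 addn0 leqNgt ltnS le5.
  move=> /card_gt0P[j]; rewrite in_setI => /andP[j1 j2].
  by exists i, j; rewrite -!in_nb.
have neq z t : [set z; t] \in C -> z != t by rewrite -in_nb => /(nb_neq pC).
have iK : i \in K by apply: (inK y) => //; exact: (subsetP sC).
have jK : j \in K by apply: (inK y) => //; exact: (subsetP sC).
have five z t : z \in K -> t \in K -> [set z; t] \in C -> chi5 [set z; t] = c.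
  by move=> zK tK /hc; rewrite subUset !sub1set zK tK.
apply: (t5 y i j) => //; try exact: neq.
by rewrite !five.
Qed.

End FourRegular.

Section SparseColouring.
Variables (R : archiRealFieldType) (T : finType) (m : R).
Implicit Types (C D E U V : {set {set T}}) (x y : T).
Local Open Scope ring_scope.
Variables (p q : {set T} -> nat).
Hypothesis m1 : 1 < m.
Hypothesis pq : forall g, p g != q g.

Lemma crit_cyclic C : crit m C -> cyclic C.
Proof.
move=> cC; apply/andP; split; last by apply/forall_inP => x; exact: (crit_deg2 m1).
by apply: contraTneq (crit_card m1 cC) => ->; rewrite cards0.
Qed.

Lemma sparse_colourable U : pairs U ->
  (forall E, E \subset U -> #|E|%:R <= m * #|cover E|%:R) ->
  colourable (crit m) p q U.
Proof.
have [n] := ubnP #|U|; elim: n => // n IHn in U * => cU pU sU.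
apply: contrapT => nU.
have minU V : V \proper U -> colourable (crit m) p q V.
  move=> pV; apply: IHn.
  - exact: leq_trans (proper_card pV) _.
  - exact: pairs_sub (proper_sub pV) pU.
  - by move=> E sE; apply: sU; apply: subset_trans sE (proper_sub pV).
have U0 := min_nonempty m1 nU.
have hs : #|U|.*2%:R <= 2 * m * #|cover U|%:R :> R.
  by have := sU _ (subxx U); rewrite -addnn natrD; lra.
have hsum d : (forall x, x \in cover U -> d <= #|star U x|)%N -> (d * #|cover U| <= #|U|.*2)%N.
  by move=> h; rewrite -handshake // mulnC -sum_nat_const leq_sum.
have c0 : (0 < #|cover U|)%N.
  have [e eU] := set0Pn _ U0.
  by apply: leq_trans (card_pairs_cover pU eU).
have c0R : 0 < #|cover U|%:R :> R by rewrite ltr0n.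
case: (leP m (3 / 2)) => m32.
  have d3 x : x \in cover U -> (3 <= #|star U x|)%N.
    exact: (deg_ge_three m1 pq pU nU minU).
  have h3 : (\sum_(x in cover U) #|star U x| <= 3 * #|cover U|)%N.
    rewrite handshake // -(ler_nat R) (le_trans hs) // natrM ler_wpM2r ?ler0n //.
    by have := m1; lra.
  have le3 x : (#|star U x| <= 3)%N.
    case: (boolP (x \in cover U)) => [xU|/star_out ->]; last by rewrite cards0.
    by rewrite (sum_min_eq d3 h3).
  have [chi lchi /goodP gchi] := cubic_forests pU le3 pq.
  apply: nU; exists chi => //; apply/goodP => C sC cC.
  by apply: gchi => //; exact: crit_cyclic.
case: (leP m 2) => m2.
  have d4 x : x \in cover U -> (4 <= #|star U x|)%N.
    by move=> xU; apply: (deg_ge_four m1 pq pU sU nU minU).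
  have h4 : (\sum_(x in cover U) #|star U x| <= 4 * #|cover U|)%N.
    rewrite handshake // -(ler_nat R) (le_trans hs) // natrM ler_wpM2r ?ler0n //.
    by have := m1; lra.
  have m2' : 2 <= m.
    have := hsum _ d4; rewrite -(ler_nat R) natrM => h.
    have := le_trans h hs; rewrite ler_pM2r //; lra.
  exact: (no_four_regular m1 m2' pq pU nU minU (sum_min_eq d4 h4) U0).
pose k := Num.truncn m.
have /andP[km mk] : k%:R <= m < k.+1%:R by apply: truncn_itv; have := m1; lra.
have k2 : (2 <= k)%N.
  by rewrite -ltnS -(ltr_nat R); exact: lt_trans m2 mk.
have dk x : x \in cover U -> (k.*2.+2 <= #|star U x|)%N.
  move=> xU; apply: (deg_ge_big m1 pq pU sU nU minU k2 km xU) => C cC xC.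
  rewrite -(ltr_nat R); apply: le_lt_trans km _.
  (* [m > 2] excludes critical graphs on three vertices, so the degree bound for four vertices
     applies. *)
  apply: (crit_deg_big m1 cC xC); rewrite ltn_neqAle (crit_cover cC) andbT.
  by apply: contraTneq m2 => /esym c3; rewrite -leNgt (crit_size3 m1 cC c3).
have := hsum _ dk; rewrite -(ler_nat R) natrM => h.
have := le_trans h hs; rewrite ler_pM2r // leNgt => /negP; apply.
by rewrite -doubleS -muln2 natrM; lra.
Qed.

End SparseColouring.

(** * Exploration *)

(** The invariant behind this is [t <= leaves + K.+1 * b] after [t] rounds with [b] degenerate
    steps. A degenerate step destroys at most [K] leaves, and its credit [K.+1] pays for these and
    for the round itself. *)
Lemma potential_bad t l l' k a : t <= l + a -> l <= l' + k -> t.+1 <= l' + (k.+1 + a).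
Proof. by lia. Qed.

Lemma potential_good t l l' a : t <= l + a -> l < l' -> t.+1 <= l' + a.
Proof. by lia. Qed.

(** A round attaches at most two graphs with at most [2 ^ k] edges each. *)
Lemma size_step n k t : n <= 1 + 2 ^ k.+1 * t + 2 ^ k + 2 ^ k -> n <= 1 + 2 ^ k.+1 * t.+1.
Proof. by rewrite mulnS {2}expnS mul2n -addnn; move: (2 ^ k) (_ * t) => a c; lia. Qed.

Section Exploration.
Variables (R : realFieldType) (T : finType) (m : R) (K : nat).
Implicit Types (C D E F G U X : {set {set T}}) (e f g : {set T}) (x : T).
Local Open Scope ring_scope.
Hypothesis m1 : 1 < m.
Local Ltac mlra := have ? := m1; lra.

Definition degen U D : bool :=
  [&& critK m K D, D :&: U != set0, ~~ (D \subset U) &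
    ~~ (exact m D && (#|cover D :&: cover U| <= 2)%N)].

Definition leaf_pair U (fg : {set T} * {set T}) : bool :=
  [exists C, [exists e, [&& leaf m K U C e, fg.1 \in C, fg.2 \in C &
    [&& fg.1 != e, fg.2 != e & fg.1 != fg.2]]]].

(* [G] contains a chain of steps from [U] which ends after [j] steps or after
   [r] degenerate ones, whichever comes first.  While there is a leaf, the chain
   attaches at one or two of its edges, chosen by [pick]; a regular step at an
   arbitrary edge is made only when there is no leaf, and then [U] has at most
   [B] edges. *)
Fixpoint reach (B j r : nat) G U : bool :=
  (U \subset G) && match j, r with
  | j'.+1, r'.+1 =>
      [exists D, degen U D && reach B j' r' G (U :|: D)] ||
      if [pick fg | leaf_pair U fg] is Some fg then
        [exists D, reg m K U fg.1 D &&
          ([exists F, degen (U :|: D) F && reach B j' r' G (U :|: D :|: F)] ||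
           [exists F, reg m K (U :|: D) fg.2 F && reach B j' r G (U :|: D :|: F)])]
      else (#|U| <= B)%N &&
        [exists f in U, [exists D, reg m K U f D && reach B j' r G (U :|: D)]]
  | _, _ => true
  end.

(** Strictness comes from minimality of [D] if at least three vertices are shared with [U], and from
    failure of [exact] if only two are. It is the source of the factor [n^(-epsilon)]. *)
Lemma degen_gain U D : pairs U -> degen U D ->
  m * #|cover D :\: cover U|%:R < #|D :\: U|%:R.
Proof.
move=> /pairsP pU /and4P[/andP[cD _] /set0Pn[e]]; rewrite inE => /andP[eD eU] nDU nex.
have pJ : D :&: U \proper D.
  rewrite properE subsetIl; apply: contra nDU => /subset_trans; apply.
  exact: subsetIr.
have W2 : (2 <= #|cover D :&: cover U|)%N.
  by rewrite -(pU _ eU) subset_leq_card // subsetI !sub_cover.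
have hD : #|D|%:R = #|D :&: U|%:R + #|D :\: U|%:R :> R by rewrite -natrD cardsID.
have hW : #|cover D|%:R = #|cover D :&: cover U|%:R + #|cover D :\: cover U|%:R :> R.
  by rewrite -natrD cardsID.
have dD := crit_dense cD; rewrite hW in dD.
case: (leqP 3 #|cover D :&: cover U|) => W3.
  by have := crit_sub_lt m1 cD pJ (coverI_sub _ _) W3; mlra.
have W : #|cover D :&: cover U| = 2%N by apply/eqP; rewrite eqn_leq W2 -ltnS W3.
have := crit_sub_le m1 cD pJ (coverI_sub _ _) W2; rewrite W.
move: nex; rewrite -ltnS W3 andbT /exact hW W => nex.
have : m * (2 + #|cover D :\: cover U|%:R - 2) < #|D|%:R - 1.
  by rewrite lt_neqAle eq_sym nex; rewrite W in dD.
mlra.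
Qed.

Lemma reg_setI U f D : pairs U -> reg m K U f D -> D :&: U = [set f].
Proof.
move=> /pairsP pU /and5P[/andP[cD _] _ fD fU s].
apply/eqP; rewrite eqEsubset sub1set in_setI fD fU !andbT; apply/subsetP => e.
rewrite !inE => /andP[eD eU]; apply/eqP/pair_eq; rewrite ?pU //.
by apply: subset_trans s; rewrite subsetI !sub_cover.
Qed.

Lemma reg_gain U f D : pairs U -> reg m K U f D ->
  #|D :\: U|%:R = m * #|cover D :\: f|%:R.
Proof.
move=> pU rD; have := reg_setI pU rD.
case/and5P: rD => /andP[cD _] /eqP xD fD fU s dI.
have hD : #|D|%:R = 1 + #|D :\: U|%:R :> R by rewrite -(cardsID U D) dI cards1 natrD.
have : #|cover D|%:R = 2 + #|cover D :\: f|%:R :> R.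
  by rewrite -(cardsID f (cover D)) (setIidPr (sub_cover fD)) (pairsP _ pU _ fU) natrD.
by move=> hC; move: xD; rewrite hC hD; mlra.
Qed.

Lemma critK_size D : critK m K D -> (#|D| <= 2 ^ K)%N.
Proof.
case/andP => _ cK; apply: leq_trans (_ : 2 ^ #|cover D| <= _)%N.
  rewrite -card_powerset; apply: subset_leq_card; apply/subsetP => e eD.
  by rewrite powersetE sub_cover.
by rewrite leq_exp2l.
Qed.

Lemma step_exists U D f : pairs U -> critK m K D -> f \in D -> f \in U ->
  ~~ (D \subset U) -> degen U D \/ reg m K U f D.
Proof.
move=> /pairsP pU kD fD fU nDU.
case: (boolP (degen U D)) => [|nd]; [by left|right].
have : exact m D && (#|cover D :&: cover U| <= 2)%N.
  apply: contraR nd => h; rewrite /degen kD nDU h !andbT /=.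
  by apply/set0Pn; exists f; rewrite inE fD.
move=> /andP[xD c2]; rewrite /reg kD xD fD fU /=.
have sf : f \subset cover D :&: cover U by rewrite subsetI !sub_cover.
have /eqP <- // : f == cover D :&: cover U by rewrite eqEcard sf (pU _ fU).
Qed.

Lemma leaf_pair_exists U : pairs U -> (0 < #|leaves m K U|)%N -> exists fg, leaf_pair U fg.
Proof.
move=> pU /card_gt0P[C /leavesP[e lC]].
have c3 : (3 <= #|C|)%N by case/and5P: lC => _ /andP[cC _] _ _ _; exact: (crit_card m1 cC).
have eC : e \in C by case/and5P: lC.
have : (1 < #|C :\ e|)%N by move: c3; rewrite (cardsD1 e) eC.
move=> /card_gt1P[f [g [fC gC fg]]].
move: fC gC; rewrite !in_setD1 => /andP[fe fC] /andP[ge gC].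
exists (f, g); apply/existsP; exists C; apply/existsP; exists e.
by rewrite lC /= fC gC fe ge fg.
Qed.

Variables (B N : nat).

(** Induction on the remaining rounds, [t] being the rounds made and [b] the degenerate steps among
    them. While there is a leaf, [two] supplies graphs to attach at its edges; without leaves the
    invariant keeps [U] small and [open] supplies one. *)
Lemma reach_explored G X : pairs X -> X \subset G ->
  (forall e C, e \in X -> e \in C ->
     exists D, [/\ D \subset X, critK m K D, e \in D & D != C]) ->
  (forall U, U \subset X -> U != set0 -> (#|U| <= B)%N ->
     exists D, [/\ D \subset X, critK m K D, D :&: U != set0 & ~~ (D \subset U)]) ->
  (1 + 2 ^ K.+1 * (K.+1 * N) <= B)%N ->
  forall j r U t b, U \subset X -> U != set0 -> (b + r = N)%N ->
    (#|U| <= 1 + 2 ^ K.+1 * t)%N -> (t <= #|leaves m K U| + K.+1 * b)%N ->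
    reach B j r G U.
Proof.
move=> pX sXG two open hB; elim=> [|j IH] r U t b sU U0 br cU tU /=.
  by rewrite (subset_trans sU sXG).
rewrite (subset_trans sU sXG) /=; case: r br => [//|r] br.
have pU := pairs_sub sU pX.
have grow (V D : {set {set T}}) : V \subset X -> D \subset X -> V != set0 -> V :|: D \subset X /\ V :|: D != set0.
  move=> sV sD V0; split; first by rewrite subUset sV.
  by apply: contra V0; rewrite setU_eq0 => /andP[].
have size1 (V D : {set {set T}}) n0 : critK m K D -> (#|V| <= n0)%N -> (#|V :|: D| <= n0 + 2 ^ K)%N.
  move=> kD cV; apply: leq_trans (leq_card_setU _ _) _.
  by rewrite leq_add // critK_size.
have size_next (V : {set {set T}}) : (#|V| <= 1 + 2 ^ K.+1 * t + 2 ^ K + 2 ^ K)%N ->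
    (#|V| <= 1 + 2 ^ K.+1 * t.+1)%N.
  exact: size_step.
have bad D : degen U D -> D \subset X -> reach B j r G (U :|: D).
  move=> dD sD; have kD : critK m K D by case/and4P: dD.
  have [sUD UD0] := grow _ _ sU sD U0.
  apply: (IH r _ t.+1 b.+1) => //.
  - by rewrite addSnnS.
  - by apply: size_next; apply: leq_trans (size1 _ _ _ kD cU) _; rewrite leq_addr.
  by rewrite mulnS; exact: potential_bad tU (leaves_bad m1 pU kD).
case: pickP => [[f g] /existsP[C /existsP[e /and5P[lC /= fC gC fe]]]|nolf]; last first.
  have l0 : #|leaves m K U| = 0%N.
    apply/eqP; rewrite -leqn0 leqNgt; apply/negP => /(leaf_pair_exists pU)[fg].
    by rewrite nolf.
  (* Without leaves the invariant reads [t <= K.+1 * b], and [b] is at most [N]. *)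
  have UB : (#|U| <= B)%N.
    apply: leq_trans cU _; apply: leq_trans hB; rewrite leq_add2l leq_mul2l.
    move: tU; rewrite l0 add0n => tU; rewrite (leq_trans tU) ?orbT // leq_mul2l.
    by rewrite -br leq_addr.
  have [D [sD kD /set0Pn[f]]] := open U sU U0 UB.
  rewrite inE => /andP[fD fU] nDU.
  case: (step_exists pU kD fD fU nDU) => [dD|rD].
    by apply/orP; left; apply/existsP; exists D; rewrite dD bad.
  have [sUD UD0] := grow _ _ sU sD U0.
  apply/orP; right; rewrite UB /=; apply/existsP; exists f; rewrite fU /=.
  apply/existsP; exists D; rewrite rD /=.
  apply: (IH r.+1 _ t.+1 b) => //.
  - by apply: size_next; apply: leq_trans (size1 _ _ _ kD cU) _; rewrite leq_addr.
  by apply: potential_good tU _; rewrite l0; exact: leaves_reg rD.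
move=> /andP[ge fg].
have [sC kC xC eC _] := and5P lC.
have fU := subsetP sC _ fC; have gU := subsetP sC _ gC.
(* Inside [U], an edge of the leaf other than its attaching edge lies in no critical graph but the
   leaf itself. *)
have notin h D : h \in C -> h != e -> h \in D -> D != C -> critK m K D -> ~~ (D \subset U).
  move=> hC he hD DC kD; apply/negP => sD.
  have := subsetP (leaf_other m1 pU lC sD (critK_crit kD) DC) _ hD.
  by rewrite !inE (negPf he) hC.
have [D [sD kD fD DC]] := two f C (subsetP sU _ fU) fC.
have nDU := notin f D fC fe fD DC kD.
case: (step_exists pU kD fD fU nDU) => [dD|rD].
  by apply/orP; left; apply/existsP; exists D; rewrite dD bad.
apply/orP; right; apply/existsP; exists D; rewrite rD /=.
have [sUD UD0] := grow _ _ sU sD U0.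
have pUD := pairs_sub sUD pX.
have [F [sF kF gF FC]] := two g C (subsetP sU _ gU) gC.
(* By [glue], a critical graph inside [U :|: D] lies in [U] or equals [D]. The first is excluded by
   [notin], the second because [D] meets [U] in no edge but [f]. *)
have nFU : ~~ (F \subset U :|: D).
  apply/negP => sFUD.
  have [_ xD _ _ sDf] := and5P rD.
  have [|FD] := glue m1 (critK_crit kD) xD fD pU sDf (critK_crit kF) sFUD.
    rewrite (setUidPr _) ?sub1set // => sFU.
    by case/negP: (notin g F gC ge gF FC kF).
  have gDU : g \in D :&: U by rewrite inE -FD gF gU.
  by move: gDU; rewrite (reg_setI pU rD) inE eq_sym (negPf fg).
have gUD : g \in U :|: D by rewrite inE gU.
have [sUDF UDF0] := grow _ _ sUD sF UD0.
have cUDF : (#|U :|: D :|: F| <= 1 + 2 ^ K.+1 * t.+1)%N.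
  exact: size_next (size1 _ _ _ kF (size1 _ _ _ kD cU)).
case: (step_exists pUD kF gF gUD nFU) => [dF|rF]; apply/orP; [left|right];
  apply/existsP; exists F.
  rewrite dF /=; apply: (IH r _ t.+1 b.+1) => //; first by rewrite addSnnS.
  rewrite mulnS; apply: potential_bad tU _.
  exact: leq_trans (leaves_half m1 pU lC fC rD) (leaves_bad m1 pUD kF).
rewrite rF /=; apply: (IH r.+1 _ t.+1 b) => //.
exact: potential_good tU (leaves_good m1 pU lC fC gC rD rF).
Qed.

End Exploration.

(** * Counting *)

Lemma leq_expn_base a b e : a <= b -> a ^ e <= b ^ e.
Proof. by case: e => // e ab; rewrite leq_exp2r. Qed.

Lemma bin_le_exp n w : 'C(n, w) <= n ^ w.
Proof.
elim: n w => [|n IH] [|w] //; rewrite ?bin0 ?expn0 //.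
rewrite binS; apply: leq_trans (leq_add (IH _) (IH _)) _.
rewrite expnS [X in _ <= X]expnS -[X in _ + X]mul1n -mulnDl addn1.
by rewrite leq_mul2l leq_expn_base ?leqnSn ?orbT.
Qed.

Section Counting.
Variable T : finType.
Implicit Types (D : {set {set T}}) (Z W A : {set T}).

Lemma card_small_subsets Z k :
  #|[set A : {set T} | (A \subset Z) && (#|A| <= k)]| <= k.+1 * #|Z|.+1 ^ k.
Proof.
have sub : [set A : {set T} | (A \subset Z) && (#|A| <= k)] \subset
    \bigcup_(i : 'I_k.+1) [set A : {set T} | (A \subset Z) && (#|A| == i)].
  apply/subsetP => A; rewrite inE => /andP[sA cA]; apply/bigcupP.
  by exists (Ordinal (cA : #|A| < k.+1)); rewrite // inE sA /=.
apply: leq_trans (subset_leq_card sub) _.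
have le_sum : #|\bigcup_(i : 'I_k.+1) [set A : {set T} | (A \subset Z) && (#|A| == i)]|
    <= \sum_(i : 'I_k.+1) #|[set A : {set T} | (A \subset Z) && (#|A| == i)]|.
  elim/big_rec2: _ => [|i u U _ h]; first by rewrite cards0.
  by apply: leq_trans (leq_card_setU _ _) _; rewrite leq_add2l.
apply: leq_trans le_sum _.
apply: leq_trans (_ : \sum_(i : 'I_k.+1) #|Z|.+1 ^ k <= _); last first.
  by rewrite sum_nat_const card_ord.
apply: leq_sum => i _; rewrite cards_draws; apply: leq_trans (bin_le_exp _ _) _.
apply: leq_trans (_ : #|Z|.+1 ^ i <= _).
  exact: leq_expn_base.
by rewrite leq_pexp2l // -ltnS.
Qed.

(** Choose the vertices outside [Z], then those inside, then a set of subsets of the chosen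
    vertices. Only the first choice depends on the order of the ambient graph. *)
Lemma card_graphs_near Z w k :
  #|[set D : {set {set T}} | (#|cover D| <= k) && (#|cover D :\: Z| == w)]|
    <= #|T| ^ w * (k.+1 * #|Z|.+1 ^ k * 2 ^ 2 ^ k).
Proof.
pose WW := [set W : {set T} | (#|W| <= k) && (#|W :\: Z| == w)].
have sub : [set D : {set {set T}} | (#|cover D| <= k) && (#|cover D :\: Z| == w)]
    \subset \bigcup_(W in WW) powerset (powerset W).
  apply/subsetP => D; rewrite inE => hD; apply/bigcupP; exists (cover D); first by rewrite inE.
  rewrite powersetE; apply/subsetP => e eD; rewrite powersetE.
  exact: sub_cover.
apply: leq_trans (subset_leq_card sub) _.
apply: leq_trans (_ : \sum_(W in WW) 2 ^ 2 ^ k <= _).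
  have : #|\bigcup_(W in WW) powerset (powerset W)| <= \sum_(W in WW) #|powerset (powerset W)|.
    elim/big_rec2: _ => [|i u U _ h]; first by rewrite cards0.
    by apply: leq_trans (leq_card_setU _ _) _; rewrite leq_add2l.
  move/leq_trans; apply; apply: leq_sum => W; rewrite inE => /andP[cW _].
  by rewrite !card_powerset !leq_exp2l.
rewrite sum_nat_const mulnA leq_mul2r; apply/orP; right.
pose A1 := [set A : {set T} | #|A| == w].
pose A2 := [set A : {set T} | (A \subset Z) && (#|A| <= k)].
have inj : {in WW &, injective (fun W : {set T} => (W :\: Z, W :&: Z))}.
  by move=> W W' _ _ [h1 h2]; rewrite -(setID W Z) -(setID W' Z) h1 h2.
rewrite -(card_in_imset inj).
apply: leq_trans (subset_leq_card (_ : _ \subset setX A1 A2)) _.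
  apply/subsetP => _ /imsetP[W + ->]; rewrite inE => /andP[cW wW].
  rewrite !inE wW subsetIr /=; apply: leq_trans cW.
  by rewrite subset_leq_card ?subsetIl.
rewrite cardsX leq_mul ?card_small_subsets //.
by rewrite card_draws bin_le_exp.
Qed.

End Counting.

Section SumBound.
Variables (R : realFieldType) (T : finType).
Implicit Types (D : {set {set T}}) (Z : {set T}).
Local Open Scope ring_scope.

(** The bound of [card_graphs_near] without the power of [#|T|]; the outer [k.+1] accounts for the
    possible numbers of vertices outside [Z]. *)
Definition near_const (k z : nat) : nat := (k.+1 * (k.+1 * z.+1 ^ k * 2 ^ 2 ^ k))%N.

Lemma sum_near Z k (P : pred {set {set T}}) (F : {set {set T}} -> R) (kappa : R) z :
  (0 < #|T|)%N -> 0 <= kappa -> (#|Z| <= z)%N ->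
  (forall D, P D -> (#|cover D| <= k)%N) ->
  (forall D, P D -> F D <= kappa / #|T|%:R ^+ #|cover D :\: Z|) ->
  \sum_(D | P D) F D <= kappa * (near_const k z)%:R.
Proof.
move=> T0 k0 Zz hP hF.
have T0R : 0 < #|T|%:R :> R by rewrite ltr0n.
pose G w D := if #|cover D :\: Z| == w then kappa / #|T|%:R ^+ w else 0.
apply: le_trans (_ : \sum_(D | P D) \sum_(w < k.+1) G w D <= _).
  apply: ler_sum => D PD.
  have lt : (#|cover D :\: Z| < k.+1)%N.
    by rewrite ltnS; apply: leq_trans (hP _ PD); rewrite subset_leq_card ?subsetDl.
  rewrite (bigD1 (Ordinal lt)) //= {1}/G eqxx big1 ?addr0; last first.
    move=> w nw; rewrite /G; case: eqP => // h; case/eqP: nw; exact: val_inj.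
  exact: hF.
rewrite exchange_big /=.
apply: le_trans (_ : \sum_(w < k.+1) kappa * (k.+1 * z.+1 ^ k * 2 ^ 2 ^ k)%:R <= _); last first.
  by rewrite sumr_const card_ord -mulrnAr -mulr_natl -natrM.
apply: ler_sum => w _.
rewrite -big_mkcondr /= sumr_const -[_ *+ #|_|]mulr_natr.
rewrite -mulrA ler_wpM2l // mulrC ler_pdivrMr ?exprn_gt0 // -natrX -natrM ler_nat mulnC.
apply: leq_trans (_ : #|[set D : {set {set T}} | (#|cover D| <= k) && (#|cover D :\: Z| == w)]| <= _)%N.
  apply: subset_leq_card; apply/subsetP => D; rewrite !inE => /andP[PD ->].
  by rewrite hP.
apply: leq_trans (card_graphs_near _ _ _) _.
rewrite leq_mul2l; apply/orP; right.
by rewrite leq_mul2r leq_mul2l leq_expn_base ?orbT.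
Qed.
End SumBound.

(** * The probability of a long exploration *)

Section RandomGraph.
Variables (R : realFieldType) (T : finType) (p : R).
Implicit Types (D E S U : {set {set T}}) (A B : pred {set {set T}}).
Local Open Scope ring_scope.
Hypothesis p01 : 0 <= p <= 1.

Definition weight E : R := p ^+ #|E| * (1 - p) ^+ ('C(#|T|, 2) - #|E|).

Definition Pr A : R := \sum_(E : {set {set T}} | pairs E && A E) weight E.

Lemma weight_ge0 E : 0 <= weight E.
Proof.
have /andP[p0 p1] := p01.
by rewrite mulr_ge0 ?exprn_ge0 // subr_ge0.
Qed.

Lemma Pr_cover (I : finType) (P : pred I) A (B : I -> pred {set {set T}}) :
  (forall E, A E -> exists2 i, P i & B i E) -> Pr A <= \sum_(i | P i) Pr (B i).
Proof.
move=> h; rewrite /Pr (exchange_big_dep predT) //= [leLHS]big_mkcond /=.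
apply: ler_sum => E _; case: ifPn => [/andP[pE /h[i Pi Bi]]|_]; last first.
  by apply: sumr_ge0 => *; exact: weight_ge0.
rewrite (bigD1 i) /=; last by rewrite Pi pE.
by rewrite lerDl; apply: sumr_ge0 => *; exact: weight_ge0.
Qed.

Lemma Pr_or A B C : (forall E, A E -> B E || C E) -> Pr A <= Pr B + Pr C.
Proof.
move=> h; apply: le_trans (@Pr_cover bool predT A (fun b => if b then B else C) _) _.
  by move=> E /h /orP[]; [exists true|exists false].
by rewrite big_bool.
Qed.

Lemma Pr_mono A B : (forall E, A E -> B E) -> Pr A <= Pr B.
Proof.
move=> h; apply: le_trans (@Pr_cover unit predT A (fun=> B) _) _.
  by move=> E /h; exists tt.
by rewrite (bigD1 tt) //= big1 ?addr0 // => -[].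
Qed.

Lemma Pr_superset S : pairs S -> Pr (fun E => S \subset E) = p ^+ #|S|.
Proof.
move=> /pairsP pS.
pose Kn := [set e : {set T} | #|e| == 2%N].
(* Expand a product over all sets [e] whose factors are [p + 0] at an edge of [S], [p + (1 - p)] at
   any other pair and [0 + 1] elsewhere. The nonzero terms are the weights of the graphs containing
   [S]. *)
pose F (e : {set T}) : R := if e \in Kn then p else 0.
pose G (e : {set T}) : R := if e \in S then 0 else if e \in Kn then 1 - p else 1.
have SK e : e \in S -> e \in Kn by rewrite inE => /pS ->.
have -> : p ^+ #|S| = \prod_e (F e + G e).
  rewrite -prodr_const big_mkcond; apply: eq_bigr => e _; rewrite /F /G.
  case: ifPn => [/SK ->|_]; first by rewrite addr0.
  by case: ifP => _; rewrite ?add0r // addrC subrK.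
rewrite (bigA_distr (R := R)) /Pr big_mkcond; apply: eq_bigr => E _.
case: ifPn => [/andP[pE sE]|]; last first.
  rewrite negb_and => /orP[|/subsetPn[e eS eE]]; last first.
    by rewrite (bigD1 e) //= (negPf eE) /G eS mul0r.
  rewrite negb_forall => /existsP[e]; rewrite negb_imply => /andP[eE ne].
  by rewrite (bigD1 e) //= eE /F inE (negPf ne) mul0r.
rewrite (bigID (mem E)) /=; congr (_ * _).
  rewrite -prodr_const; apply: eq_bigr => e eE.
  by rewrite eE /F inE (pairsP _ pE _ eE).
have -> : ('C(#|T|, 2) - #|E| = #|Kn :\: E|)%N.
  have sEK : E \subset Kn by apply/subsetP => e eE; rewrite inE (pairsP _ pE _ eE).
  by rewrite cardsD (setIidPr sEK) card_draws.
rewrite -prodr_const big_mkcond [RHS]big_mkcond; apply: eq_bigr => e _ /=.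
rewrite in_setD; case: (boolP (e \in E)) => //= eE.
have eS : e \notin S by apply: contra eE; exact: (subsetP sE).
by rewrite /G (negPf eS).
Qed.

Variables (m : R) (K B0 M : nat) (eta1 rho : R).
Hypothesis degen_sum : forall U, pairs U -> (#|U| <= M)%N ->
  \sum_(D | degen m K U D) p ^+ #|D :\: U| <= eta1.
Hypothesis reg_sum : forall U f, pairs U -> f \in U ->
  \sum_(D | reg m K U f D) p ^+ #|D :\: U| <= rho.
Hypothesis eta0 : 0 <= eta1.
Hypothesis rho01 : 0 <= rho <= 1.
Hypothesis B1 : (1 <= B0)%N.
Hypothesis Brho : B0%:R * rho <= 1 / 2.

(* [p ^+ #|U| * Phi j r] dominates the union bound for [reach]; the summand
   [x ^+ j] accounts for running out of steps and [y ^+ r] for the degenerate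
   steps. *)
Let x := B0%:R * rho + 2 * eta1.
Let y := 4 * eta1.
Let Phi (j r : nat) : R := x ^+ j + y ^+ r.

Lemma x_ge0 : 0 <= x.
Proof.
have /andP[r0 _] := rho01; have e0 := eta0.
have : 0 <= B0%:R * rho by rewrite mulr_ge0.
by rewrite /x; lra.
Qed.

Lemma y_ge0 : 0 <= y. Proof. by have e0 := eta0; rewrite /y; lra. Qed.

Lemma Phi_ge0 j r : 0 <= Phi j r.
Proof. by rewrite addr_ge0 ?exprn_ge0 ?x_ge0 ?y_ge0. Qed.

(** The coefficient of [x ^+ j] on the left is [x] itself. That of [y ^+ r] is at most
    [2 eta1 + y / 2], which equals [y] and explains the factor 4 in [y]. *)
Lemma Phi_step j r :
  2 * eta1 * Phi j r + B0%:R * rho * Phi j r.+1 <= Phi j.+1 r.+1.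
Proof.
have h : 0 <= y ^+ r * (2 * eta1) * (1 - 2 * (B0%:R * rho)).
  by rewrite !mulr_ge0 ?exprn_ge0 ?y_ge0 //; have := eta0; have := Brho; lra.
move: h; rewrite /Phi !exprS; set X := x ^+ j; set Y := y ^+ r.
by rewrite /x /y; lra.
Qed.

Lemma cards_setU_diff (X : finType) (A B : {set X}) : #|A :|: B| = (#|A| + #|B :\: A|)%N.
Proof. by rewrite -(cardsID A (A :|: B)) (setIidPr (subsetUl A B)) setDUl setDv set0U. Qed.

Lemma sum_extend U (P : pred {set {set T}}) (Q : {set {set T}} -> R) (s c : R) :
  \sum_(D | P D) p ^+ #|D :\: U| <= s -> 0 <= c ->
  (forall D, P D -> Q D <= p ^+ #|U :|: D| * c) ->
  \sum_(D | P D) Q D <= p ^+ #|U| * (s * c).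
Proof.
have /andP[p0 _] := p01.
move=> hs c0 hQ; apply: le_trans (_ : \sum_(D | P D) p ^+ #|U| * (p ^+ #|D :\: U| * c) <= _).
  apply: ler_sum => D /hQ /le_trans; apply.
  by rewrite cards_setU_diff exprD mulrA.
rewrite -mulr_sumr -mulr_suml ler_wpM2l ?exprn_ge0 // ler_wpM2r //.
Qed.

(** [M] leaves room for two attachments in each remaining round. A round costs at most [2 eta1] for
    a degenerate first or second step, and at most [B0 rho] for regular ones: [rho ^ 2] at a leaf,
    and [rho] for each of at most [B0] edges otherwise. *)
Lemma Pr_reach j r U : pairs U -> (#|U| + 2 ^ K.+1 * j <= M)%N ->
  Pr (fun G => reach m K B0 j r G U) <= p ^+ #|U| * Phi j r.
Proof.
have /andP[p0 _] := p01; have /andP[r0 r1] := rho01; have e0 := eta0.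
elim: j r U => [|j IH] [|r] U pU sU.
- apply: le_trans (Pr_mono (B := fun E => U \subset E) _) _; first by move=> E /andP[].
  by rewrite Pr_superset // ler_peMr ?exprn_ge0 // /Phi !expr0; lra.
- apply: le_trans (Pr_mono (B := fun E => U \subset E) _) _; first by move=> E /andP[].
  rewrite Pr_superset // ler_peMr ?exprn_ge0 // /Phi expr0.
  by rewrite lerDl exprn_ge0 ?y_ge0.
- apply: le_trans (Pr_mono (B := fun E => U \subset E) _) _; first by move=> E /andP[].
  rewrite Pr_superset // ler_peMr ?exprn_ge0 // /Phi expr0.
  by rewrite lerDr exprn_ge0 ?x_ge0.
have sU' : (#|U| <= M)%N by apply: leq_trans sU; rewrite leq_addr.
have small V D : critK m K D -> (#|V :|: D| <= #|V| + 2 ^ K)%N.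
  move=> kD; apply: leq_trans (leq_card_setU _ _) _.
  by rewrite leq_add2l; exact: critK_size kD.
have room (V : {set {set T}}) : (#|V| <= #|U| + 2 ^ K + 2 ^ K)%N -> (#|V| + 2 ^ K.+1 * j <= M)%N.
  move=> h; apply: leq_trans sU; rewrite mulnS addnA leq_add2r.
  by apply: leq_trans h _; rewrite expnS mul2n -addnn addnA.
have pUD V D : pairs V -> critK m K D -> pairs (V :|: D).
  by move=> pV /andP[/crit_pairs pD _]; exact: pairsU.
have degenK V D : degen m K V D -> critK m K D by case/and4P.
have regK V f D : reg m K V f D -> critK m K D by case/and5P.
have bad V : pairs V -> (#|V| <= #|U| + 2 ^ K)%N ->
    \sum_(D | degen m K V D) Pr (fun G => reach m K B0 j r G (V :|: D))
      <= p ^+ #|V| * (eta1 * Phi j r).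
  move=> pV cV; apply: sum_extend; [|exact: Phi_ge0|].
    have cV2 : (#|V| <= #|U| + 2 ^ K + 2 ^ K)%N by apply: leq_trans cV _; rewrite leq_addr.
    apply: degen_sum => //; have := room V cV2; apply: leq_trans; exact: leq_addr.
  move=> D /degenK kD; apply: IH; first exact: pUD.
  by apply: room; apply: leq_trans (small _ _ kD) _; rewrite leq_add2r.
have good V f : pairs V -> (#|V| <= #|U| + 2 ^ K)%N -> f \in V ->
    \sum_(D | reg m K V f D) Pr (fun G => reach m K B0 j r.+1 G (V :|: D))
      <= p ^+ #|V| * (rho * Phi j r.+1).
  move=> pV cV fV; apply: sum_extend; [exact: reg_sum|exact: Phi_ge0|].
  move=> D /regK kD; apply: IH; first exact: pUD.
  by apply: room; apply: leq_trans (small _ _ kD) _; rewrite leq_add2r.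
have P1 := Phi_ge0 j r; have P2 := Phi_ge0 j r.+1.
have pU0 : 0 <= p ^+ #|U| by rewrite exprn_ge0.
apply: le_trans (_ : p ^+ #|U| * (2 * eta1 * Phi j r + B0%:R * rho * Phi j r.+1) <= _); last first.
  by rewrite ler_wpM2l // Phi_step.
have -> : 2 * eta1 * Phi j r + B0%:R * rho * Phi j r.+1
    = eta1 * Phi j r + (eta1 * Phi j r + B0%:R * rho * Phi j r.+1) by ring.
rewrite mulrDr /=.
have B1R : 1 <= B0%:R :> R by rewrite (ler_nat R 1).
case: pickP => [[f g] lp|_].
  have [fU gU] : f \in U /\ g \in U.
    case/existsP: lp => C /existsP[e /and4P[lC /= fC gC _]].
    by case/and5P: lC => /subsetP sC _ _ _ _; rewrite !sC.
  apply: le_trans (Pr_or (B := fun G => [exists D, degen m K U D && reach m K B0 j r G (U :|: D)])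
    (C := fun G => [exists D, reg m K U f D &&
          ([exists F, degen m K (U :|: D) F && reach m K B0 j r G (U :|: D :|: F)] ||
           [exists F, reg m K (U :|: D) g F && reach m K B0 j r.+1 G (U :|: D :|: F)])]) _) _.
    by move=> E /andP[_].
  apply: lerD.
    apply: le_trans (bad U pU (leq_addr _ _)); apply: Pr_cover => E /existsP[D /andP[]].
    by exists D.
  apply: le_trans (Pr_cover (P := reg m K U f) (B := fun D G =>
       [exists F, degen m K (U :|: D) F && reach m K B0 j r G (U :|: D :|: F)] ||
       [exists F, reg m K (U :|: D) g F && reach m K B0 j r.+1 G (U :|: D :|: F)]) _) _.
    by move=> E /existsP[D /andP[]]; exists D.
  apply: le_trans (@sum_extend U _ _ rho (eta1 * Phi j r + rho * Phi j r.+1) (reg_sum pU fU) _ _) _.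
  - by rewrite addr_ge0 ?mulr_ge0.
  - move=> D rD; have kD := regK _ _ _ rD; have pV := pUD _ _ pU kD.
    have cV := small U _ kD.
    apply: le_trans (Pr_or (B := fun G => [exists F, degen m K (U :|: D) F && reach m K B0 j r G (U :|: D :|: F)])
       (C := fun G => [exists F, reg m K (U :|: D) g F && reach m K B0 j r.+1 G (U :|: D :|: F)]) _) _ => //.
    rewrite mulrDr; apply: lerD.
      apply: le_trans (bad _ pV cV); apply: Pr_cover => E /existsP[F /andP[]].
      by exists F.
    apply: le_trans (good _ g pV cV _); last by rewrite inE gU.
    apply: Pr_cover => E /existsP[F /andP[]].
    by exists F.
  rewrite ler_wpM2l // mulrDr; apply: lerD.
    by rewrite ler_piMl ?mulr_ge0.
  rewrite mulrA ler_wpM2r // ler_wpM2r //.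
  by apply: le_trans r1 B1R.
apply: le_trans (Pr_or (B := fun G => [exists D, degen m K U D && reach m K B0 j r G (U :|: D)])
    (C := fun G => (#|U| <= B0)%N && [exists f in U, [exists D, reg m K U f D &&
       reach m K B0 j r.+1 G (U :|: D)]]) _) _.
  by move=> E /andP[_].
apply: lerD.
  apply: le_trans (bad U pU (leq_addr _ _)); apply: Pr_cover => E /existsP[D /andP[]].
  by exists D.
apply: le_trans (_ : p ^+ #|U| * (B0%:R * rho * Phi j r.+1) <= _); last first.
  by rewrite ler_wpM2l // lerDr mulr_ge0.
case: (leqP #|U| B0) => UB; last first.
  rewrite [leLHS]big1 ?mulr_ge0 //.
  by move=> E /andP[].
apply: le_trans (Pr_cover (P := mem U) (B := fun f G => [exists D, reg m K U f D &&
       reach m K B0 j r.+1 G (U :|: D)]) _) _.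
  by move=> E /= /exists_inP[f fU h]; exists f.
apply: le_trans (_ : \sum_(f in U) p ^+ #|U| * (rho * Phi j r.+1) <= _).
  apply: ler_sum => f fU; apply: le_trans (good U f pU (leq_addr _ _) fU).
  by apply: Pr_cover => E /existsP[D /andP[]]; exists D.
rewrite sumr_const -mulrnAr ler_wpM2l // -mulrA -[leLHS]mulr_natl ler_wpM2r ?mulr_ge0 //.
by rewrite ler_nat.
Qed.

End RandomGraph.

(** * Random graphs and the threshold *)

Require Import Defs.
From mathcomp Require Import finmap.
From mathcomp Require Import all_classical all_reals all_analysis.

Import numFieldNormedType.Exports.
(* [all_classical] shadows [cover], [set0], [subsetP] and others of finset and
   fintype. *)
Import mathcomp.boot.fintype mathcomp.boot.finset.
Local Open Scope ring_scope.

Lemma m2_family_le (R : realType) (Fs : seq graph) F :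
  F \in Fs -> m2_family R Fs <= m2 R F.
Proof.
rewrite /m2_family => /(map_f (m2 R)); set x0 := head _ _.
elim: [seq _ | _ <- _] x0 => // y s IH x0.
rewrite in_cons big_cons ge_min => /orP[/eqP ->|/IH ->]; by rewrite ?lexx ?orbT.
Qed.

Lemma m2_attained (R : realType) (F : graph) (m : R) : 1 < m -> m <= m2 R F ->
  exists H, [/\ subgraph (tagged F) H, (3 <= #|H.1|)%N &
    m * (#|H.1|%:R - 2) <= #|H.2|%:R - 1].
Proof.
move=> m1 mF; apply: contrapT => h; move: mF; rewrite leNgt => /negP; apply.
(* The default value 1/2 of the maximum lies below [m]. *)
apply: bigmax_lt => [|H /andP[sH cH]]; first by lra.
have c3 : 3 <= #|H.1|%:R :> R by rewrite (ler_nat R 3).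
rewrite ltr_pdivrMr ?ltNge; last by lra.
by apply/negP => hH; apply: h; exists H.
Qed.

(** The image of a dense subgraph of [F] may lose isolated vertices, which only makes it denser, so
    it contains a critical graph. *)
Lemma mono_copy_crit (R : realType) (T : finType) (G : sgraph T) chi (F : graph) (m : R) :
  1 < m -> m <= m2 R F -> mono_copy G chi (tagged F) ->
  exists C : {set {set T}}, [/\ C \subset edges G, critK m (tag F) C & mono chi C].
Proof.
move=> m1 /(m2_attained m1)[H [/andP[sH1 /forall_inP sH2] cH dH]] [f [c [finj hf]]].
pose S := ([set f @: (e : {set 'I_(tag F)}) | e in H.2])%SET.
have pG : pairs (edges G) by case: (G).
have hS e : e \in S -> e \in edges G /\ chi e = c.
  by case/imsetP => g gH ->; apply: hf; apply: (subsetP sH1).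
have sS : S \subset edges G by apply/subsetP => e /hS[].
have cS : #|S| = #|H.2| by rewrite card_imset //; exact: imset_inj.
have covS : (#|cover S| <= #|H.1|)%N.
  apply: leq_trans (leq_imset_card f _); apply: subset_leq_card.
  apply/subsetP => x /in_coverP[_ /imsetP[g gH ->]] /imsetP[y yg ->].
  by apply: imset_f; apply: (subsetP (sH2 _ gH)).
have covSR : #|cover S|%:R <= #|H.1|%:R :> R by rewrite ler_nat.
have c3 : 3 <= #|H.1|%:R :> R by rewrite (ler_nat R 3).
have S1 : 1 < #|S|%:R - 1 :> R by rewrite cS; nra.
have cov3 : (3 <= #|cover S|)%N.
  rewrite leqNgt; apply/negP => h.
  have := card_pairs_small (pairs_sub sS pG) (subxx _) h.
  by rewrite -(ler_nat R); lra.
have dS : m * (#|cover S|%:R - 2) <= #|S|%:R - 1.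
  by rewrite cS; apply: le_trans dH; rewrite ler_wpM2l //; lra.
have [C sC cC] := crit_exists (pairs_sub sS pG) cov3 dS.
exists C; split; first exact: subset_trans sC sS.
  rewrite /critK cC /=; apply: leq_trans (subset_leq_card (coverS sC)) _.
  by apply: leq_trans covS _; apply: leq_trans (max_card _) _; rewrite card_ord.
by apply/monoP; exists c => e eC; have [] := hS _ (subsetP sC _ eC).
Qed.

Lemma fset2_pair (A : {fset nat}) : #|` A| = 2%N ->
  exists a b, [/\ a != b, a \in A & b \in A].
Proof.
move=> c2; exists (nth 0%N A 0), (nth 0%N A 1).
by rewrite nth_uniq ?fset_uniq ?c2 // !mem_nth ?c2.
Qed.

Lemma list_Ramsey_not_colourable (R : realType) (T : finType) (Fs : seq graph)
    (m : R) K (G : sgraph T) :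
  1 < m -> (forall F, F \in Fs -> m <= m2 R F) -> (forall F, F \in Fs -> (tag F <= K)%N) ->
  list_Ramsey Fs 2 G ->
  exists2 pq : ({set T} -> nat) * ({set T} -> nat), (forall e, pq.1 e != pq.2 e) &
    ~ colourable (critK m K) pq.1 pq.2 (edges G).
Proof.
move=> m1 hm hK [L [hL hchi]].
have /choice[pq hpq] : forall e : {set T}, exists ab : nat * nat,
    ab.1 != ab.2 /\ (e \in edges G -> ab.1 \in L e /\ ab.2 \in L e).
  move=> e; case: (boolP (e \in edges G)) => [/hL/fset2_pair[a [b [ab aL bL]]]|_].
    by exists (a, b).
  by exists (0%N, 1%N).
exists (fun e => (pq e).1, fun e => (pq e).2) => [e|[chi lchi /goodP gchi]] /=.
  by have [] := hpq e.
have [|F FFs cp] := hchi chi.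
  move=> e eG; have [_ /(_ eG)[h1 h2]] := hpq e.
  by case: (lchi e) => ->.
have [C [sC /andP[cC kC] mC]] := mono_copy_crit m1 (hm _ FFs) cp.
have kCK : critK m K C by rewrite /critK cC (leq_trans kC) ?hK.
by case/negP: (gchi C sC kCK).
Qed.

(** * Minimal non-colourable graphs *)

Section MinimalNonColourable.
Variables (R : realType) (T : finType) (m : R) (K : nat).
Implicit Types (C D E F G U X Y : {set {set T}}) (e f g : {set T}).
Variables (p q : {set T} -> nat) (X : {set {set T}}).
Hypothesis m1 : 1 < m.
Hypothesis pq : forall e, p e != q e.
Hypothesis pX : pairs X.
Hypothesis nX : ~ colourable (critK m K) p q X.
Hypothesis minX : forall V : {set {set T}}, V \proper X -> colourable (critK m K) p q V.

(** Colour [X] without [e]. Either colour of [e] completes a monochromatic critical graph, and these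
    two graphs differ because their edges other than [e] have different colours; so one of them is
    not [C]. *)
Lemma edge_in_two e C : e \in X ->
  exists D, [/\ D \subset X, critK m K D, e \in D & D != C].
Proof.
move=> eX; have [chi lchi /goodP gchi] := minX (properD1 eX).
have ext c : c = p e \/ c = q e -> exists D, [/\ D \subset X, critK m K D, e \in D &
    forall f, f \in D -> f != e -> chi f = c].
  move=> hc; pose chi' f := if f == e then c else chi f.
  have /negP/not_goodP[D [sD cD mD]] : ~ good (critK m K) chi' X.
    move=> g; apply: nX; exists chi' => // f; rewrite /chi'.
    by case: eqP => [->|].
  have eD : e \in D.
    apply: contraLR mD => eD; rewrite (mono_eq_in (chi' := chi)); last first.
      by move=> f fD; rewrite /chi' ifN //; apply: contraNneq eD => <-.
    by apply: gchi => //; rewrite subsetD1 sD.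
  have /monoP[c' hc'] := mD; exists D; split => // f fD fe.
  by have := hc' _ fD; have := hc' _ eD; rewrite /chi' eqxx (negPf fe) => -> ->.
have [D1 [s1 c1 e1 h1]] := ext (p e) (or_introl erefl).
have [D2 [s2 c2 e2 h2]] := ext (q e) (or_intror erefl).
case: (eqVneq D1 C) => [DC|]; last by exists D1.
exists D2; split => //; apply/eqP => DC2.
have : (1 < #|D1|)%N by apply: leq_trans (crit_card m1 (critK_crit c1)).
move=> /card_gt1P[a [b [a1 b1 ab]]].
have [f f1 fe] : exists2 f, f \in D1 & f != e.
  by case: (eqVneq a e) => [ae|]; [exists b; rewrite // -ae eq_sym|exists a].
have f2 : f \in D2 by rewrite DC2 -DC.
by have := pq e; rewrite -(h1 _ f1 fe) (h2 _ f2 fe) eqxx.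
Qed.

(** Otherwise every critical graph lies in [U] or shares no edge with it, so the sparse graph [U]
    and the smaller graph [X :\: U] could be coloured separately. *)
Lemma not_closed U : U \subset X -> U != set0 ->
  (forall Y, Y \subset U -> #|Y|%:R <= m * #|cover Y|%:R) ->
  exists D, [/\ D \subset X, critK m K D, D :&: U != set0 & ~~ (D \subset U)].
Proof.
move=> sU U0 spU; apply: contrapT => hn.
have pV : X :\: U \proper X.
  rewrite properE subsetDl; have [e eU] := set0Pn _ U0.
  by apply/subsetPn; exists e; rewrite ?(subsetP sU) // inE eU.
have [chi1 l1 /goodP g1] := minX pV.
have [chi2 l2 /goodP g2] := sparse_colourable m1 pq (pairs_sub sU pX) spU.
apply: nX; exists (fun e => if e \in U then chi2 e else chi1 e) => [e|].
  by case: ifP.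
apply/goodP => C sC cC; case: (boolP (C :&: U == set0)) => [/eqP CU|CU].
  have nC e : e \in C -> e \notin U.
    by move=> eC; apply/negP => eU; have := in_set0 e; rewrite -CU inE eC eU.
  rewrite (mono_eq_in (chi' := chi1)); last by move=> e /nC /negPf ->.
  apply: g1 => //; apply/subsetP => e eC.
  by rewrite inE nC // (subsetP sC).
have sCU : C \subset U.
  by apply: contrapT => /negP nCU; apply: hn; exists C.
rewrite (mono_eq_in (chi' := chi2)); last by move=> e /(subsetP sCU) ->.
by apply: g2 => //; exact: critK_crit cC.
Qed.

End MinimalNonColourable.

Lemma not_colourable_reach (R : realType) (T : finType) (m : R) (K B N L : nat)
    (p q : {set T} -> nat) (G : {set {set T}}) :
  1 < m -> (forall e, p e != q e) -> pairs G ->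
  ~ colourable (critK m K) p q G -> (1 + 2 ^ K.+1 * (K.+1 * N) <= B)%N ->
  (exists2 Y : {set {set T}}, Y \subset G & (#|Y| <= B)%N && (m * #|cover Y|%:R < #|Y|%:R)) \/
  (exists2 e, e \in G & reach m K B L N G [set e]%SET).
Proof.
move=> m1 pq pG nG hB; case: (pselect (exists2 Y : {set {set T}}, Y \subset G &
  (#|Y| <= B)%N && (m * #|cover Y|%:R < #|Y|%:R))) => [|nY]; [by left|right].
have [X [sX nX minX]] : exists X : {set {set T}}, [/\ X \subset G,
    ~ colourable (critK m K) p q X &
    forall V : {set {set T}}, V \proper X -> colourable (critK m K) p q V].
  have [n] := ubnP #|G|; elim: n => // n IH in G nG {pG nY} * => cG.
  case: (pselect (exists2 V : {set {set T}}, V \proper G & ~ colourable (critK m K) p q V)) => [[V pV nV]|h].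
    have [|X [sX nX minX]] := IH V nV; first exact: leq_trans (proper_card pV) _.
    by exists X; split => //; apply: subset_trans sX (proper_sub pV).
  by exists G; split => // V pV; apply: contrapT => nV; apply: h; exists V.
have [X0|[e eX]] := set_0Vmem X.
  case: nX; exists p => [e|]; first by left.
  apply/goodP => C; rewrite X0 subset0 => /eqP -> /critK_crit /(crit_card m1).
  by rewrite cards0.
have pX := pairs_sub sX pG.
exists e; first exact: (subsetP sX).
apply: (@reach_explored _ _ m K m1 B N G X pX sX _ _ hB L N _ 0 0) => //.
- by move=> f C fX _; exact: (edge_in_two m1 pq nX minX).
- move=> U sU U0 cU; apply: (not_closed m1 pq pX nX minX) => // Y sY.
  rewrite leNgt; apply/negP => hY; apply: nY; exists Y.
    exact: subset_trans sY (subset_trans sU sX).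
  by rewrite hY andbT (leq_trans (subset_leq_card sY)).
- by rewrite sub1set.
- by apply/set0Pn; exists e; rewrite inE.
- by rewrite cards1.
Qed.

(** * Asymptotic estimates *)

Section Asymptotics.
Variable R : realType.
Implicit Types (m d c x : R) (n k a w : nat).

(** Only finitely many pairs occur, so the strict gains of degenerate steps and of too dense graphs
    are bounded away from zero; [e / m] becomes the exponent of [n]. *)
Lemma bounded_gap m k : exists2 e : R, 0 < e &
  forall a w, (a <= k)%N -> (w <= k)%N -> m * w%:R < a%:R -> m * w%:R + e <= a%:R.
Proof.
pose P (aw : 'I_k.+1 * 'I_k.+1) := m * aw.2%:R < aw.1%:R.
pose f (aw : 'I_k.+1 * 'I_k.+1) : R := aw.1%:R - m * aw.2%:R.
exists (\big[Order.min/1]_(aw | P aw) f aw).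
  by rewrite lt_bigmin // => aw; rewrite /P /f subr_gt0.
move=> a w ak wk h.
pose aw := (Ordinal (ak : (a < k.+1)%N), Ordinal (wk : (w < k.+1)%N)).
have := @bigmin_le_cond _ _ _ 1 aw P f h.
by rewrite {2}/f /=; lra.
Qed.

Lemma expr_bernoulli x n : 0 <= x -> 1 + n%:R * x <= (1 + x) ^+ n.
Proof.
move=> x0; elim: n => [|n IH]; first by rewrite expr0 mul0r addr0.
rewrite exprS -natr1.
have : 0 <= n%:R * x * x by rewrite !mulr_ge0.
have : (1 + x) * (1 + n%:R * x) <= (1 + x) * (1 + x) ^+ n.
  by rewrite ler_wpM2l // addr_ge0.
by lra.
Qed.

Lemma log_le_powR d : 0 < d -> exists2 c, 0 < c &
  forall n, (0 < n)%N -> (trunc_log 2 n).+1%:R <= c * n%:R `^ d.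
Proof.
move=> d0; pose a : R := 2 `^ d.
have a1 : 1 < a.
  have := @gt0_ltr_powR R d d0 1 2; rewrite powR1; apply; rewrite ?nnegrE //.
  by rewrite ltr1n.
exists ((a - 1)^-1 + 1); first by rewrite addr_gt0 // invr_gt0; lra.
move=> n n0; set j := trunc_log 2 n.
have /andP[jn _] := trunc_log_bounds (isT : (1 < 2)%N) n0.
have h : a ^+ j <= n%:R `^ d.
  rewrite /a -powR_mulrn ?powR_ge0 // -powRrM mulrC powRrM powR_mulrn //.
  apply: (ge0_ler_powR (ltW d0)); rewrite ?nnegrE ?exprn_ge0 //.
  by rewrite -natrX ler_nat.
have hb := @expr_bernoulli (a - 1) j; rewrite [X in X ^+ j]addrC subrK in hb.
have : 1 + j%:R * (a - 1) <= n%:R `^ d by apply: le_trans h; apply: hb; lra.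
have n1 : 1 <= n%:R `^ d.
  by rewrite -[leLHS](powRr0 n%:R) ler_powR ?ler1n // ltW.
move=> hj; rewrite mulrDl mul1r -natr1.
apply: lerD => //; rewrite mulrC ler_pdivlMr; last by lra.
by lra.
Qed.

Lemma natr_powR_cvg0 d : 0 < d -> (((n%:R `^ (- d) : R) @[n --> \oo])%R --> (0 : R))%classic.
Proof.
move=> d0; apply/cvgrPdist_lt => e e0.
near=> n.
have n0 : (0 < n)%N by near: n; exact: nbhs_infty_gt.
have n0R : 0 < n%:R :> R by rewrite ltr0n.
rewrite sub0r normrN ger0_norm ?powR_ge0 // powRN.
have h : e^-1 < n%:R `^ d.
  have -> : e^-1 = (e^-1 `^ d^-1) `^ d.
    by rewrite -powRrM mulVf ?powRr1 ?invr_ge0 ?ltW // gt_eqF.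
  apply: (gt0_ltr_powR d0); rewrite ?nnegrE ?powR_ge0 //.
  near: n; exact: nbhs_infty_gtr.
rewrite -[ltRHS]invrK ltf_pV2 ?posrE ?powR_gt0 ?invr_gt0 //.
Unshelve. all: by end_near.
Qed.

Lemma powR_natr_inv n d w : (0 < n)%N -> n%:R `^ (- (w%:R + d)) = n%:R `^ (- d) / n%:R ^+ w :> R.
Proof.
move=> n0; have n0R : n%:R != 0 :> R by rewrite pnatr_eq0 -lt0n.
rewrite opprD powRD ?n0R ?implybT // mulrC; congr (_ * _).
by rewrite powRN powR_mulrn.
Qed.

Section EdgeProbability.
Variables (m c p : R) (n : nat).
Hypothesis m1 : 1 < m.
Hypothesis n0 : (0 < n)%N.
Hypothesis c01 : 0 <= c <= 1.
Hypothesis p0 : 0 <= p.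
Hypothesis hp : p <= c * n%:R `^ (- m^-1).

Lemma expr_edge_prob a : p ^+ a <= c ^+ a * n%:R `^ (- (a%:R / m)).
Proof.
have /andP[c0 _] := c01.
have -> : n%:R `^ (- (a%:R / m)) = (n%:R `^ (- m^-1)) ^+ a :> R.
  by rewrite -powR_mulrn ?powR_ge0 // -powRrM mulNr mulrC.
rewrite -exprMn; apply: lerXn2r => //.
by rewrite nnegrE mulr_ge0 ?powR_ge0.
Qed.

Lemma edge_prob_gain a w e : m * w%:R + e <= a%:R ->
  p ^+ a <= n%:R `^ (- (e / m)) / n%:R ^+ w.
Proof.
have /andP[c0 c1] := c01; have m0 : 0 < m by apply: lt_trans m1.
move=> h; apply: le_trans (expr_edge_prob a) _.
rewrite -powR_natr_inv //.
apply: le_trans (_ : n%:R `^ (- (a%:R / m)) <= _).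
  by rewrite ler_piMl ?powR_ge0 // exprn_ile1.
apply: ler_powR; first by rewrite ler1n.
by rewrite lerN2 ler_pdivlMr // mulrDl divfK ?gt_eqF // mulrC.
Qed.

Lemma edge_prob_exact a w : (0 < a)%N -> a%:R = m * w%:R -> p ^+ a <= c / n%:R ^+ w.
Proof.
have /andP[c0 c1] := c01; have m0 : 0 < m by apply: lt_trans m1.
move=> a0 h; apply: le_trans (expr_edge_prob a) _.
have -> : a%:R / m = w%:R by rewrite h mulrAC mulfV ?mul1r // gt_eqF.
rewrite powRN powR_mulrn // ler_wpM2r ?invr_ge0 ?exprn_ge0 //.
by case: a a0 {h} => // a _; rewrite exprS ler_piMr // exprn_ile1.
Qed.

End EdgeProbability.

End Asymptotics.

Lemma Pr_gnp_le (R : realType) n (p : R) (A : set (sgraph 'I_n)) (B : pred {set {set 'I_n}}) :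
  0 <= p <= 1 -> (forall G, G \in A -> B (edges G)) -> Pr_gnp p A <= Pr p B.
Proof.
move=> p01 hAB; pose D := [set G : sgraph 'I_n | G \in A]%SET.
pose I := [set edges G | G in D]%SET.
have -> : Pr_gnp p A = \sum_(E in I) weight p E.
  rewrite big_imset /=; last by move=> G H _ _; exact: val_inj.
  rewrite /Pr_gnp; apply: eq_big => [G|G _]; first by rewrite inE.
  by rewrite /weight card_ord.
rewrite /Pr [leLHS]big_mkcond [leRHS]big_mkcond; apply: ler_sum => E _.
case: ifPn => [/imsetP[G GD ->]|_]; last by case: ifP => // _; exact: weight_ge0.
have -> : pairs (edges G) by case: (G).
by rewrite hAB //; rewrite inE in GD.
Qed.

Lemma card_cover_pairs (T : finType) (E : {set {set T}}) : pairs E -> (#|cover E| <= 2 * #|E|)%N.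
Proof.
move=> /pairsP pE; apply: leq_trans (leq_card_cover E) _.
by rewrite (eq_bigr (fun=> 2%N)) // sum_nat_const mulnC.
Qed.

(** * The union bound for fixed [n] *)

Section FixedOrder.
Variables (R : realType) (Fs : seq graph) (m c p e1 e2 : R) (n K B N L : nat).
Hypothesis m1 : 1 < m.
Hypothesis n0 : (0 < n)%N.
Hypothesis c01 : 0 <= c <= 1.
Hypothesis p01 : 0 <= p <= 1.
Hypothesis hp : p <= c * n%:R `^ (- m^-1).
Hypothesis hm : forall F, F \in Fs -> m <= m2 R F.
Hypothesis hK : forall F, F \in Fs -> (tag F <= K)%N.
Hypothesis hB : (1 + 2 ^ K.+1 * (K.+1 * N) <= B)%N.
Hypothesis gap1 : forall a w, (a <= 2 ^ K)%N -> (w <= 2 ^ K)%N ->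
  m * w%:R < a%:R -> m * w%:R + e1 <= a%:R.
Hypothesis gap2 : forall a w, (a <= 2 * B)%N -> (w <= 2 * B)%N ->
  m * w%:R < a%:R -> m * w%:R + e2 <= a%:R.

Let T := 'I_n.
(** A regular step shares just the two vertices of [f], so [rho] is independent of the size of the
    explored graph. A degenerate step may share any of the at most [2 * M] explored vertices, which
    puts a power of [log n] into [eta]. *)
Let rho := c * (near_const K 2)%:R.
Let M := (1 + 2 ^ K.+1 * L)%N.
Let eta := n%:R `^ (- (e1 / m)) * (near_const K (2 * M))%:R.

Lemma ramsey_union_bound :
  Pr_gnp p (@list_Ramsey Fs 2 T) <=
    \sum_(Y : {set {set T}} | [&& pairs Y, (#|Y| <= B)%N & m * #|cover Y|%:R < #|Y|%:R]) p ^+ #|Y|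
    + \sum_(e : {set T} | #|e| == 2%N) Pr p (fun G => reach m K B L N G [set e]%SET).
Proof.
pose A1 (E : {set {set T}}) := [exists Y : {set {set T}},
  [&& pairs Y, (#|Y| <= B)%N & m * #|cover Y|%:R < #|Y|%:R] && (Y \subset E)].
pose A2 (E : {set {set T}}) := [exists e : {set T}, (#|e| == 2%N) && reach m K B L N E [set e]%SET].
apply: le_trans (Pr_gnp_le (B := fun E => A1 E || A2 E) p01 _) _.
  move=> G; rewrite in_setE => /(list_Ramsey_not_colourable m1 hm hK)[[q r] /= qr nG].
  have pG : pairs (edges G) by case: (G).
  have [[Y sY /andP[cY dY]]|[e eG re]] := not_colourable_reach L m1 qr pG nG hB.
    by apply/orP; left; apply/existsP; exists Y; rewrite (pairs_sub sY pG) cY dY.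
  by apply/orP; right; apply/existsP; exists e; rewrite (pairsP _ pG _ eG) eqxx.
apply: le_trans (Pr_or p01 (B := A1) (C := A2) _) _ => //; apply: lerD.
  apply: le_trans (Pr_cover p01 (P := fun Y : {set {set T}} =>
     [&& pairs Y, (#|Y| <= B)%N & m * #|cover Y|%:R < #|Y|%:R]) (B := fun Y E => Y \subset E) _) _.
    by move=> E /existsP[Y /andP[]]; exists Y.
  by apply: ler_sum => Y /and3P[pY _ _]; rewrite Pr_superset.
apply: (Pr_cover p01 (P := fun e : {set T} => #|e| == 2%N)
  (B := fun e G => reach m K B L N G [set e]%SET)).
by move=> E /existsP[e /andP[]]; exists e.
Qed.

Let T0 : (0 < #|T|)%N. Proof. by rewrite card_ord. Qed.
Let TE : #|T|%:R = n%:R :> R. Proof. by rewrite card_ord. Qed.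
Let p0 : 0 <= p. Proof. by case/andP: p01. Qed.

Lemma dense_sum :
  \sum_(Y : {set {set T}} | [&& pairs Y, (#|Y| <= B)%N & m * #|cover Y|%:R < #|Y|%:R]) p ^+ #|Y|
    <= n%:R `^ (- (e2 / m)) * (near_const (2 * B) 0)%:R.
Proof.
apply: (sum_near (Z := set0)) => //; rewrite ?powR_ge0 ?cards0 //.
  move=> Y /and3P[pY cY _]; apply: leq_trans (card_cover_pairs pY) _.
  by rewrite leq_mul2l.
move=> Y /and3P[pY cY dY]; rewrite TE setD0.
apply: (edge_prob_gain m1 n0 c01 p0 hp); apply: gap2 => //.
  by apply: leq_trans cY _; rewrite leq_pmull.
by apply: leq_trans (card_cover_pairs pY) _; rewrite leq_mul2l.
Qed.

Lemma degen_sum_le (U : {set {set T}}) : pairs U -> (#|U| <= M)%N ->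
  \sum_(D | degen m K U D) p ^+ #|D :\: U| <= eta.
Proof.
move=> pU cU; apply: (sum_near (Z := cover U)) => //; rewrite ?powR_ge0 //.
- by apply: leq_trans (card_cover_pairs pU) _; rewrite leq_mul2l.
- by move=> D /and4P[/andP[]].
move=> D dD; rewrite TE; have kD : critK m K D by case/and4P: dD.
apply: (edge_prob_gain m1 n0 c01 p0 hp); apply: gap1.
- by apply: leq_trans (critK_size kD); rewrite subset_leq_card ?subsetDl.
- apply: leq_trans (_ : K <= _)%N; last by apply: ltnW; exact: ltn_expl.
  by case/andP: kD => _; apply: leq_trans; rewrite subset_leq_card ?subsetDl.
exact: (degen_gain m1 pU dD).
Qed.

Lemma reg_sum_le (U : {set {set T}}) f : pairs U -> f \in U ->
  \sum_(D | reg m K U f D) p ^+ #|D :\: U| <= rho.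
Proof.
have /andP[c0 _] := c01.
move=> pU fU; have cf := pairsP _ pU _ fU.
apply: (sum_near (Z := f)) => //; first by rewrite cf.
  by move=> D /and5P[/andP[]].
move=> D rD; rewrite TE; have hD := reg_gain m1 pU rD.
apply: (edge_prob_exact m1 c01 p0 hp _ hD).
rewrite -(ltr_nat R) hD mulr_gt0 //; first by apply: lt_trans m1.
rewrite ltr0n; case/and5P: rD => /andP[cD _] _ fD _ _.
have := crit_cover cD; rewrite -(cardsID f (cover D)) (setIidPr (sub_cover fD)) cf.
by case: #|_ :\: _|.
Qed.

Lemma ramsey_prob_le : (0 < B)%N -> B%:R * rho <= 16^-1 -> rho <= 1 ->
  Pr_gnp p (@list_Ramsey Fs 2 T) <=
    n%:R `^ (- (e2 / m)) * (near_const (2 * B) 0)%:R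
    + n%:R ^+ 2 * ((16^-1 + 2 * eta) ^+ L + (4 * eta) ^+ N).
Proof.
have /andP[c0 _] := c01; have /andP[_ p1] := p01.
move=> B0 Br r1; apply: le_trans ramsey_union_bound _; apply: lerD; first exact: dense_sum.
have eta0 : 0 <= eta by rewrite mulr_ge0 ?powR_ge0.
have r0 : 0 <= rho by rewrite mulr_ge0.
have Br0 : 0 <= B%:R * rho by rewrite mulr_ge0.
apply: le_trans (_ : \sum_(e : {set T} | #|e| == 2%N) ((16^-1 + 2 * eta) ^+ L + (4 * eta) ^+ N) <= _).
  apply: ler_sum => e ce.
  have pe : pairs [set e]%SET.
    by apply/pairsP => f; rewrite inE => /eqP ->; apply/eqP.
  have rho01 : 0 <= rho <= 1 by rewrite r0.
  have Br2 : B%:R * rho <= 1 / 2 by lra.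
  have se : (#|[set e]%SET| + 2 ^ K.+1 * L <= M)%N by rewrite cards1.
  apply: le_trans (Pr_reach p01 degen_sum_le reg_sum_le eta0 rho01 B0 Br2 N pe se) _.
  rewrite cards1 expr1; apply: le_trans (_ : 1 * _ <= _).
    by apply: ler_wpM2r => //; rewrite addr_ge0 ?exprn_ge0 //; lra.
  by rewrite mul1r lerD2r lerXn2r ?nnegrE //; lra.
rewrite sumr_const -[leLHS]mulr_natl ler_wpM2r //.
  by rewrite addr_ge0 ?exprn_ge0 //; lra.
rewrite -natrX ler_nat; apply: leq_trans (_ : #|[set A : {set T} | #|A| == 2%N]%SET| <= _)%N.
  by apply: subset_leq_card; apply/subsetP => e; rewrite !inE.
by rewrite card_draws card_ord bin_le_exp.
Qed.

End FixedOrder.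

Local Open Scope classical_set_scope.

Lemma near_const_log_le (R : realType) k (d : R) : 0 < d -> exists2 A : R, 0 < A &
  forall n, (0 < n)%N ->
    (near_const k (2 * (1 + 2 ^ k.+1 * (trunc_log 2 n).+1)))%:R <= A * n%:R `^ d.
Proof.
(* The size enters with the power [k], and [th * k <= d]; the denominator is positive even for
   [k = 0]. *)
move=> d0; pose th := d / k.+1%:R.
have th0 : 0 < th by rewrite divr_gt0 ?ltr0n.
have [c c0 hc] := log_le_powR th0.
pose a : R := (2 ^ k.+3)%:R * c.
have a0 : 0 < a by rewrite mulr_gt0 // ltr0n expn_gt0.
exists ((k.+1 * k.+1 * 2 ^ 2 ^ k)%:R * a ^+ k).
  by rewrite mulr_gt0 ?exprn_gt0 // ltr0n !muln_gt0 expn_gt0.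
move=> n n0; set L := (trunc_log 2 n).+1.
have nR1 : 1 <= n%:R :> R by rewrite ler1n.
have sz : ((2 * (1 + 2 ^ k.+1 * L)).+1 <= 2 ^ k.+3 * L)%N.
  have : (1 <= 2 ^ k)%N by rewrite expn_gt0.
  rewrite !expnS; set b := (2 ^ k)%N; rewrite /L; set l := trunc_log _ _ => b1.
  by nia.
have szR : (2 * (1 + 2 ^ k.+1 * L)).+1%:R <= a * n%:R `^ th.
  apply: le_trans (_ : (2 ^ k.+3 * L)%:R <= _); first by rewrite ler_nat.
  by rewrite natrM -mulrA ler_wpM2l // hc.
rewrite /near_const; set z := (2 * _)%N in szR *.
have -> : (k.+1 * (k.+1 * z.+1 ^ k * 2 ^ 2 ^ k))%:R
    = (k.+1 * k.+1 * 2 ^ 2 ^ k)%:R * z.+1%:R ^+ k :> R.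
  by rewrite -natrX -natrM; congr (_%:R); rewrite -!mulnA; congr (_ * (_ * _))%N; rewrite mulnC.
rewrite -mulrA ler_wpM2l //; apply: le_trans (_ : (a * n%:R `^ th) ^+ k <= _).
  by apply: lerXn2r; rewrite ?nnegrE ?mulr_ge0 ?powR_ge0 // ltW.
rewrite exprMn ler_wpM2l ?exprn_ge0 ?(ltW a0) //.
rewrite -powR_mulrn ?powR_ge0 // -powRrM ler_powR //.
rewrite /th -mulrA ler_piMr ?(ltW d0) // mulrC ler_pdivrMr ?ltr0n //.
by rewrite mul1r ler_nat.
Qed.

Theorem mainTheorem2 (R : realType) (Fs : seq graph)
    (hm2 : 1 < m2_family R Fs) :
  exists2 c0 : R, 0 < c0 &
    forall p : nat -> R,
      (forall n, 0 <= p n <= 1) ->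
      (forall n, (0 < n)%N -> p n <= c0 * n%:R `^ (- (m2_family R Fs)^-1)) ->
      Pr_gnp (p n) (@list_Ramsey Fs 2 'I_n) @[n --> \oo] --> (0 : R).
Proof.
set m := m2_family R Fs in hm2 *.
have m0 : 0 < m by apply: lt_trans hm2.
pose K := \max_(F <- Fs) tag F.
have hK F : F \in Fs -> (tag F <= K)%N by move=> FFs; exact: leq_bigmax_seq.
have hm F : F \in Fs -> m <= m2 R F by exact: m2_family_le.
have [e1 e10 gap1] := bounded_gap m (2 ^ K).
pose d := e1 / m; have d0 : 0 < d by rewrite divr_gt0.
(* [4 eta] will be of order [n^(-d/2)]; since [N d / 2 > 3], its [N]-th power beats the [n ^ 2]
   starting edges with a factor [1 / n] to spare. *)
pose N := (Num.truncn (6 / d)).+1.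
have hN : 6 < N%:R * d by rewrite -ltr_pdivrMr // truncnS_gt.
pose B := (1 + 2 ^ K.+1 * (K.+1 * N))%N.
have [e2 e20 gap2] := bounded_gap m (2 * B).
have q0 : (0 < near_const K 2)%N by rewrite !muln_gt0 !expn_gt0.
have s1 : 1 <= (16 * B * near_const K 2)%:R :> R by rewrite ler1n muln_gt0 q0 andbT.
(* This makes [B rho = 1/16]. With [eta <= 1/32] a round costs at most 1/8, and [8^(-L) <= n^(-3)]
   because [L] exceeds the binary logarithm of [n]. *)
pose c : R := (16 * B * near_const K 2)%:R^-1.
have c0 : 0 < c by rewrite invr_gt0; apply: lt_le_trans s1.
exists c => // p p01 hp.
(* Half of the gain [d] pays for the power of [log n] in the number of possible degenerate steps. *)
have dd0 : 0 < d / 2 by rewrite divr_gt0.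
have [A A0 hA] := near_const_log_le K dd0.
pose g n := n%:R `^ (- (e2 / m)) * (near_const (2 * B) 0)%:R + (1 + (4 * A) ^+ N) * n%:R `^ (- 1) : R.
have g0 : g n @[n --> \oo] --> (0 : R).
  rewrite -[X in _ --> X](addr0 0); apply: cvgD.
    rewrite -[X in _ --> X](mul0r (near_const (2 * B) 0)%:R).
    by apply: cvgMl; apply: natr_powR_cvg0; rewrite divr_gt0.
  rewrite -[X in _ --> X](mulr0 (1 + (4 * A) ^+ N)).
  by apply: cvgMr; exact: natr_powR_cvg0.
apply: (squeeze_cvgr (f := fun=> 0) (h := g)) => //; last exact: cvg_cst.
have A32 : 0 < (32 * A)^-1 by rewrite invr_gt0 mulr_gt0.
near=> n; apply/andP; split.
  by apply: sumr_ge0 => G _; have /andP[? ?] := p01 n; rewrite mulr_ge0 ?exprn_ge0 ?subr_ge0.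
have n0 : (0 < n)%N by near: n; exact: nbhs_infty_gt.
have nR0 : 0 < n%:R :> R by rewrite ltr0n.
have nR1 : 1 <= n%:R :> R by rewrite ler1n.
have nz : n%:R != 0 :> R by rewrite gt_eqF.
have small : n%:R `^ (- (d / 2)) < (32 * A)^-1.
  have -> : n%:R `^ (- (d / 2)) = `|n%:R `^ (- (d / 2))| :> R.
    by rewrite ger0_norm ?powR_ge0.
  by near: n; apply: (cvgr0_norm_lt _ (natr_powR_cvg0 dd0)).
pose L := (trunc_log 2 n).+1.
pose eta := n%:R `^ (- d) * (near_const K (2 * (1 + 2 ^ K.+1 * L)))%:R : R.
have eta0 : 0 <= eta by rewrite mulr_ge0 ?powR_ge0.
have etaA : eta <= A * n%:R `^ (- (d / 2)).
  apply: le_trans (_ : n%:R `^ (- d) * (A * n%:R `^ (d / 2)) <= _).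
    by rewrite ler_wpM2l ?powR_ge0 // hA.
  rewrite mulrCA ler_wpM2l ?(ltW A0) // -powRD ?nz ?implybT //.
  by rewrite ler_powR //; lra.
have eta32 : eta <= 32^-1.
  apply: le_trans etaA _; apply: le_trans (_ : A * (32 * A)^-1 <= _).
    by rewrite ler_wpM2l ?ltW.
  by rewrite invfM mulrCA mulfV ?mulr1 ?gt_eqF.
have qE : B%:R * (c * (near_const K 2)%:R) = 16^-1.
  have B0 : B%:R != 0 :> R by rewrite pnatr_eq0.
  have Q0 : (near_const K 2)%:R != 0 :> R by rewrite pnatr_eq0 -lt0n.
  rewrite /c natrM natrM.
  move: B0 Q0; move: B%:R (near_const K 2)%:R => b r B0 Q0.
  by field; rewrite B0 Q0.
have q1 : c * (near_const K 2)%:R <= 1.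
  have : 1 <= B%:R :> R by rewrite ler1n.
  have : 0 <= c * (near_const K 2)%:R by rewrite mulr_ge0 // ltW.
  move: qE; set r := c * _; set b := B%:R => h1 h2 h3.
  have : 0 <= (b - 1) * r by rewrite mulr_ge0 // subr_ge0.
  by lra.
have c01 : 0 <= c <= 1 by rewrite ltW //= invf_le1 // (lt_le_trans _ s1).
have := @ramsey_prob_le R Fs m c (p n) e1 e2 n K B N L hm2 n0 c01 (p01 n) (hp n n0)
  hm hK (leqnn _) gap1 gap2 isT.
rewrite qE => /(_ (lexx _) q1) /le_trans; apply.
rewrite /g lerD2l -/d -/eta.
have n2 : n%:R ^+ 2 * n%:R `^ (- 3) = n%:R `^ (- 1) :> R.
  by rewrite -powR_mulrn // -powRD ?nz ?implybT //; congr (_ `^ _); lra.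
rewrite -n2 [leRHS]mulrCA ler_wpM2l ?exprn_ge0 // [leRHS]mulrDl mul1r; apply: lerD.
  apply: le_trans (_ : (8^-1) ^+ L <= _).
    by apply: lerXn2r; rewrite ?nnegrE; lra.
  rewrite powRN (powR_mulrn 3) // -exprVn.
  have -> : 8^-1 = (2^-1) ^+ 3 :> R by lra.
  rewrite exprAC; apply: lerXn2r; rewrite ?nnegrE ?invr_ge0 ?exprn_ge0 ?invr_ge0 //.
  rewrite exprVn lef_pV2 ?posrE ?exprn_gt0 // -natrX ler_nat.
  by have /andP[_ /ltnW] := trunc_log_bounds (isT : (1 < 2)%N) n0.
apply: le_trans (_ : (4 * A * n%:R `^ (- (d / 2))) ^+ N <= _).
  by apply: lerXn2r; rewrite ?nnegrE ?mulr_ge0 ?powR_ge0 ?(ltW A0) // -mulrA ler_wpM2l.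
rewrite exprMn ler_wpM2l ?exprn_ge0 ?mulr_ge0 ?(ltW A0) //.
rewrite -powR_mulrn ?powR_ge0 // -powRrM ler_powR //.
by rewrite mulNr lerN2; lra.
Unshelve. all: by end_near.
Qed.
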